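(* Let $P=P(z,\partial_z)$ be a linear ordinary differential operator whose coefficients are holomorphic in a neighbourhood of $0$. Let $1<s<3$ and suppose $\hat u\in\mathbb{C}_{(s)}[[z]]$ satisfies $P\hat u=f$ with $f\in\mathbb{C}\{z\}$. Suppose that $g=\hat{\mathcal{B}}_{(s-1)^{-1}}\hat u$ extends holomorphically, with exponential growth of order at most $(s-1)^{-1}$, to a sector $S(\theta,\epsilon)$ for some $\theta\in[-\pi,\pi]$ and some $\epsilon>0$. Then there exist a sector $S=S(\theta,\alpha,\rho)$ with $\alpha>(s-1)\pi$ and a function $u\in\mathcal{O}_{(s)}(S)$ such that $u\approx_s\hat u$ in $S$ and $Pu=f$ in $S$.
   Context: $\mathbb{C}\{z\}$ is the ring of power series with positive radius of convergence. For $\psi\in\mathbb{R}$, $0<\alpha\le2\pi$, $0<r\le\infty$, $S(\psi,\alpha,r)=\{te^{i\varphi}:0<t<r,\ |\varphi-\psi|<\alpha/2\}$ and $S(\psi,\alpha)=S(\psi,\alpha,\infty)$. For sectors $S=\{0<|z|<r,\ \eta<\arg z<\theta\}$ and $S'=\{0<|z|<r',\ \eta'<\arg z<\theta'\}$, write $S'\subset\!\subset S$ if $0<r'<r$, $\eta<\eta'<\theta'<\theta$. $\mathbb{C}_{(s)}[[z]]$ is the set of formal series $\sum_{k\ge0}c_kz^k$ for which there are $M,C>0$ with $|c_k|\le MC^k\,k!^{\,s-1}$ for all $k\ge0$. $\mathcal{O}_{(s)}(S)$ is the set of holomorphic $f$ on $S$ such that for every $S'\subset\!\subset S$ there are $M,C>0$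 with $|f^{(k)}(z)|\le MC^k\,k!^{\,s}$ for all $k\ge0$, $z\in S'$. $u\approx_s\hat u$ in $S$, for $\hat u=\sum_k\frac{a_k}{k!}z^k$, means: for every $S'\subset\!\subset S$ there are $M,C>0$ with $|u(z)-\sum_{k=0}^{n-1}\frac{a_k}{k!}z^k|\le MC^n\,n!^{\,s-1}|z|^n$ for all $n\ge0$, $z\in S'$. Formal Borel transform of index $m>0$: $\hat{\mathcal{B}}_m\big(\sum_kc_kz^k\big)=\sum_k\frac{c_k}{\Gamma(1+k/m)}z^k$; for $\hat u\in\mathbb{C}_{(s)}[[z]]$ and $m=(s-1)^{-1}$ this series has positive radius of convergence. A function $h$ holomorphic on an infinite-radius sector $\tilde S$ has exponential growth of order (at most) $m$ in $\tilde S$ if for every infinite-radius subsector $S'=\{\eta'<\arg z<\theta'\}$ with $[\eta',\theta']$ contained in the open angular interval of $\tilde S$ there are $r,b,B>0$ with $|h(z)|\le Be^{b|z|^m}$ for $z\in S'$, $|z|>r$. *)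

(* Defs.v *)
From Stdlib Require Import Arith Factorial Reals.
From Coquelicot Require Import Coquelicot.

Open Scope R_scope.

(* {t e^(i phi) : 0 < t < sec_rad, sec_lo < phi < sec_hi}; the relation below
   between sectors compares these parameters, as in the notation S' << S, so a
   sector is kept as data rather than as a bare subset of C. *)
Record sector := Sector { sec_lo : R; sec_hi : R; sec_rad : Rbar }.

Definition in_sector (S : sector) (z : C) : Prop :=
  exists t phi : R,
    0 < t /\ Rbar_lt t (sec_rad S) /\
    sec_lo S < phi < sec_hi S /\
    z = (t * cos phi, t * sin phi).

(* S(psi, alpha, r), given by its bisecting direction and its opening *)
Definition bisected_sector (psi alpha : R) (r : Rbar) : sector :=
  Sector (psi - alpha / 2) (psi + alpha / 2) r.

Definition proper_subsector (S' S : sector) : Prop :=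
  Rbar_lt 0 (sec_rad S') /\ Rbar_lt (sec_rad S') (sec_rad S) /\
  sec_lo S < sec_lo S' /\ sec_lo S' < sec_hi S' /\ sec_hi S' < sec_hi S.

Definition holomorphic_on (D : C -> Prop) (f : C -> C) : Prop :=
  forall z : C, D z -> ex_derive (K := C_AbsRing) (V := C_NormedModule) f z.

(* [C_derive] is total; it is the complex derivative at the points where the
   function is complex differentiable, hence so are all its iterates at the
   points of an open set on which the function is holomorphic. *)
Fixpoint C_derive_n (f : C -> C) (n : nat) : C -> C :=
  match n with
  | O => f
  | Datatypes.S k => C_derive (C_derive_n f k)
  end.

Definition fact_pow (k : nat) (p : R) : R := Rpower (INR (fact k)) p.

(* A formal power series sum_k c_k z^k is its coefficient sequence c. *)
Definition fps := nat -> C.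

Definition fps_sum (c : fps) (z l : C) : Prop :=
  is_pseries (K := C_AbsRing) (V := C_NormedModule) c z l.

(* membership in C{z} *)
Definition fps_convergent (c : fps) : Prop :=
  exists r : R, 0 < r /\
    forall z : C, Cmod z < r -> exists l : C, fps_sum c z l.

Definition fps_deriv (c : fps) : fps :=
  fun k => (RtoC (INR (k + 1)) * c (k + 1)%nat)%C.

Definition fps_mul (c d : fps) : fps :=
  fun k => sum_n (G := C_AbelianMonoid) (fun i => (c i * d (k - i)%nat)%C) k.

Definition taylor (f : C -> C) : fps :=
  fun k => (C_derive_n f k (RtoC 0) / RtoC (INR (fact k)))%C.

(* P = sum_(j <= N) a_j(z) (d/dz)^j, acting on functions and, through the
   Taylor expansions of the a_j at 0, on formal power series *)
Definition diffop (N : nat) (a : nat -> C -> C) (u : C -> C) (z : C) : C :=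
  sum_n (G := C_AbelianMonoid) (fun j => (a j z * C_derive_n u j z)%C) N.

Definition diffop_fps (N : nat) (a : nat -> C -> C) (c : fps) : fps :=
  fun k => sum_n (G := C_AbelianMonoid)
    (fun j => fps_mul (taylor (a j)) (Nat.iter j fps_deriv c) k) N.

(* C_(s)[[z]] *)
Definition gevrey_fps (s : R) (c : fps) : Prop :=
  exists M K : R, 0 < M /\ 0 < K /\
    forall k : nat, Cmod (c k) <= M * K ^ k * fact_pow k (s - 1).

(* O_(s)(S) *)
Definition gevrey_on (s : R) (S : sector) (f : C -> C) : Prop :=
  holomorphic_on (in_sector S) f /\
  forall S' : sector, proper_subsector S' S ->
    exists M K : R, 0 < M /\ 0 < K /\
      forall (k : nat) (z : C), in_sector S' z ->
        Cmod (C_derive_n f k z) <= M * K ^ k * fact_pow k s.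

Definition fps_partial_sum (c : fps) (n : nat) (z : C) : C :=
  match n with
  | O => RtoC 0
  | Datatypes.S m =>
      sum_n (G := C_AbelianMonoid) (fun k => (c k * z ^ k)%C) m
  end.

(* u ~_s sum_k c_k z^k in S, where c_k stands for a_k / k! *)
Definition gevrey_asymp (s : R) (S : sector) (u : C -> C) (c : fps) : Prop :=
  forall S' : sector, proper_subsector S' S ->
    exists M K : R, 0 < M /\ 0 < K /\
      forall (n : nat) (z : C), in_sector S' z ->
        Cmod (u z - fps_partial_sum c n z)%C
          <= M * K ^ n * fact_pow n (s - 1) * Cmod z ^ n.

(* Euler's integral; meaningful for x > 0 *)
Definition Gamma (x : R) : R :=
  RInt_gen (fun t : R => Rpower t (x - 1) * exp (- t))
    (at_right 0) (Rbar_locally p_infty).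

Definition borel (m : R) (c : fps) : fps :=
  fun k => (c k / RtoC (Gamma (1 + INR k / m)))%C.

(* for S of infinite radius *)
Definition exp_growth (m : R) (S : sector) (h : C -> C) : Prop :=
  forall eta' theta' : R,
    sec_lo S < eta' -> eta' < theta' -> theta' < sec_hi S ->
    exists r b B : R, 0 < r /\ 0 < b /\ 0 < B /\
      forall z : C, in_sector (Sector eta' theta' p_infty) z -> r < Cmod z ->
        Cmod (h z) <= B * exp (b * Rpower (Cmod z) m).

(* h is a holomorphic extension to S of the sum of the series near 0 *)
Definition extends_fps (c : fps) (S : sector) (h : C -> C) : Prop :=
  holomorphic_on (in_sector S) h /\
  exists r : R, 0 < r /\
    forall z : C, in_sector S z -> Cmod z < r -> fps_sum c z (h z).

(* Main.v *)
Require Import Defs.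
From Stdlib Require Import Arith Factorial Reals Lra Lia Psatz ClassicalEpsilon.
From Coquelicot Require Import Coquelicot.

(* With p = s - 1, the solution is the Laplace transform u(z) = int e^(-t) g(z t^p) dt of g, taken along the
   two rays of argument theta +- 2 delta. Each ray gives u on a sector of opening p pi; by Cauchy's theorem
   the two functions agree on the overlap, so u lives on a sector of opening p pi + 2 delta. Since the moments
   of e^(-t) are Gamma(1 + k p) and g minus a partial sum of its series is O(C^n |zeta|^n e^(b |zeta|^(1/p))),
   u is asymptotic to the given series with Gevrey constants, and Cauchy's estimates on discs of radius
   proportional to |z| carry this over to the derivatives of u. Hence P u - f is asymptotic to the zero
   series, so it is O(exp(-c |z|^(-1/p))) on a sector of opening larger than p pi, and Watson's lemma
   makes it vanish. *)

Open Scope R_scope.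

(** * Complex derivatives and the exponential function *)

(** The substitution z = e^w makes elementary contours suffice: sectors become half-strips, rays
    become horizontal lines, and both the rotation of a ray and Watson's lemma turn into integrals
    over the boundary of a rectangle with sides parallel to the axes. Complex analysis is therefore
    developed from Goursat's lemma to Cauchy's formula on rectangles only. The price is the return
    from w to z, which needs the exponential to be injective on the strip: s < 3, that is p < 2,
    leaves room for an opening p pi + 2 delta below 2 pi. The Laplace kernel decays at least like
    e^(-4 kap |t|) as long as the angle between the ray and z stays delta away from p pi / 2. This
    budget is shared between the growth of g, the moments and the convergence of the integral; the
    radius (kap / b)^p of the sector is the one for which the growth of g costs a single share.
    Estimates of derivatives and Watson's lemma each consume a part of the opening beyond p pi,
    hence the three openings al0 > al1 > al2 in the final proof. *)

Definition cder (f : C -> C) (z l : C) : Prop :=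
  forall eps : R, 0 < eps -> exists d : R, 0 < d /\
    forall w : C, Cmod (w - z) < d ->
      Cmod (f w - f z - l * (w - z)) <= eps * Cmod (w - z).

Lemma locally_C_Cmod (P : C -> Prop) (z : C) :
  locally (T := C_UniformSpace) z P <->
  exists d : R, 0 < d /\ forall w : C, Cmod (w - z) < d -> P w.
Proof.
  split.
  - intros [e He]; exists e; split; [apply cond_pos|].
    intros w Hw; apply He. apply C_NormedModule_mixin_compat1. exact Hw.
  - intros (d & Hd & H).
    (* Balls of the product structure are squares; the one of half-side d / sqrt 2 lies in the disc
       of radius d. *)
    assert (Hd2 : 0 < d / sqrt 2) by (apply Rdiv_lt_0_compat; [lra|apply sqrt_lt_R0; lra]).
    exists (mkposreal _ Hd2). intros w Hw. apply H.
    apply C_NormedModule_mixin_compat2 in Hw. simpl in Hw.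
    replace d with (sqrt 2 * (d / sqrt 2)). exact Hw.
    field. apply Rgt_not_eq, sqrt_lt_R0; lra.
Qed.

Lemma locally_absC_Cmod (P : C -> Prop) (z : C) :
  locally (T := AbsRing_UniformSpace C_AbsRing) z P <->
  exists d : R, 0 < d /\ forall w : C, Cmod (w - z) < d -> P w.
Proof.
  split.
  - intros [e He]; exists e; split; [apply cond_pos|].
    intros w Hw; apply He. exact Hw.
  - intros (d & Hd & H). exists (mkposreal d Hd). intros w Hw. apply H. exact Hw.
Qed.

Ltac cder_is_derive_tac V f z l :=
  split;
  [ intros H; split; [apply is_linear_scal_l|];
    intros x Hx; apply (is_filter_lim_locally_unique (K := C_AbsRing) (V := AbsRing_NormedModule C_AbsRing)) in Hx;
    subst x; intros eps;
    destruct (H eps (cond_pos eps)) as (d & Hd & Hw);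
    apply (locally_absC_Cmod _ z); exists d; split; [exact Hd|];
    intros w Hw'; specialize (Hw w Hw');
    replace (norm _) with (Cmod (f w - f z - l * (w - z)))
      by (change (Cmod (f w - f z - l * (w - z)) = Cmod (f w + - f z + - ((w + - z) * l))%C); f_equal; ring);
    exact Hw
  | intros [_ H] eps Heps;
    specialize (H z (fun P HP => HP) (mkposreal _ Heps));
    apply (locally_absC_Cmod _ z) in H; destruct H as (d & Hd & H);
    exists d; split; [exact Hd|]; intros w Hw; specialize (H w Hw); simpl in H;
    replace (Cmod (f w - f z - l * (w - z))) with (norm (K := C_AbsRing) (V := V) (minus (minus (f w) (f z)) (scal (minus w z) l)));
    [exact H|change (Cmod (f w + - f z + - ((w + - z) * l))%C = Cmod (f w - f z - l * (w - z))); f_equal; ring] ].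

(* C carries two uniform structures in Coquelicot: the product one, used by [C_NormedModule], and the one
   of the absolute ring, in which the product and chain rules of Coquelicot are stated. *)
Lemma cder_is_derive (f : C -> C) (z l : C) :
  cder f z l <-> is_derive (K := C_AbsRing) (V := C_NormedModule) f z l.
Proof. cder_is_derive_tac C_NormedModule f z l. Qed.

Lemma cder_is_derive_abs (f : C -> C) (z l : C) :
  cder f z l <-> is_derive (K := C_AbsRing) (V := AbsRing_NormedModule C_AbsRing) f z l.
Proof. cder_is_derive_tac (AbsRing_NormedModule C_AbsRing) f z l. Qed.

Lemma cder_C_derive f z l : cder f z l -> C_derive f z = l.
Proof. intros H. apply is_C_derive_unique, cder_is_derive, H. Qed.

Lemma ex_derive_cder f z :
  ex_derive (K := C_AbsRing) (V := C_NormedModule) f z <-> exists l, cder f z l.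
Proof. split; intros [l Hl]; exists l; apply cder_is_derive; exact Hl. Qed.

Lemma cder_eq f z l l' : cder f z l -> l = l' -> cder f z l'.
Proof. intros H <-; exact H. Qed.

Lemma cder_ext_loc f g z l :
  (exists d, 0 < d /\ forall w, Cmod (w - z) < d -> f w = g w) -> cder f z l -> cder g z l.
Proof.
  intros (d & Hd & H) Hf eps He. destruct (Hf eps He) as (d' & Hd' & H').
  exists (Rmin d d'); split; [apply Rmin_pos; auto|].
  intros w Hw. rewrite <- !H. apply H'. apply Rlt_le_trans with (1 := Hw), Rmin_r.
  replace (z - z)%C with (RtoC 0) by ring. rewrite Cmod_0; auto.
  apply Rlt_le_trans with (1 := Hw), Rmin_l.
Qed.

Lemma cder_ext f g z l : (forall w, f w = g w) -> cder f z l -> cder g z l.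
Proof. intros H. apply cder_ext_loc. exists 1; split; [lra|auto]. Qed.

Lemma cder_const (c z : C) : cder (fun _ => c) z 0.
Proof.
  intros eps He; exists 1; split; [lra|]. intros w _.
  replace (c - c - 0 * (w - z))%C with (RtoC 0) by ring. rewrite Cmod_0.
  apply Rmult_le_pos; [lra|apply Cmod_ge_0].
Qed.

Lemma cder_id z : cder (fun w => w) z 1.
Proof.
  intros eps He; exists 1; split; [lra|]. intros w _.
  replace (w - z - 1 * (w - z))%C with (RtoC 0) by ring. rewrite Cmod_0.
  apply Rmult_le_pos; [lra|apply Cmod_ge_0].
Qed.

Lemma cder_plus f g z a b : cder f z a -> cder g z b -> cder (fun w => f w + g w)%C z (a + b).
Proof. rewrite !cder_is_derive. intros; apply @is_derive_plus; assumption. Qed.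

Lemma cder_opp f z a : cder f z a -> cder (fun w => - f w)%C z (- a).
Proof. rewrite !cder_is_derive. intros; apply @is_derive_opp; assumption. Qed.

Lemma cder_minus f g z a b : cder f z a -> cder g z b -> cder (fun w => f w - g w)%C z (a - b).
Proof. intros; apply cder_plus; [|apply cder_opp]; assumption. Qed.

Lemma cder_mult f g z a b :
  cder f z a -> cder g z b -> cder (fun w => f w * g w)%C z (a * g z + f z * b).
Proof.
  rewrite !cder_is_derive_abs. intros.
  apply (is_derive_mult (K := C_AbsRing)); try assumption. exact Cmult_comm.
Qed.

Lemma cder_comp f g z a b :
  cder f (g z) a -> cder g z b -> cder (fun w => f (g w))%C z (a * b).
Proof.
  rewrite !cder_is_derive_abs. intros.
  rewrite Cmult_comm.
  exact (is_derive_comp (V := AbsRing_NormedModule C_AbsRing) f g z a b H H0).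
Qed.

Lemma cder_scal c f z a : cder f z a -> cder (fun w => c * f w)%C z (c * a).
Proof.
  intros H. apply cder_eq with (0 * f z + c * a)%C; [|ring].
  apply cder_mult with (f := fun _ => c); [apply cder_const|exact H].
Qed.

Lemma Cmod_sub_sym (a b : C) : Cmod (a - b) = Cmod (b - a).
Proof. rewrite <- Cmod_opp. f_equal; ring. Qed.

Lemma Cmod_triangle_minus (a b : C) : Cmod (a - b) <= Cmod a + Cmod b.
Proof. unfold Cminus. rewrite <- (Cmod_opp b). apply Cmod_triangle. Qed.

Lemma Cmod_rtriangle (a b : C) : Cmod a - Cmod b <= Cmod (a - b).
Proof. generalize (Cmod_triangle (a - b) b). replace (a - b + b)%C with a by ring. lra. Qed.

Lemma Cmod_chain (a b c : C) : Cmod (a - c) <= Cmod (a - b) + Cmod (b - c).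
Proof. replace (a - c)%C with ((a - b) + (b - c))%C by ring. apply Cmod_triangle. Qed.

Lemma Cmod_neq_0 (z : C) : z <> 0 -> 0 < Cmod z.
Proof. apply Cmod_gt_0. Qed.

Lemma Cmod_pos_neq (z : C) : 0 < Cmod z -> z <> 0.
Proof. apply Cmod_gt_0. Qed.

Lemma cder_inv (z : C) : z <> 0 -> cder (fun w => / w)%C z (- / (z * z)).
Proof.
  intros Hz eps He.
  assert (Hm := Cmod_neq_0 _ Hz). set (m := Cmod z) in *.
  assert (Hk : 0 < eps * (m * m * m) / 2) by (repeat apply Rmult_lt_0_compat; lra).
  (* The error is |w - z|^2 / (|w| |z|^2). The first bound gives |w| > m / 2, the second then
     absorbs one factor |w - z| into eps. *)
  exists (Rmin (m / 2) (eps * (m * m * m) / 2)). split; [apply Rmin_pos; lra|].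
  intros w Hw.
  assert (H1 := Rlt_le_trans _ _ _ Hw (Rmin_l _ _)).
  assert (H2 := Rlt_le_trans _ _ _ Hw (Rmin_r _ _)).
  assert (Hwm : m / 2 < Cmod w).
  { generalize (Cmod_rtriangle z w). rewrite Cmod_sub_sym. fold m. lra. }
  assert (Hw0 : w <> 0) by (apply Cmod_pos_neq; lra).
  replace (/ w - / z - - / (z * z) * (w - z))%C with ((w - z) * ((w - z) * / (w * (z * z))))%C
    by (field; auto).
  rewrite !Cmod_mult, Cmod_inv, !Cmod_mult by (repeat apply Cmult_neq_0; auto). fold m.
  rewrite (Rmult_comm eps). apply Rmult_le_compat_l; [apply Cmod_ge_0|].
  apply Rmult_le_reg_r with (Cmod w * (m * m)); [repeat apply Rmult_lt_0_compat; lra|].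
  rewrite Rmult_assoc, Rinv_l, Rmult_1_r by (apply Rgt_not_eq; repeat apply Rmult_lt_0_compat; lra).
  apply Rle_trans with (eps * (m * m * m) / 2); [lra|].
  replace (eps * (m * m * m) / 2) with (eps * (m / 2 * (m * m))) by field.
  apply Rmult_le_compat_l; [lra|]. apply Rmult_le_compat_r; [|lra]. apply Rmult_le_pos; lra.
Qed.

Lemma cder_continuous f z l : cder f z l ->
  forall eps, 0 < eps -> exists d, 0 < d /\ forall w, Cmod (w - z) < d -> Cmod (f w - f z) < eps.
Proof.
  intros H eps He. destruct (H 1 Rlt_0_1) as (d & Hd & H').
  assert (Hl := Cmod_ge_0 l).
  assert (Hp : 0 < eps / (Cmod l + 2)) by (apply Rdiv_lt_0_compat; lra).
  exists (Rmin d (eps / (Cmod l + 2))); split; [apply Rmin_pos; auto|].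
  intros w Hw.
  assert (H1 := Rlt_le_trans _ _ _ Hw (Rmin_l _ _)).
  assert (H2 := Rlt_le_trans _ _ _ Hw (Rmin_r _ _)).
  replace (f w - f z)%C with ((f w - f z - l * (w - z)) + l * (w - z))%C by ring.
  apply Rle_lt_trans with (1 := Cmod_triangle _ _). rewrite Cmod_mult.
  specialize (H' w H1).
  apply Rle_lt_trans with ((Cmod l + 1) * Cmod (w - z)); [lra|].
  apply Rle_lt_trans with ((Cmod l + 1) * (eps / (Cmod l + 2))).
  apply Rmult_le_compat_l; lra.
  replace eps with ((Cmod l + 2) * (eps / (Cmod l + 2))) at 2 by (field; lra).
  apply Rmult_lt_compat_r; lra.
Qed.

Definition ccont (f : C -> C) (z : C) : Prop :=
  forall eps, 0 < eps -> exists d, 0 < d /\ forall w, Cmod (w - z) < d -> Cmod (f w - f z) < eps.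

Lemma ccont_continuous f z :
  ccont f z <-> continuous (T := C_UniformSpace) (U := C_UniformSpace) f z.
Proof.
  split.
  - intros H P HP. apply locally_C_Cmod in HP. destruct HP as (e & He & HP).
    destruct (H e He) as (d & Hd & H'). apply locally_C_Cmod. exists d; split; auto.
  - intros H eps He.
    assert (HP : locally (T := C_UniformSpace) (f z) (fun w => Cmod (w - f z) < eps)).
    { apply locally_C_Cmod. exists eps; auto. }
    specialize (H _ HP). unfold filtermap in H. apply locally_C_Cmod in H. exact H.
Qed.

Definition cexp (z : C) : C := (exp (Re z) * cos (Im z), exp (Re z) * sin (Im z)).

Lemma cexp_plus (z w : C) : cexp (z + w) = (cexp z * cexp w)%C.
Proof.
  unfold cexp, Cmult, Re, Im; simpl. rewrite exp_plus, cos_plus, sin_plus. f_equal; ring.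
Qed.

Lemma cexp_0 : cexp 0 = RtoC 1.
Proof. unfold cexp, Re, Im; simpl. rewrite exp_0, cos_0, sin_0. unfold RtoC; f_equal; ring. Qed.

Lemma Cmod_cexp (z : C) : Cmod (cexp z) = exp (Re z).
Proof.
  unfold cexp, Cmod; simpl.
  replace (exp (Re z) * cos (Im z) * (exp (Re z) * cos (Im z) * 1) + exp (Re z) * sin (Im z) * (exp (Re z) * sin (Im z) * 1)) with (exp (Re z) ^ 2 * (sin (Im z) ^ 2 + cos (Im z) ^ 2)) by ring.
  generalize (sin2_cos2 (Im z)). unfold Rsqr. intros H.
  replace (sin (Im z) ^ 2 + cos (Im z) ^ 2) with 1 by (simpl; lra).
  rewrite Rmult_1_r. rewrite sqrt_pow2; [reflexivity|apply Rlt_le, exp_pos].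
Qed.

Lemma cexp_neq_0 (z : C) : cexp z <> 0.
Proof. apply Cmod_pos_neq. rewrite Cmod_cexp. apply exp_pos. Qed.

Lemma cexp_RtoC x : cexp (RtoC x) = RtoC (exp x).
Proof. unfold cexp, Re, Im, RtoC; simpl. rewrite cos_0, sin_0. f_equal; ring. Qed.

Lemma cexp_opp (z : C) : cexp (- z) = (/ cexp z)%C.
Proof.
  assert (H : (cexp (- z) * cexp z)%C = 1).
  { rewrite <- cexp_plus. replace (- z + z)%C with (RtoC 0) by ring. apply cexp_0. }
  rewrite <- (Cmult_1_l (/ cexp z)), <- H. field. apply cexp_neq_0.
Qed.

Lemma cexp_nat (k : nat) (z : C) : cexp (RtoC (INR k) * z) = (cexp z ^ k)%C.
Proof.
  induction k. simpl. rewrite Cmult_0_l. apply cexp_0.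
  rewrite S_INR, RtoC_plus, Cmult_plus_distr_r, Cmult_1_l, cexp_plus, IHk. simpl. ring.
Qed.

Lemma is_derive_R_eps (f : R -> R) x l : is_derive f x l ->
  forall eps, 0 < eps -> exists d, 0 < d /\ forall y, Rabs (y - x) < d -> Rabs (f y - f x - l * (y - x)) <= eps * Rabs (y - x).
Proof.
  intros [_ H] eps Heps.
  specialize (H x (fun P HP => HP) (mkposreal _ Heps)).
  destruct H as [d H]. exists d; split; [apply cond_pos|]. intros y Hy.
  specialize (H y Hy). simpl in H. unfold norm, minus, plus, opp, scal in H; simpl in H. unfold abs, mult in H; simpl in H.
  replace (f y - f x - l * (y - x)) with (f y + - f x + - ((y + - x) * l)) by ring.
  exact H.
Qed.

Lemma Cmod_le_sum x y : Cmod (x, y) <= Rabs x + Rabs y.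
Proof.
  replace ((x, y) : C) with (RtoC x + Ci * RtoC y)%C.
  apply Rle_trans with (1 := Cmod_triangle _ _). rewrite Cmod_mult, Cmod_Ci, !Cmod_R. lra.
  unfold RtoC, Ci, Cmult, Cplus; simpl. f_equal; ring.
Qed.

Lemma im_le_Cmod c : Rabs (Im c) <= Cmod c.
Proof. apply Rle_trans with (2 := Rmax_Cmod c), Rmax_r. Qed.

(** Reduces to the real derivatives of exp, cos and sin at 0, by writing e^(x + iy) - 1 - (x + iy)
    as e^x (cos y - 1 + i (sin y - y)) + (e^x - 1 - x) + (e^x - 1) i y. *)
Lemma cder_cexp_0 : cder cexp 0 1.
Proof.
  intros eps He.
  (* The three terms of the splitting contribute at most 6, 1 and 1 times e |w|; the cap by 1 is
     what gives e^x <= 3. *)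
  set (e := Rmin eps 1 / 10).
  assert (Hm : 0 < Rmin eps 1) by (apply Rmin_pos; lra).
  assert (Hm1 := Rmin_l eps 1). assert (Hm2 := Rmin_r eps 1).
  destruct (is_derive_R_eps exp 0 1) with (eps := e) as (d1 & Hd1 & H1); [| unfold e; lra|].
  { rewrite <- exp_0. apply is_derive_Reals, derivable_pt_lim_exp. }
  destruct (is_derive_R_eps cos 0 0) with (eps := e) as (d2 & Hd2 & H2); [| unfold e; lra|].
  { replace 0 with (- sin 0) at 2 by (rewrite sin_0; ring). apply is_derive_Reals, derivable_pt_lim_cos. }
  destruct (is_derive_R_eps sin 0 1) with (eps := e) as (d3 & Hd3 & H3); [| unfold e; lra|].
  { rewrite <- cos_0. apply is_derive_Reals, derivable_pt_lim_sin. }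
  exists (Rmin (Rmin d1 d2) (Rmin d3 (e / 2))); split; [repeat apply Rmin_pos; unfold e; lra|].
  intros w Hw.
  replace (w - 0)%C with w in * by ring.
  apply Rmin_Rgt in Hw. destruct Hw as [Hw1 Hw2].
  apply Rmin_Rgt in Hw1. apply Rmin_Rgt in Hw2. destruct Hw1 as [Ha1 Ha2], Hw2 as [Ha3 Ha4].
  destruct w as [x y].
  assert (Hx := re_le_Cmod (x, y)). assert (Hy := im_le_Cmod (x, y)). unfold Re, Im in Hx, Hy; simpl in Hx, Hy.
  assert (Hc0 := Cmod_ge_0 (x, y)).
  set (c := Cmod (x, y)) in *.
  specialize (H1 x). specialize (H2 y). specialize (H3 y).
  rewrite exp_0 in H1. rewrite cos_0 in H2. rewrite sin_0 in H3.
  rewrite ?Rminus_0_r in *.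
  specialize (H1 ltac:(lra)). specialize (H2 ltac:(lra)). specialize (H3 ltac:(lra)).
  rewrite Rmult_0_l, Rminus_0_r in H2. rewrite Rmult_1_l in H1, H3.
  assert (He1 : e * Rabs x <= e * c) by (apply Rmult_le_compat_l; unfold e; lra).
  assert (He2 : e * Rabs y <= e * c) by (apply Rmult_le_compat_l; unfold e; lra).
  assert (He3 : 0 < e <= / 10) by (unfold e; lra).
  assert (He4 : e * c <= / 10 * c) by (apply Rmult_le_compat_r; lra).
  assert (HE : Rabs (exp x - 1) <= 2 * c).
  { replace (exp x - 1) with ((exp x - 1 - x) + x) by ring.
    apply Rle_trans with (1 := Rabs_triang _ _). lra. }
  assert (HX : exp x <= 3).
  { generalize (Rle_abs (exp x - 1)). lra. }
  rewrite cexp_0.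
  replace (cexp (x, y) - 1 - 1 * (x, y))%C with
    (RtoC (exp x) * ((cos y - 1)%R, (sin y - y)%R) + RtoC (exp x - 1 - x) + RtoC (exp x - 1) * (0%R, y))%C
    by (unfold cexp, Re, Im; apply injective_projections; simpl; ring).
  apply Rle_trans with (1 := Cmod_triangle _ _).
  eapply Rle_trans. apply Rplus_le_compat_r. apply Cmod_triangle.
  rewrite !Cmod_mult, !Cmod_R.
  rewrite (Rabs_right (exp x)) by (apply Rle_ge, Rlt_le, exp_pos).
  assert (HA := Cmod_le_sum (cos y - 1) (sin y - y)).
  assert (HB := Cmod_le_sum 0 y). rewrite Rabs_R0 in HB.
  assert (P1 : exp x * Cmod (cos y - 1, sin y - y) <= 3 * (2 * (e * c))).
  { apply Rmult_le_compat; [left; apply exp_pos|apply Cmod_ge_0|exact HX|lra]. }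
  assert (P2 : Rabs (exp x - 1) * Cmod (0, y) <= e * c).
  { apply Rmult_le_compat; [apply Rabs_pos|apply Cmod_ge_0|lra|lra]. }
  assert (P3 : 10 * e * c <= eps * c) by (apply Rmult_le_compat_r; unfold e; lra).
  assert (P4 : 0 <= e * c) by (apply Rmult_le_pos; lra).
  lra.
Qed.

Lemma cder_cexp (z : C) : cder cexp z (cexp z).
Proof.
  apply cder_ext with (fun w => cexp z * cexp (w - z))%C.
  { intros w. rewrite <- cexp_plus. f_equal; ring. }
  eapply cder_eq. apply cder_scal.
  apply cder_comp with (f := cexp) (g := fun w => (w - z)%C).
  replace (z - z)%C with (RtoC 0) by ring. apply cder_cexp_0.
  apply cder_minus. apply cder_id. apply cder_const. ring.
Qed.

Lemma cder_pow f z l n : cder f z l ->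
  cder (fun w => f w ^ n)%C z (RtoC (INR n) * f z ^ (n - 1) * l).
Proof.
  intros H. induction n as [|n IH].
  - simpl. eapply cder_eq. apply cder_const. ring.
  - eapply cder_eq. apply cder_mult with (1 := H) (2 := IH).
    rewrite S_INR, RtoC_plus. replace (S n - 1)%nat with n by lia.
    destruct n; simpl; [ring|]. replace (n - 0)%nat with n by lia. ring.
Qed.

Lemma is_derive_R_C (f : R -> C) (x : R) (l : C) :
  (forall eps, 0 < eps -> exists d, 0 < d /\ forall y, Rabs (y - x) < d ->
      Cmod (f y - f x - RtoC (y - x) * l) <= eps * Rabs (y - x)) ->
  is_derive (K := R_AbsRing) (V := C_R_NormedModule) f x l.
Proof.
  intros H. split; [apply is_linear_scal_l|].
  intros x' Hx. apply (is_filter_lim_locally_unique (K := R_AbsRing) (V := R_NormedModule)) in Hx.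
  subst x'. intros eps.
  destruct (H eps (cond_pos eps)) as (d & Hd & Hw).
  exists (mkposreal d Hd). intros y Hy. specialize (Hw y Hy).
  assert (E : forall u : C_R_NormedModule, norm (K := R_AbsRing) u = Cmod u) by (intros; symmetry; apply Cmod_norm).
  rewrite E.
  match goal with |- Cmod ?a <= _ => replace a with (f y - f x - RtoC (y - x) * l)%C end.
  exact Hw.
  unfold minus, plus, opp, scal; simpl. unfold prod_plus, prod_opp, prod_scal; simpl.
  unfold plus, opp, scal, mult; simpl. unfold mult; simpl.
  destruct l as [l1 l2]. unfold Cminus, Cplus, Copp, Cmult, RtoC. simpl. f_equal; ring.
Qed.

Lemma cder_path (f : C -> C) (a b : C) (t : R) (l : C) :
  cder f (a + RtoC t * b)%C l ->
  is_derive (K := R_AbsRing) (V := C_R_NormedModule) (fun s : R => f (a + RtoC s * b)%C) t (b * l)%C.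
Proof.
  intros H. apply is_derive_R_C. intros eps He.
  assert (Hb := Cmod_ge_0 b).
  assert (Hp : 0 < eps / (Cmod b + 1)) by (apply Rdiv_lt_0_compat; lra).
  destruct (H _ Hp) as (d & Hd & H').
  exists (d / (Cmod b + 1)). split; [apply Rdiv_lt_0_compat; lra|]. intros y Hy.
  specialize (H' (a + RtoC y * b)%C).
  replace (a + RtoC y * b - (a + RtoC t * b))%C with (RtoC (y - t) * b)%C in H' by (rewrite RtoC_minus; ring).
  rewrite Cmod_mult, Cmod_R in H'.
  replace (RtoC (y - t) * (b * l))%C with (l * (RtoC (y - t) * b))%C by ring.
  eapply Rle_trans. apply H'.
  apply Rle_lt_trans with (Rabs (y - t) * (Cmod b + 1)). apply Rmult_le_compat_l; [apply Rabs_pos|lra].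
  apply Rlt_le_trans with (d / (Cmod b + 1) * (Cmod b + 1)). apply Rmult_lt_compat_r; lra. right; field; lra.
  apply Rle_trans with (eps / (Cmod b + 1) * (Rabs (y - t) * (Cmod b + 1))).
  apply Rmult_le_compat_l; [lra|]. apply Rmult_le_compat_l; [apply Rabs_pos|lra].
  right; field; lra.
Qed.

(** * Contour integrals and Goursat's theorem *)

Definition is_cint (f : R -> C) (a b : R) (l : C) : Prop :=
  is_RInt (V := C_R_NormedModule) f a b l.

Lemma is_cint_pair (f : R -> C) (a b : R) (l : C) :
  is_cint f a b l <-> is_RInt (fun t => Re (f t)) a b (Re l) /\ is_RInt (fun t => Im (f t)) a b (Im l).
Proof.
  split.
  - intros H; split.
    apply (is_RInt_fct_extend_fst (U := R_NormedModule) (V := R_NormedModule) f a b l H).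
    apply (is_RInt_fct_extend_snd (U := R_NormedModule) (V := R_NormedModule) f a b l H).
  - intros [H1 H2]. destruct l as [l1 l2].
    apply (is_RInt_fct_extend_pair (U := R_NormedModule) (V := R_NormedModule) f a b l1 l2 H1 H2).
Qed.

Lemma is_cint_ext (f g : R -> C) (a b : R) (l : C) :
  (forall t, Rmin a b < t < Rmax a b -> f t = g t) -> is_cint f a b l -> is_cint g a b l.
Proof. apply (is_RInt_ext (V := C_R_NormedModule)). Qed.

Lemma is_cint_plus (f g : R -> C) (a b : R) (l l' : C) :
  is_cint f a b l -> is_cint g a b l' -> is_cint (fun t => f t + g t)%C a b (l + l').
Proof. apply (is_RInt_plus (V := C_R_NormedModule)). Qed.

(** [C_R_NormedModule] is a real vector space, so linearity of its integral covers real scalars; a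
    complex factor mixes the two components. *)
Lemma is_cint_scal (f : R -> C) (a b : R) (c l : C) :
  is_cint f a b l -> is_cint (fun t => c * f t)%C a b (c * l).
Proof.
  rewrite !is_cint_pair. intros [H1 H2].
  split.
  - apply is_RInt_ext with (fun t => minus (scal (Re c) (Re (f t))) (scal (Im c) (Im (f t)))); [reflexivity|].
    apply @is_RInt_minus; apply @is_RInt_scal; assumption.
  - apply is_RInt_ext with (fun t => plus (scal (Re c) (Im (f t))) (scal (Im c) (Re (f t)))); [reflexivity|].
    apply @is_RInt_plus; apply @is_RInt_scal; assumption.
Qed.

Lemma is_cint_opp (f : R -> C) (a b : R) (l : C) :
  is_cint f a b l -> is_cint (fun t => - f t)%C a b (- l).
Proof. apply (is_RInt_opp (V := C_R_NormedModule)). Qed.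

Lemma is_cint_minus (f g : R -> C) (a b : R) (l l' : C) :
  is_cint f a b l -> is_cint g a b l' -> is_cint (fun t => f t - g t)%C a b (l - l').
Proof. intros; apply is_cint_plus; [|apply is_cint_opp]; assumption. Qed.

Lemma is_cint_Chasles (f : R -> C) (a b c : R) (l l' : C) :
  is_cint f a b l -> is_cint f b c l' -> is_cint f a c (l + l').
Proof. apply (is_RInt_Chasles (V := C_R_NormedModule)). Qed.

Lemma is_cint_swap (f : R -> C) (a b : R) (l : C) : is_cint f b a l -> is_cint f a b (- l).
Proof. apply (is_RInt_swap (V := C_R_NormedModule)). Qed.

Lemma is_cint_comp_lin (f : R -> C) (u v a b : R) (l : C) :
  is_cint f (u * a + v) (u * b + v) l -> is_cint (fun y => RtoC u * f (u * y + v)%R)%C a b l.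
Proof.
  intros H. apply (is_RInt_comp_lin (V := C_R_NormedModule)) in H.
  refine (is_cint_ext _ _ _ _ _ _ H). intros t _.
  unfold scal; simpl. unfold prod_scal, scal; simpl. unfold mult; simpl.
  apply injective_projections; simpl; ring.
Qed.

Lemma is_cint_norm_le (f : R -> C) (g : R -> R) (a b : R) (l : C) (lg : R) :
  a <= b -> (forall t, a <= t <= b -> Cmod (f t) <= g t) ->
  is_cint f a b l -> is_RInt g a b lg -> Cmod l <= lg.
Proof.
  intros Hab H Hf Hg. rewrite Cmod_norm.
  refine (norm_RInt_le (V := C_R_NormedModule) f g a b l lg Hab _ Hf Hg).
  intros t Ht. rewrite <- Cmod_norm. auto.
Qed.

Lemma ccont_path (f : C -> C) (a b : C) (t : R) :
  ccont f (a + RtoC t * b)%C ->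
  continuous (U := C_R_NormedModule) (fun s : R => f (a + RtoC s * b)%C) t.
Proof.
  intros H. apply ccont_continuous in H.
  apply continuous_comp with (g := f) (f := fun s : R => (a + RtoC s * b)%C); [|exact H].
  apply (ex_derive_continuous (K := R_AbsRing) (V := C_R_NormedModule)).
  eexists. apply (cder_path (fun w => w) a b t 1). apply cder_id.
Qed.

Lemma ex_cint (f : R -> C) (a b : R) :
  (forall t, Rmin a b <= t <= Rmax a b -> continuous (U := C_R_NormedModule) f t) ->
  exists l, is_cint f a b l.
Proof. intros H. destruct (ex_RInt_continuous (V := C_R_CompleteNormedModule) f a b H) as [l Hl]. exists l; exact Hl. Qed.

(** * Integrals along segments *)

Definition is_seg (f : C -> C) (a b l : C) : Prop :=
  is_cint (fun t => (b - a) * f (a + RtoC t * (b - a)))%C 0 1 l.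

Definition on_seg (a b z : C) : Prop := exists t, 0 <= t <= 1 /\ z = (a + RtoC t * (b - a))%C.

Lemma ccont_scal f z c : ccont f z -> ccont (fun w => c * f w)%C z.
Proof.
  intros H eps He. assert (Hc := Cmod_ge_0 c).
  destruct (H (eps / (Cmod c + 1))) as (d & Hd & H'); [apply Rdiv_lt_0_compat; lra|].
  exists d; split; auto. intros w Hw. specialize (H' w Hw).
  replace (c * f w - c * f z)%C with (c * (f w - f z))%C by ring. rewrite Cmod_mult.
  apply Rle_lt_trans with (Cmod c * (eps / (Cmod c + 1))). apply Rmult_le_compat_l; lra.
  replace eps with ((Cmod c + 1) * (eps / (Cmod c + 1))) at 2 by (field; lra).
  apply Rmult_lt_compat_r; [apply Rdiv_lt_0_compat; lra|lra].
Qed.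

Lemma ccont_cder f z l : cder f z l -> ccont f z.
Proof. exact (cder_continuous f z l). Qed.

Lemma ccont_plus f g z : ccont f z -> ccont g z -> ccont (fun w => f w + g w)%C z.
Proof.
  intros Hf Hg eps He. destruct (Hf (eps / 2)) as (d & Hd & H); [lra|].
  destruct (Hg (eps / 2)) as (d' & Hd' & H'); [lra|].
  exists (Rmin d d'); split; [apply Rmin_pos; auto|]. intros w Hw.
  apply Rmin_Rgt in Hw. specialize (H w (proj1 Hw)). specialize (H' w (proj2 Hw)).
  replace (f w + g w - (f z + g z))%C with ((f w - f z) + (g w - g z))%C by ring.
  apply Rle_lt_trans with (1 := Cmod_triangle _ _). lra.
Qed.

Lemma ccont_mult f g z : ccont f z -> ccont g z -> ccont (fun w => f w * g w)%C z.
Proof.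
  intros Hf Hg eps He.
  assert (Hgz := Cmod_ge_0 (g z)). assert (Hfz := Cmod_ge_0 (f z)).
  set (K := Cmod (f z) + Cmod (g z) + 1).
  set (e := Rmin 1 (eps / (2 * K))).
  assert (Hq : 0 < eps / (2 * K)) by (apply Rdiv_lt_0_compat; unfold K; lra).
  assert (He' : 0 < e) by (apply Rmin_pos; lra).
  assert (He1 : e <= 1) by apply Rmin_l. assert (He2 : e <= eps / (2 * K)) by apply Rmin_r.
  destruct (Hf e He') as (d & Hd & H). destruct (Hg e He') as (d' & Hd' & H').
  exists (Rmin d d'); split; [apply Rmin_pos; auto|]. intros w Hw.
  apply Rmin_Rgt in Hw. specialize (H w (proj1 Hw)). specialize (H' w (proj2 Hw)).
  replace (f w * g w - f z * g z)%C with ((f w - f z) * (g w - g z) + (f w - f z) * g z + f z * (g w - g z))%C by ring.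
  eapply Rle_lt_trans. apply Cmod_triangle.
  eapply Rle_lt_trans. apply Rplus_le_compat_r. apply Cmod_triangle.
  rewrite !Cmod_mult.
  assert (A0 := Cmod_ge_0 (f w - f z)). assert (B0 := Cmod_ge_0 (g w - g z)).
  assert (P1 : Cmod (f w - f z) * Cmod (g w - g z) <= e * 1) by (apply Rmult_le_compat; lra).
  assert (P2 : Cmod (f w - f z) * Cmod (g z) <= e * Cmod (g z)) by (apply Rmult_le_compat_r; lra).
  assert (P3 : Cmod (f z) * Cmod (g w - g z) <= Cmod (f z) * e) by (apply Rmult_le_compat_l; lra).
  apply Rle_lt_trans with (e * K); [unfold K; lra|].
  apply Rle_lt_trans with (eps / (2 * K) * K). apply Rmult_le_compat_r; [unfold K; lra|exact He2].
  replace (eps / (2 * K) * K) with (eps / 2) by (field; unfold K; lra). lra.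
Qed.

Lemma ccont_const (c z : C) : ccont (fun _ => c) z.
Proof. eapply ccont_cder, cder_const. Qed.

Lemma ex_seg f a b : (forall z, on_seg a b z -> ccont f z) -> exists l, is_seg f a b l.
Proof.
  intros H. apply ex_cint. rewrite Rmin_left, Rmax_right by lra. intros t Ht.
  apply (ccont_path (fun w => (b - a) * f w)%C). apply ccont_scal. apply H. exists t; auto.
Qed.

Lemma is_seg_plus f g a b l l' : is_seg f a b l -> is_seg g a b l' ->
  is_seg (fun z => f z + g z)%C a b (l + l').
Proof.
  intros H H'. eapply is_cint_ext. 2: apply is_cint_plus; [exact H|exact H'].
  intros t _; simpl; ring.
Qed.

Lemma is_seg_scal f a b l c : is_seg f a b l -> is_seg (fun z => c * f z)%C a b (c * l).
Proof.
  intros H. eapply is_cint_ext. 2: apply is_cint_scal; exact H. intros t _; simpl; ring.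
Qed.

Lemma is_seg_minus f g a b l l' : is_seg f a b l -> is_seg g a b l' ->
  is_seg (fun z => f z - g z)%C a b (l - l').
Proof.
  intros H H'. eapply is_cint_ext. 2: apply is_cint_minus; [exact H|exact H'].
  intros t _; simpl; ring.
Qed.

Lemma is_seg_ext f g a b l : (forall z, on_seg a b z -> f z = g z) -> is_seg f a b l -> is_seg g a b l.
Proof.
  intros H Hf. eapply is_cint_ext. 2: exact Hf. rewrite Rmin_left, Rmax_right by lra.
  intros t Ht; simpl. rewrite H; [reflexivity|]. exists t; split; [lra|reflexivity].
Qed.

Lemma is_seg_bound f a b l M : is_seg f a b l ->
  (forall z, on_seg a b z -> Cmod (f z) <= M) -> Cmod l <= M * Cmod (b - a).
Proof.
  intros H HM.
  replace (M * Cmod (b - a)) with (scal (1 - 0) (Cmod (b - a) * M)) by (unfold scal; simpl; unfold mult; simpl; ring).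
  eapply is_cint_norm_le with (g := fun _ => Cmod (b - a) * M); [| |exact H|]; [lra| |].
  - intros t Ht. cbv beta; rewrite Cmod_mult. apply Rmult_le_compat_l; [apply Cmod_ge_0|].
    apply HM. exists t; auto.
  - apply @is_RInt_const.
Qed.

Lemma is_seg_ftc F f a b : (forall z, on_seg a b z -> cder F z (f z)) ->
  (forall z, on_seg a b z -> ccont f z) -> is_seg f a b (F b - F a).
Proof.
  intros HF Hf.
  replace (F b - F a)%C with (F (a + RtoC 1 * (b - a)) - F (a + RtoC 0 * (b - a)))%C
    by (f_equal; [|f_equal]; f_equal; ring).
  apply (is_RInt_derive (V := C_R_CompleteNormedModule) (fun t => F (a + RtoC t * (b - a))%C)).
  - rewrite Rmin_left, Rmax_right by lra. intros t Ht. apply cder_path. apply HF. exists t; auto.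
  - rewrite Rmin_left, Rmax_right by lra. intros t Ht.
    apply (ccont_path (fun w => (b - a) * f w)%C). apply ccont_scal. apply Hf. exists t; auto.
Qed.

Lemma is_seg_rev f a b l : is_seg f a b l -> is_seg f b a (- l).
Proof.
  intros H. unfold is_seg in *.
  apply is_cint_ext with (fun y => RtoC (-1) * ((b - a) * f (a + RtoC (-1 * y + 1) * (b - a))))%C.
  - intros t _. replace (a + RtoC (-1 * t + 1) * (b - a))%C with (b + RtoC t * (a - b))%C.
    replace (RtoC (-1)) with (- (1))%C by (apply injective_projections; simpl; ring). ring.
    rewrite RtoC_plus, RtoC_mult. replace (RtoC (-1)) with (- (1))%C by (apply injective_projections; simpl; ring). ring.
  - apply (is_cint_comp_lin (fun s => (b - a) * f (a + RtoC s * (b - a)))%C (-1) 1).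
    replace (-1 * 0 + 1) with 1 by ring. replace (-1 * 1 + 1) with 0 by ring.
    apply is_cint_swap. exact H.
Qed.

Lemma is_seg_split f a b s l l' : 0 < s < 1 ->
  is_seg f a (a + RtoC s * (b - a)) l -> is_seg f (a + RtoC s * (b - a)) b l' ->
  is_seg f a b (l + l').
Proof.
  intros Hs H H'. set (c := (a + RtoC s * (b - a))%C) in *.
  assert (E : forall x, x <> 0 -> RtoC x <> 0) by (intros x Hx E; apply Hx; injection E; auto).
  apply is_cint_Chasles with s.
  - apply is_cint_ext with (fun y => RtoC (/ s) * ((c - a) * f (a + RtoC (/ s * y + 0) * (c - a))))%C.
    + intros t _. replace (a + RtoC (/ s * t + 0) * (c - a))%C with (a + RtoC t * (b - a))%C.
      unfold c. rewrite RtoC_inv by lra. field. apply E; lra.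
      rewrite RtoC_plus, RtoC_mult, RtoC_inv by lra. unfold c. field. apply E; lra.
    + apply (is_cint_comp_lin (fun s => (c - a) * f (a + RtoC s * (c - a)))%C).
      replace (/ s * 0 + 0) with 0 by ring. replace (/ s * s + 0) with 1 by (field; lra). exact H.
  - apply is_cint_ext with (fun y => RtoC (/ (1 - s)) * ((b - c) * f (c + RtoC (/ (1 - s) * y + (- s / (1 - s))) * (b - c))))%C.
    + intros t _.
      assert (N : (1 - RtoC s)%C <> 0) by (rewrite <- RtoC_minus; apply E; lra).
      replace (c + RtoC (/ (1 - s) * t + (- s / (1 - s))) * (b - c))%C with (a + RtoC t * (b - a))%C.
      unfold c. rewrite RtoC_inv, RtoC_minus by lra. field. auto.
      rewrite RtoC_plus, RtoC_mult, RtoC_div, RtoC_inv, RtoC_opp, RtoC_minus by lra. unfold c. field. auto.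
    + apply (is_cint_comp_lin (fun s => (b - c) * f (c + RtoC s * (b - c)))%C).
      replace (/ (1 - s) * s + (- s / (1 - s))) with 0 by (field; lra).
      replace (/ (1 - s) * 1 + (- s / (1 - s))) with 1 by (field; lra). exact H'.
Qed.

(** Total through [RInt]; [seg_correct] makes it the integral as soon as f is continuous along the
    segment. *)
Definition seg (f : C -> C) (a b : C) : C :=
  RInt (V := C_R_CompleteNormedModule) (fun t => (b - a) * f (a + RtoC t * (b - a)))%C 0 1.

Lemma is_seg_eq f a b l : is_seg f a b l -> seg f a b = l.
Proof. intros H. apply (is_RInt_unique (V := C_R_CompleteNormedModule)). exact H. Qed.

Definition ccont_on_seg (f : C -> C) (a b : C) : Prop := forall z, on_seg a b z -> ccont f z.

Lemma seg_correct f a b : ccont_on_seg f a b -> is_seg f a b (seg f a b).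
Proof. intros H. destruct (ex_seg f a b H) as [l Hl]. rewrite (is_seg_eq _ _ _ _ Hl). exact Hl. Qed.

Lemma on_seg_sym a b z : on_seg a b z -> on_seg b a z.
Proof.
  intros (t & Ht & ->). exists (1 - t); split; [lra|]. rewrite RtoC_minus. ring.
Qed.

Lemma seg_rev f a b : ccont_on_seg f a b -> seg f b a = (- seg f a b)%C.
Proof. intros H. apply is_seg_eq, is_seg_rev, seg_correct, H. Qed.

Lemma is_cint_const (c : C) (a b : R) : is_cint (fun _ => c) a b (RtoC (b - a) * c).
Proof.
  replace (RtoC (b - a) * c)%C with (scal (K := R_AbsRing) (V := C_R_NormedModule) (b - a) c).
  exact (is_RInt_const (V := C_R_NormedModule) a b c).
  unfold scal; simpl; unfold prod_scal, scal; simpl; unfold mult; simpl.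
  apply injective_projections; simpl; ring.
Qed.

Lemma seg_point f a : seg f a a = 0.
Proof.
  apply is_seg_eq. apply is_cint_ext with (fun _ => RtoC 0).
  - intros t _; ring.
  - generalize (is_cint_const 0 0 1). rewrite Cmult_0_r. auto.
Qed.

Lemma on_seg_sub a b c z s : 0 <= s <= 1 -> c = (a + RtoC s * (b - a))%C -> on_seg a c z -> on_seg a b z.
Proof.
  intros Hs -> (t & Ht & ->). exists (t * s); split; [nra|]. rewrite RtoC_mult. ring.
Qed.

Lemma on_seg_sub_r a b c z s : 0 <= s <= 1 -> c = (a + RtoC s * (b - a))%C -> on_seg c b z -> on_seg a b z.
Proof.
  intros Hs -> (t & Ht & ->). exists (s + t * (1 - s)); split; [nra|].
  rewrite RtoC_plus, RtoC_mult, RtoC_minus. ring.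
Qed.

Lemma seg_split f a b c s : 0 < s < 1 -> c = (a + RtoC s * (b - a))%C ->
  ccont_on_seg f a b -> (seg f a b = seg f a c + seg f c b)%C.
Proof.
  intros Hs Hc H. apply is_seg_eq.
  apply is_seg_split with s; [exact Hs| |]; rewrite <- Hc; apply seg_correct; intros z Hz; apply H.
  - apply on_seg_sub with (2 := Hc); [lra|exact Hz].
  - apply on_seg_sub_r with (2 := Hc); [lra|exact Hz].
Qed.

Lemma seg_bound f a b M : ccont_on_seg f a b ->
  (forall z, on_seg a b z -> Cmod (f z) <= M) -> Cmod (seg f a b) <= M * Cmod (b - a).
Proof. intros H HM. eapply is_seg_bound; [apply seg_correct, H|exact HM]. Qed.

(** * Triangles and Goursat's lemma *)

Definition tri f a b c : C := (seg f a b + seg f b c + seg f c a)%C.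

Definition per a b c : R := Cmod (b - a) + Cmod (c - b) + Cmod (a - c).

Definition convex (K : C -> Prop) : Prop := forall a b z, K a -> K b -> on_seg a b z -> K z.

Definition seq_closed (K : C -> Prop) : Prop :=
  forall z, (forall e, 0 < e -> exists w, K w /\ Cmod (w - z) < e) -> K z.

Definition mid (a b : C) : C := (a + RtoC (/ 2) * (b - a))%C.

Lemma mid_on_seg a b : on_seg a b (mid a b).
Proof. exists (/ 2); split; [lra|reflexivity]. Qed.

Lemma C_half : RtoC (/ 2) = (/ 2)%C.
Proof. rewrite RtoC_inv; [reflexivity|lra]. Qed.

(** Each side of the middle triangle is run through once in each direction and cancels; the halves
    of the outer sides add up. *)
Lemma tri_split f K a b c : convex K -> (forall z, K z -> ccont f z) -> K a -> K b -> K c ->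
  tri f a b c = (tri f a (mid a b) (mid c a) + tri f (mid a b) b (mid b c)
    + tri f (mid c a) (mid b c) c + tri f (mid a b) (mid b c) (mid c a))%C.
Proof.
  intros HK Hf Ha Hb Hc.
  assert (Hs : forall x y, K x -> K y -> ccont_on_seg f x y).
  { intros x y Hx Hy z Hz. apply Hf. exact (HK x y z Hx Hy Hz). }
  assert (Hm : forall x y, K x -> K y -> K (mid x y)).
  { intros x y Hx Hy. apply (HK x y); auto. apply mid_on_seg. }
  assert (S1 : forall x y, K x -> K y -> (seg f x y = seg f x (mid x y) + seg f (mid x y) y)%C).
  { intros x y Hx Hy. apply seg_split with (/ 2); [lra|reflexivity|auto]. }
  unfold tri.
  rewrite (S1 a b), (S1 b c), (S1 c a) by auto.
  rewrite (seg_rev f (mid a b) (mid c a)), (seg_rev f (mid b c) (mid a b)), (seg_rev f (mid c a) (mid b c)) by auto.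
  ring.
Qed.

Lemma Cmod_half z : Cmod (/ 2 * z) = / 2 * Cmod z.
Proof. rewrite Cmod_mult, <- C_half, Cmod_R, Rabs_right; lra. Qed.

Lemma per_split a b c :
  per a (mid a b) (mid c a) = per a b c / 2 /\ per (mid a b) b (mid b c) = per a b c / 2 /\
  per (mid c a) (mid b c) c = per a b c / 2 /\ per (mid a b) (mid b c) (mid c a) = per a b c / 2.
Proof.
  unfold per.
  assert (E : forall x y z w, (x - y = / 2 * (z - w))%C -> Cmod (x - y) = / 2 * Cmod (z - w)).
  { intros x y z w ->. apply Cmod_half. }
  repeat split.
  - rewrite (E (mid a b) a b a), (E (mid c a) (mid a b) c b), (E a (mid c a) a c); [lra| | |]; unfold mid; rewrite C_half; field.
  - rewrite (E b (mid a b) b a), (E (mid b c) b c b), (E (mid a b) (mid b c) a c); [lra| | |]; unfold mid; rewrite C_half; field.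
  - rewrite (E (mid b c) (mid c a) b a), (E c (mid b c) c b), (E (mid c a) c a c); [lra| | |]; unfold mid; rewrite C_half; field.
  - rewrite (E (mid b c) (mid a b) c a), (E (mid c a) (mid b c) a b), (E (mid a b) (mid c a) b c); [|unfold mid; rewrite C_half; field..].
    rewrite (Cmod_sub_sym c a), (Cmod_sub_sym a b), (Cmod_sub_sym b c). lra.
Qed.

Definition clim (u : nat -> C) (l : C) : Prop :=
  forall e, 0 < e -> exists N, forall n, (N <= n)%nat -> Cmod (u n - l) < e.

Lemma clim_complete (u : nat -> C) :
  (forall e, 0 < e -> exists N, forall n m, (N <= n)%nat -> (N <= m)%nat -> Cmod (u n - u m) < e) ->
  exists l, clim u l.
Proof.
  intros H.
  destruct (Rcomplete.R_complete (fun n => Re (u n))) as [l1 H1].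
  { intros e He. destruct (H e He) as [N HN]. exists N. intros n m Hn Hm. unfold Rdist.
    apply Rle_lt_trans with (2 := HN n m Hn Hm). exact (re_le_Cmod (u n - u m)). }
  destruct (Rcomplete.R_complete (fun n => Im (u n))) as [l2 H2].
  { intros e He. destruct (H e He) as [N HN]. exists N. intros n m Hn Hm. unfold Rdist.
    apply Rle_lt_trans with (2 := HN n m Hn Hm). exact (im_le_Cmod (u n - u m)). }
  exists (l1, l2). intros e He.
  destruct (H1 (e / 2)) as [N1 HN1]; [lra|]. destruct (H2 (e / 2)) as [N2 HN2]; [lra|].
  exists (Nat.max N1 N2). intros n Hn.
  specialize (HN1 n ltac:(lia)). specialize (HN2 n ltac:(lia)). unfold Rdist in *.
  destruct (u n) as [x y] eqn:E. unfold Re, Im in *; simpl in *.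
  apply Rle_lt_trans with (1 := Cmod_le_sum _ _). unfold Rminus in *. simpl. lra.
Qed.

Lemma clim_unique u l l' : clim u l -> clim u l' -> l = l'.
Proof.
  intros H H'. destruct (Ceq_dec l l') as [E|E]; [exact E|exfalso].
  assert (P : 0 < Cmod (l - l')).
  { apply Cmod_neq_0. intros E'. apply E. replace l with (l - l' + l')%C by ring. rewrite E'. ring. }
  destruct (H (Cmod (l - l') / 2)) as [N HN]; [lra|]. destruct (H' (Cmod (l - l') / 2)) as [N' HN']; [lra|].
  specialize (HN (Nat.max N N') ltac:(lia)). specialize (HN' (Nat.max N N') ltac:(lia)).
  generalize (Cmod_chain l (u (Nat.max N N')) l'). rewrite (Cmod_sub_sym l (u _)). lra.
Qed.

Lemma clim_bound u l M a : clim u l -> (forall n, Cmod (u n - a) <= M) -> Cmod (l - a) <= M.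
Proof.
  intros H HM. apply Rnot_lt_le. intros Hlt.
  destruct (H (Cmod (l - a) - M)) as [N HN]; [lra|]. specialize (HN N (le_n N)). specialize (HM N).
  generalize (Cmod_chain l (u N) a). rewrite (Cmod_sub_sym l (u N)). lra.
Qed.

Lemma clim_eventually u v l : (exists N, forall n, (N <= n)%nat -> u n = v n) -> clim u l -> clim v l.
Proof.
  intros [N HN] H e He. destruct (H e He) as [N' HN']. exists (Nat.max N N'). intros n Hn.
  rewrite <- HN by lia. apply HN'; lia.
Qed.

Lemma per_nonneg a b c : 0 <= per a b c.
Proof. unfold per. generalize (Cmod_ge_0 (b - a)) (Cmod_ge_0 (c - b)) (Cmod_ge_0 (a - c)). lra. Qed.

(* A triangle is bad when its contour integral exceeds eps times the square of its perimeter; halving the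
   perimeter divides that bound by exactly four, so one of the four halves of a bad triangle is bad. *)
Section Bisection.

Variables (f : C -> C) (eps : R).

Definition bad (T : C * C * C) : Prop :=
  let '(a, b, c) := T in eps * (per a b c) ^ 2 < Cmod (tri f a b c).

Definition bad_dec (T : C * C * C) : {bad T} + {~ bad T}.
Proof. destruct T as [[a b] c]. apply Rlt_dec. Defined.

Definition bisect (T : C * C * C) : C * C * C :=
  let '(a, b, c) := T in
  if bad_dec (a, mid a b, mid c a) then (a, mid a b, mid c a) else
  if bad_dec (mid a b, b, mid b c) then (mid a b, b, mid b c) else
  if bad_dec (mid c a, mid b c, c) then (mid c a, mid b c, c) else
  (mid a b, mid b c, mid c a).

Definition tper (T : C * C * C) : R := let '(a, b, c) := T in per a b c.

Definition apex (T : C * C * C) : C := let '(a, b, c) := T in a.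

Definition inK (K : C -> Prop) (T : C * C * C) : Prop := let '(a, b, c) := T in K a /\ K b /\ K c.

(** The last clause turns the successive apexes into a sequence with geometrically decreasing steps,
    whose limit plays the role of the common point of the nested triangles. *)
Lemma bisect_spec K T : convex K -> (forall z, K z -> ccont f z) -> inK K T -> bad T ->
  inK K (bisect T) /\ bad (bisect T) /\ tper (bisect T) = tper T / 2 /\
  Cmod (apex (bisect T) - apex T) <= tper T.
Proof.
  intros HK Hf HT HB. destruct T as [[a b] c]. destruct HT as (Ha & Hb & Hc).
  assert (Hm : forall x y, K x -> K y -> K (mid x y)).
  { intros x y Hx Hy. apply (HK x y); auto. apply mid_on_seg. }
  destruct (per_split a b c) as (P1 & P2 & P3 & P4).
  assert (Hp := per_nonneg a b c).
  assert (A1 : Cmod (mid a b - a) <= per a b c).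
  { replace (mid a b - a)%C with (/ 2 * (b - a))%C by (unfold mid; rewrite C_half; field).
    rewrite Cmod_half. unfold per in *. generalize (Cmod_ge_0 (b - a)) (Cmod_ge_0 (c - b)) (Cmod_ge_0 (a - c)). lra. }
  assert (A2 : Cmod (mid c a - a) <= per a b c).
  { replace (mid c a - a)%C with (/ 2 * - (a - c))%C by (unfold mid; rewrite C_half; field).
    rewrite Cmod_half, Cmod_opp. unfold per in *. generalize (Cmod_ge_0 (b - a)) (Cmod_ge_0 (c - b)) (Cmod_ge_0 (a - c)). lra. }
  simpl in HB. unfold bisect.
  destruct (bad_dec _) as [B1|B1]; [|destruct (bad_dec _) as [B2|B2]; [|destruct (bad_dec _) as [B3|B3]]].
  - simpl. repeat split; auto. replace (a - a)%C with (RtoC 0) by ring. rewrite Cmod_0; exact Hp.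
  - simpl. repeat split; auto.
  - simpl. repeat split; auto.
  (* By elimination: if the fourth triangle failed as well, the four bounds, each a quarter of the
     original one, would contradict the badness of the whole. *)
  - assert (B4 : bad (mid a b, mid b c, mid c a)).
    { simpl in *. rewrite P1 in B1. rewrite P2 in B2. rewrite P3 in B3. rewrite P4.
      apply Rnot_lt_le in B1. apply Rnot_lt_le in B2. apply Rnot_lt_le in B3.
      rewrite (tri_split f K a b c HK Hf Ha Hb Hc) in HB.
      eapply Rlt_le_trans in HB; [|eapply Rle_trans; [apply Cmod_triangle|apply Rplus_le_compat_r; eapply Rle_trans; [apply Cmod_triangle|apply Rplus_le_compat_r, Cmod_triangle]]].
      lra. }
    simpl in *. repeat split; auto.
Qed.

Fixpoint bisects (T : C * C * C) (n : nat) : C * C * C :=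
  match n with O => T | S k => bisect (bisects T k) end.

End Bisection.

Lemma pow_half_small P e : 0 < e -> exists N, forall n, (N <= n)%nat -> P * (/ 2) ^ n < e.
Proof.
  intros He.
  destruct (pow_lt_1_zero (/ 2)) with (y := e / (Rabs P + 1)) as [N HN].
  rewrite Rabs_right; lra. apply Rdiv_lt_0_compat; [lra|]. generalize (Rabs_pos P); lra.
  exists N. intros n Hn. specialize (HN n Hn). 
  rewrite Rabs_right in HN by (apply Rle_ge, pow_le; lra).
  assert (H0 : 0 <= (/ 2) ^ n) by (apply pow_le; lra).
  assert (HP := Rle_abs P). assert (HP' := Rabs_pos P).
  apply Rle_lt_trans with ((Rabs P + 1) * (/ 2) ^ n). apply Rmult_le_compat_r; lra.
  apply Rlt_le_trans with ((Rabs P + 1) * (e / (Rabs P + 1))). apply Rmult_lt_compat_l; lra.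
  right; field; lra.
Qed.

Lemma clim_geometric (u : nat -> C) (P : R) :
  (forall n, Cmod (u (S n) - u n) <= P * (/ 2) ^ n) ->
  exists l, clim u l /\ forall n, Cmod (u n - l) <= 2 * P * (/ 2) ^ n.
Proof.
  intros H.
  assert (H' : forall n k, Cmod (u (n + k)%nat - u n) <= 2 * P * (/ 2) ^ n - 2 * P * (/ 2) ^ (n + k)).
  { intros n k; induction k as [|k IH].
    - rewrite Nat.add_0_r. replace (u n - u n)%C with (RtoC 0) by ring. rewrite Cmod_0. lra.
    - rewrite Nat.add_succ_r. specialize (H (n + k)%nat).
      generalize (Cmod_chain (u (S (n + k))) (u (n + k)%nat) (u n)). simpl. lra. }
  assert (P0 : 0 <= P).
  { generalize (Rle_trans _ _ _ (Cmod_ge_0 _) (H 0%nat)). simpl. lra. }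
  assert (H2 : forall n k, Cmod (u (n + k)%nat - u n) <= 2 * P * (/ 2) ^ n).
  { intros n k. apply Rle_trans with (1 := H' n k).
    assert (0 <= 2 * P * (/ 2) ^ (n + k)) by (apply Rmult_le_pos; [lra|apply pow_le; lra]). lra. }
  destruct (clim_complete u) as [l Hl].
  - intros e He. destruct (pow_half_small (2 * P) (e / 2)) as [N HN]; [lra|].
    exists N. intros n m Hn Hm.
    replace n with (N + (n - N))%nat by lia. replace m with (N + (m - N))%nat by lia.
    generalize (Cmod_chain (u (N + (n - N))%nat) (u N) (u (N + (m - N))%nat)).
    rewrite (Cmod_sub_sym (u N) (u _)). specialize (HN N (le_n _)).
    generalize (H2 N (n - N)%nat) (H2 N (m - N)%nat). lra.
  - exists l. split; [exact Hl|]. intros n. rewrite Cmod_sub_sym.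
    apply clim_bound with (fun k => u (n + k)%nat).
    + intros e He. destruct (Hl e He) as [N HN]. exists N. intros k Hk. apply HN. lia.
    + intros k. apply H2.
Qed.

(** An affine function has a quadratic primitive. In Goursat's lemma it is the first-order Taylor
    polynomial, which can be subtracted for free. *)
Lemma affine_tri (p q a b c : C) : tri (fun z => p + q * z)%C a b c = 0.
Proof.
  assert (E : forall x y, seg (fun z => p + q * z)%C x y = ((p * y + q * / 2 * (y * y)) - (p * x + q * / 2 * (x * x)))%C).
  { intros x y. apply is_seg_eq.
    apply (is_seg_ftc (fun z => p * z + q * / 2 * (z * z))%C).
    - intros z _. eapply cder_eq. apply cder_plus. apply cder_scal, cder_id.
      apply cder_scal. apply cder_mult; apply cder_id. cbv beta. field.
    - intros z _. eapply ccont_cder. apply cder_plus. apply cder_const. apply cder_scal, cder_id. }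
  unfold tri. rewrite !E. ring.
Qed.

(** A closed convex [K] containing the vertices replaces the filled triangle: convexity keeps all
    bisected triangles in [K], closedness the limit of their apexes. *)
Lemma goursat f K a b c : convex K -> seq_closed K -> (forall z, K z -> exists l, cder f z l) ->
  K a -> K b -> K c -> tri f a b c = 0.
Proof.
  intros HK Hcl Hf Ha Hb Hc.
  assert (Hcont : forall z, K z -> ccont f z).
  { intros z Hz. destruct (Hf z Hz) as [l Hl]. exact (ccont_cder _ _ _ Hl). }
  assert (Main : forall eps, 0 < eps -> Cmod (tri f a b c) <= eps * per a b c ^ 2).
  { intros eps He. apply Rnot_lt_le. intros HB.
    set (T := bisects f eps (a, b, c)).
    assert (Inv : forall n, inK K (T n) /\ bad f eps (T n) /\ tper (T n) = per a b c * (/ 2) ^ n).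
    { induction n as [|n (I1 & I2 & I3)].
      - simpl. repeat split; auto. ring.
      - destruct (bisect_spec f eps K (T n) HK Hcont I1 I2) as (J1 & J2 & J3 & _).
        change (T (S n)) with (bisect f eps (T n)). split; [|split]; auto. rewrite J3, I3. simpl. field. }
    destruct (clim_geometric (fun n => apex (T n)) (per a b c)) as (z & Hz & Hz').
    { intros n. destruct (Inv n) as (I1 & I2 & I3). rewrite <- I3.
      destruct (bisect_spec f eps K (T n) HK Hcont I1 I2) as (_ & _ & _ & J4). exact J4. }
    assert (HKz : K z).
    { apply Hcl. intros e He'. destruct (Hz e He') as [N HN]. exists (apex (T N)). split; [|apply HN, le_n].
      destruct (Inv N) as (I1 & _). destruct (T N) as [[x y] w]. apply I1. }
    destruct (Hf z HKz) as [l Hl].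
    (* On a small triangle the remainder is at most eps / 4 times three perimeters, so its integral
       is at most 3/4 eps per^2, below the threshold of [bad]. *)
    destruct (Hl (eps / 4)) as (d & Hd & Hd'); [lra|].
    (* Three perimeters: a point of the contour is within one of the apex, and the apex within two
       of the limit. *)
    destruct (pow_half_small (3 * per a b c) d Hd) as [N HN]. specialize (HN N (le_n N)).
    destruct (Inv N) as (I1 & I2 & I3). specialize (Hz' N).
    destruct (T N) as [[x y] w]. simpl in I1, I2, I3, Hz'. destruct I1 as (Kx & Ky & Kw).
    set (h := fun v => (f v - ((f z - l * z) + l * v))%C).
    assert (Hseg : forall u v, K u -> K v -> ccont_on_seg f u v).
    { intros u v Hu Hv s Hs. apply Hcont. exact (HK u v s Hu Hv Hs). }
    assert (Haff : forall u v, ccont_on_seg (fun v => (f z - l * z) + l * v)%C u v).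
    { intros u v s _. eapply ccont_cder. apply cder_plus. apply cder_const. apply cder_scal, cder_id. }
    assert (Hh : forall u v, K u -> K v -> is_seg h u v (seg f u v - seg (fun v => (f z - l * z) + l * v)%C u v)).
    { intros u v Hu Hv. apply is_seg_minus; apply seg_correct; auto. }
    assert (Et : (tri f x y w = (seg f x y - seg (fun v => (f z - l * z) + l * v)%C x y) + (seg f y w - seg (fun v => (f z - l * z) + l * v)%C y w) + (seg f w x - seg (fun v => (f z - l * z) + l * v)%C w x))%C).
    { assert (E0 := affine_tri (f z - l * z) l x y w). unfold tri in *.
      rewrite <- (Cplus_0_r (seg f x y + seg f y w + seg f w x)), <- (Copp_0), <- E0. ring. }
    assert (Hp := per_nonneg x y w). 
    assert (Hnear : forall v, Cmod (v - x) <= per x y w -> Cmod (h v) <= eps / 4 * (3 * per x y w)).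
    { intros v Hv. unfold h.
      assert (Hvz : Cmod (v - z) <= 3 * per x y w).
      { generalize (Cmod_chain v x z). lra. }
      replace (f v - (f z - l * z + l * v))%C with (f v - f z - l * (v - z))%C by ring.
      apply Rle_trans with (eps / 4 * Cmod (v - z)). apply Hd'. lra.
      apply Rmult_le_compat_l; lra. }
    assert (Hb1 : forall u v, K u -> K v -> (forall s, on_seg u v s -> Cmod (s - x) <= per x y w) ->
       Cmod (seg f u v - seg (fun v => (f z - l * z) + l * v)%C u v) <= eps / 4 * (3 * per x y w) * Cmod (v - u)).
    { intros u v Hu Hv Hs. apply (is_seg_bound h u v _ _ (Hh u v Hu Hv)); auto. }
    assert (Q : forall u v s, on_seg u v s -> Cmod (s - u) <= Cmod (v - u)).
    { intros u v s (t & Ht & ->). replace (u + t * (v - u) - u)%C with (t * (v - u))%C by ring.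
      rewrite Cmod_mult, Cmod_R, Rabs_right by lra. generalize (Cmod_ge_0 (v - u)); nra. }
    assert (B1 := Hb1 x y Kx Ky). assert (B2 := Hb1 y w Ky Kw). assert (B3 := Hb1 w x Kw Kx).
    simpl in I2. rewrite Et in I2.
    assert (C1 := Cmod_ge_0 (y - x)). assert (C2 := Cmod_ge_0 (w - y)). assert (C3 := Cmod_ge_0 (x - w)).
    assert (D1 : forall s, on_seg x y s -> Cmod (s - x) <= per x y w).
    { intros s Hs. generalize (Q x y s Hs). unfold per. lra. }
    assert (D2 : forall s, on_seg y w s -> Cmod (s - x) <= per x y w).
    { intros s Hs. generalize (Q y w s Hs) (Cmod_chain s y x). unfold per. lra. }
    assert (D3 : forall s, on_seg w x s -> Cmod (s - x) <= per x y w).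
    { intros s Hs. generalize (Q x w s (on_seg_sym _ _ _ Hs)). rewrite (Cmod_sub_sym w x). unfold per. lra. }
    specialize (B1 D1). specialize (B2 D2). specialize (B3 D3).
    eapply Rlt_le_trans in I2; [|eapply Rle_trans; [apply Cmod_triangle|apply Rplus_le_compat; [eapply Rle_trans; [apply Cmod_triangle|apply Rplus_le_compat; [exact B1|exact B2]]|exact B3]]].
    fold (per x y w) in I2.
    assert (E1 : eps / 4 * (3 * per x y w) * Cmod (y - x) + eps / 4 * (3 * per x y w) * Cmod (w - y) + eps / 4 * (3 * per x y w) * Cmod (x - w) = 3 / 4 * (eps * per x y w ^ 2)) by (unfold per; field).
    rewrite E1 in I2. assert (0 <= eps * per x y w ^ 2) by (apply Rmult_le_pos; [lra|apply pow_le; lra]).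
    simpl in I2, H. lra. }
  destruct (Ceq_dec (tri f a b c) 0) as [E|E]; [exact E|exfalso].
  assert (P := Cmod_neq_0 _ E). assert (Hp := per_nonneg a b c).
  assert (H2 : 0 <= per a b c ^ 2) by (apply pow_le; lra).
  specialize (Main (Cmod (tri f a b c) / (2 * (per a b c ^ 2 + 1)))).
  assert (0 < Cmod (tri f a b c) / (2 * (per a b c ^ 2 + 1))) by (apply Rdiv_lt_0_compat; lra).
  specialize (Main H).
  apply (Rmult_le_compat_r (2 * (per a b c ^ 2 + 1))) in Main; [|lra].
  replace (Cmod (tri f a b c) / (2 * (per a b c ^ 2 + 1)) * per a b c ^ 2 * (2 * (per a b c ^ 2 + 1))) with (Cmod (tri f a b c) * per a b c ^ 2) in Main by (field; lra).
  nra.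
Qed.

Lemma Re_Cplus z w : Re (z + w) = Re z + Re w.
Proof. reflexivity. Qed.
Lemma Im_Cplus z w : Im (z + w) = Im z + Im w.
Proof. reflexivity. Qed.
Lemma Re_Cminus z w : Re (z - w) = Re z - Re w.
Proof. reflexivity. Qed.
Lemma Im_Cminus z w : Im (z - w) = Im z - Im w.
Proof. reflexivity. Qed.
Lemma Re_Cmult z w : Re (z * w) = Re z * Re w - Im z * Im w.
Proof. reflexivity. Qed.
Lemma Im_Cmult z w : Im (z * w) = Re z * Im w + Im z * Re w.
Proof. reflexivity. Qed.
Lemma Re_RtoC x : Re (RtoC x) = x.
Proof. reflexivity. Qed.
Lemma Im_RtoC x : Im (RtoC x) = 0.
Proof. reflexivity. Qed.

(** * Rectangles, half-planes and primitives on convex open sets *)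

Definition rect (x0 x1 y0 y1 : R) (z : C) : Prop := x0 < Re z < x1 /\ y0 < Im z < y1.

Definition crect (x0 x1 y0 y1 : R) (z : C) : Prop := x0 <= Re z <= x1 /\ y0 <= Im z <= y1.

Definition copen (D : C -> Prop) : Prop :=
  forall z, D z -> exists d, 0 < d /\ forall w, Cmod (w - z) < d -> D w.

(** The form in which [goursat], which needs a closed set, becomes available in an open one. *)
Definition hull_closed (D : C -> Prop) : Prop := forall a b c, D a -> D b -> D c ->
  exists K, convex K /\ seq_closed K /\ (forall z, K z -> D z) /\ K a /\ K b /\ K c.

Lemma Re_seg a b t : Re (a + RtoC t * (b - a)) = Re a + t * (Re b - Re a).
Proof. rewrite Re_Cplus, Re_Cmult, Re_Cminus, Im_RtoC, Re_RtoC. ring. Qed.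

Lemma Im_seg a b t : Im (a + RtoC t * (b - a)) = Im a + t * (Im b - Im a).
Proof. rewrite Im_Cplus, Im_Cmult, Im_Cminus, Im_RtoC, Re_RtoC. ring. Qed.

Lemma lt_conv x a b t : x < a -> x < b -> 0 <= t <= 1 -> x < a + t * (b - a).
Proof. intros. destruct (Rle_dec a b); nra. Qed.

Lemma gt_conv x a b t : a < x -> b < x -> 0 <= t <= 1 -> a + t * (b - a) < x.
Proof. intros. destruct (Rle_dec a b); nra. Qed.

Lemma convex_rect x0 x1 y0 y1 : convex (rect x0 x1 y0 y1).
Proof.
  intros a b z [Ha Ha'] [Hb Hb'] (t & Ht & ->).
  unfold rect. rewrite Re_seg, Im_seg. repeat split; (apply lt_conv || apply gt_conv); lra.
Qed.

Lemma convex_crect x0 x1 y0 y1 : convex (crect x0 x1 y0 y1).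
Proof.
  intros a b z [Ha Ha'] [Hb Hb'] (t & Ht & ->).
  unfold crect. rewrite Re_seg, Im_seg. repeat split; nra.
Qed.

Lemma re_sub_le z w : Rabs (Re z - Re w) <= Cmod (z - w).
Proof. apply (re_le_Cmod (z - w)). Qed.

Lemma im_sub_le z w : Rabs (Im z - Im w) <= Cmod (z - w).
Proof. apply (im_le_Cmod (z - w)). Qed.

Lemma closed_crect x0 x1 y0 y1 : seq_closed (crect x0 x1 y0 y1).
Proof.
  intros z H. repeat split; apply Rnot_lt_le; intros Hlt.
  - destruct (H (x0 - Re z)) as (w & [Hw Hw'] & Hd); [lra|].
    generalize (Rle_abs (Re w - Re z)) (re_sub_le w z); lra.
  - destruct (H (Re z - x1)) as (w & [Hw Hw'] & Hd); [lra|].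
    generalize (Rle_abs (- (Re w - Re z))) (re_sub_le w z). rewrite Rabs_Ropp; lra.
  - destruct (H (y0 - Im z)) as (w & [Hw Hw'] & Hd); [lra|].
    generalize (Rle_abs (Im w - Im z)) (im_sub_le w z); lra.
  - destruct (H (Im z - y1)) as (w & [Hw Hw'] & Hd); [lra|].
    generalize (Rle_abs (- (Im w - Im z))) (im_sub_le w z). rewrite Rabs_Ropp; lra.
Qed.

Lemma open_rect x0 x1 y0 y1 : copen (rect x0 x1 y0 y1).
Proof.
  intros z [Hx Hy].
  exists (Rmin (Rmin (Re z - x0) (x1 - Re z)) (Rmin (Im z - y0) (y1 - Im z))).
  split; [repeat apply Rmin_pos; lra|]. intros w Hw.
  apply Rmin_Rgt in Hw. destruct Hw as [H1 H2]. apply Rmin_Rgt in H1. apply Rmin_Rgt in H2.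
  generalize (re_sub_le w z) (im_sub_le w z). intros A B.
  apply Rabs_le_between in A. apply Rabs_le_between in B. unfold rect. lra.
Qed.

Lemma hull_closed_rect x0 x1 y0 y1 : hull_closed (rect x0 x1 y0 y1).
Proof.
  intros a b c [Ha Ha'] [Hb Hb'] [Hc Hc'].
  exists (crect (Rmin (Re a) (Rmin (Re b) (Re c))) (Rmax (Re a) (Rmax (Re b) (Re c)))
     (Rmin (Im a) (Rmin (Im b) (Im c))) (Rmax (Im a) (Rmax (Im b) (Im c)))).
  split; [apply convex_crect|]. split; [apply closed_crect|].
  unfold crect, rect, Rmin, Rmax. repeat destruct Rle_dec; repeat split; lra.
Qed.

(** The real part is the Euclidean scalar product of v - v0 and d, so a positive eta cuts off the
    point v0. *)
Definition half_plane (v0 d : C) (eta : R) (v : C) : Prop := eta <= Re ((v - v0) * Cconj d).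

Lemma convex_half_plane v0 d eta : convex (half_plane v0 d eta).
Proof.
  intros a b z Ha Hb (t & Ht & ->). unfold half_plane in *.
  replace ((a + t * (b - a) - v0) * Cconj d)%C with
    ((a - v0) * Cconj d + RtoC t * ((b - v0) * Cconj d - (a - v0) * Cconj d))%C by ring.
  rewrite Re_seg. nra.
Qed.

Lemma closed_half_plane v0 d eta : seq_closed (half_plane v0 d eta).
Proof.
  intros z H. unfold half_plane in *. apply Rnot_lt_le; intros Hlt.
  assert (Hd := Cmod_ge_0 d).
  set (g := eta - Re ((z - v0) * Cconj d)) in *.
  destruct (H (g / (Cmod d + 1))) as (w & Hw & Hd').
  { apply Rdiv_lt_0_compat; unfold g; lra. }
  generalize (re_sub_le ((w - v0) * Cconj d) ((z - v0) * Cconj d)).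
  replace ((w - v0) * Cconj d - (z - v0) * Cconj d)%C with ((w - z) * Cconj d)%C by ring.
  rewrite Cmod_mult, Cmod_conj. intros B.
  generalize (Rle_abs (Re ((w - v0) * Cconj d) - Re ((z - v0) * Cconj d))). intros A.
  assert (Hg : Cmod (w - z) * Cmod d < g).
  { apply Rle_lt_trans with (g / (Cmod d + 1) * Cmod d). apply Rmult_le_compat_r; lra.
    apply Rlt_le_trans with (g / (Cmod d + 1) * (Cmod d + 1)).
    apply Rmult_lt_compat_l; [apply Rdiv_lt_0_compat; unfold g; lra|lra]. right; field; lra. }
  unfold g in Hg. lra.
Qed.

(* The exceptional point v0, where k is only assumed continuous, is there for the difference quotients
   (f z - f v0) / (z - v0) of Cauchy's formula. *)
Section Primitive.

Variables (D : C -> Prop) (v0 : C) (k : C -> C).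
Hypothesis (Dconv : convex D) (Dopen : copen D) (Dhull : hull_closed D) (Dv0 : D v0).
Hypothesis (kcont : forall z, D z -> ccont k z).
Hypothesis (kder : forall z, D z -> z <> v0 -> exists l, cder k z l).

Lemma seg_cont_D a b : D a -> D b -> ccont_on_seg k a b.
Proof. intros Ha Hb z Hz. apply kcont. exact (Dconv a b z Ha Hb Hz). Qed.

(** The corner at v0 is cut off at the fraction [lam] of its two sides. The remaining quadrilateral
    consists of two triangles in a half-plane that avoids v0, where Goursat applies; w lies on the
    side of z because it is close to z. The small triangle at v0 contributes O(lam), by continuity
    of k. *)
Lemma tri_far z w : D z -> D w -> z <> v0 -> Cmod (w - z) <= Cmod (z - v0) / 2 ->
  tri k v0 z w = 0.
Proof.
  intros Hz Hw Hne Hzw.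
  assert (Hd : 0 < Cmod (z - v0)).
  { apply Cmod_neq_0. intros E; apply Hne. replace z with (z - v0 + v0)%C by ring. rewrite E; ring. }
  destruct (kcont v0 Dv0 1 Rlt_0_1) as (d0 & Hd0 & Hk0).
  set (M := Cmod (k v0) + 1).
  assert (HM : 0 < M) by (unfold M; generalize (Cmod_ge_0 (k v0)); lra).
  assert (E2 : Re ((z - v0) * Cconj (z - v0)) = Cmod (z - v0) ^ 2).
  { rewrite <- Re_RtoC, Cmod2_conj. reflexivity. }
  assert (E3 : Cmod (z - v0) ^ 2 / 2 <= Re ((w - v0) * Cconj (z - v0))).
  { replace ((w - v0) * Cconj (z - v0))%C with ((w - z) * Cconj (z - v0) + (z - v0) * Cconj (z - v0))%C by ring.
    rewrite Re_Cplus, E2.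
    generalize (re_le_Cmod ((w - z) * Cconj (z - v0))). rewrite Cmod_mult, Cmod_conj. intros B.
    apply Rabs_le_between in B. assert (Cmod (w - z) * Cmod (z - v0) <= Cmod (z - v0) / 2 * Cmod (z - v0)) by (apply Rmult_le_compat_r; lra). rewrite <- Rsqr_pow2; unfold Rsqr; lra. }
  assert (Main : forall lam, 0 < lam < 1 -> lam * (2 * Cmod (z - v0)) < d0 ->
     Cmod (tri k v0 z w) <= M * (lam * per v0 z w)).
  { intros lam Hl Hl0.
    set (z' := (v0 + RtoC lam * (z - v0))%C). set (w' := (v0 + RtoC lam * (w - v0))%C).
    assert (Dz' : D z') by (apply (Dconv v0 z); auto; exists lam; split; [lra|reflexivity]).
    assert (Dw' : D w') by (apply (Dconv v0 w); auto; exists lam; split; [lra|reflexivity]).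
    assert (G : forall a b c, D a -> D b -> D c ->
       (forall x, x = a \/ x = b \/ x = c -> half_plane v0 (z - v0) (lam * (Cmod (z - v0) ^ 2 / 2)) x) ->
       tri k a b c = 0).
    { intros a b c Ha Hb Hc Hx. destruct (Dhull a b c Ha Hb Hc) as (K & K1 & K2 & K3 & Ka & Kb & Kc).
      apply (goursat k (fun v => K v /\ half_plane v0 (z - v0) (lam * (Cmod (z - v0) ^ 2 / 2)) v)).
      - intros x y s [X1 X2] [Y1 Y2] Hs. split; [apply (K1 x y)|apply (convex_half_plane v0 (z - v0) _ x y)]; auto.
      - intros x X. split; [apply K2|apply closed_half_plane]; intros e He; destruct (X e He) as (y & [Y1 Y2] & Y3); exists y; auto.
      - intros x [X1 X2]. apply kder; [auto|]. intros ->.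
        unfold half_plane in X2. replace ((v0 - v0) * Cconj (z - v0))%C with (RtoC 0) in X2 by ring.
        rewrite Re_RtoC in X2. assert (0 < lam * (Cmod (z - v0) ^ 2 / 2)); [|lra].
        apply Rmult_lt_0_compat; [lra|]. apply Rdiv_lt_0_compat; [apply pow_lt; auto|lra].
      - split; auto.
      - split; auto.
      - split; auto. }
    assert (Hz1 : half_plane v0 (z - v0) (lam * (Cmod (z - v0) ^ 2 / 2)) z) by (unfold half_plane; rewrite E2; nra).
    assert (Hw1 : half_plane v0 (z - v0) (lam * (Cmod (z - v0) ^ 2 / 2)) w) by (unfold half_plane; nra).
    assert (Hz2 : half_plane v0 (z - v0) (lam * (Cmod (z - v0) ^ 2 / 2)) z').
    { unfold half_plane, z'. replace ((v0 + lam * (z - v0) - v0) * Cconj (z - v0))%C with (RtoC lam * ((z - v0) * Cconj (z - v0)))%C by ring.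
      rewrite Re_Cmult, Re_RtoC, Im_RtoC, E2. nra. }
    assert (Hw2 : half_plane v0 (z - v0) (lam * (Cmod (z - v0) ^ 2 / 2)) w').
    { unfold half_plane, w'. replace ((v0 + lam * (w - v0) - v0) * Cconj (z - v0))%C with (RtoC lam * ((w - v0) * Cconj (z - v0)))%C by ring.
      rewrite Re_Cmult, Re_RtoC, Im_RtoC. nra. }
    assert (T1 : tri k z' z w = 0) by (apply G; auto; intros x [->|[->| ->]]; auto).
    assert (T2 : tri k z' w w' = 0) by (apply G; auto; intros x [->|[->| ->]]; auto).
    assert (T3 : tri k v0 z w = (tri k v0 z' w' + tri k z' z w + tri k z' w w')%C).
    { unfold tri.
      rewrite (seg_split k v0 z z' lam), (seg_rev k v0 w), (seg_split k v0 w w' lam), (seg_rev k w' z'), (seg_rev k z' w), (seg_rev k v0 w'), (seg_rev k w' w);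
        try (apply seg_cont_D; assumption); try exact Hl; try reflexivity.
      ring. }
    rewrite T3, T1, T2, !Cplus_0_r.
    assert (Hnear : forall a, Cmod (a - v0) < d0 -> Cmod (k a) <= M).
    { intros a Ha. specialize (Hk0 a Ha). generalize (Cmod_rtriangle (k a) (k v0)). unfold M. lra. }
    assert (Hwv : Cmod (w - v0) <= 3 / 2 * Cmod (z - v0)) by (generalize (Cmod_chain w z v0); lra).
    assert (Nz : Cmod (z' - v0) < d0).
    { unfold z'. replace (v0 + lam * (z - v0) - v0)%C with (RtoC lam * (z - v0))%C by ring.
      rewrite Cmod_mult, Cmod_R, Rabs_right by lra. nra. }
    assert (Nw : Cmod (w' - v0) < d0).
    { unfold w'. replace (v0 + lam * (w - v0) - v0)%C with (RtoC lam * (w - v0))%C by ring.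
      rewrite Cmod_mult, Cmod_R, Rabs_right by lra. nra. }
    assert (Hball : forall a b x, Cmod (a - v0) < d0 -> Cmod (b - v0) < d0 -> on_seg a b x -> Cmod (x - v0) < d0).
    { intros a b x Ha Hb (t & Ht & ->).
      replace (a + t * (b - a) - v0)%C with (RtoC (1 - t) * (a - v0) + RtoC t * (b - v0))%C by (rewrite RtoC_minus; ring).
      apply Rle_lt_trans with (1 := Cmod_triangle _ _). rewrite !Cmod_mult, !Cmod_R, !Rabs_right by lra. generalize (gt_conv d0 (Cmod (a - v0)) (Cmod (b - v0)) t Ha Hb Ht). lra. }
    assert (N0 : Cmod (v0 - v0) < d0) by (replace (v0 - v0)%C with (RtoC 0) by ring; rewrite Cmod_0; auto).
    assert (Ep : per v0 z' w' = lam * per v0 z w).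
    { unfold per, z', w'.
      replace (v0 + lam * (z - v0) - v0)%C with (RtoC lam * (z - v0))%C by ring.
      replace (v0 + lam * (w - v0) - (v0 + lam * (z - v0)))%C with (RtoC lam * (w - z))%C by ring.
      replace (v0 - (v0 + lam * (w - v0)))%C with (RtoC lam * (v0 - w))%C by ring.
      rewrite !Cmod_mult, !Cmod_R, !Rabs_right by lra. ring. }
    rewrite <- Ep. unfold tri.
    eapply Rle_trans; [apply Cmod_triangle|]. eapply Rle_trans; [apply Rplus_le_compat_r, Cmod_triangle|].
    unfold per. rewrite !Rmult_plus_distr_l.
    repeat apply Rplus_le_compat; apply seg_bound; try (apply seg_cont_D; assumption); intros x Hx; apply Hnear; eapply Hball; try exact Hx; auto. }
  destruct (Ceq_dec (tri k v0 z w) 0) as [E|E]; [exact E|exfalso].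
  assert (P := Cmod_neq_0 _ E). assert (Hp := per_nonneg v0 z w).
  (* The second bound keeps the small triangle in the disc where |k| <= M, the third makes its
     integral smaller than the supposedly nonzero value. *)
  set (lam := Rmin (Rmin (/ 2) (d0 / (4 * Cmod (z - v0)))) (Cmod (tri k v0 z w) / (2 * M * (per v0 z w + 1)))).
  assert (Q1 : 0 < d0 / (4 * Cmod (z - v0))) by (apply Rdiv_lt_0_compat; lra).
  assert (Q3 : 0 < 2 * M * (per v0 z w + 1)) by (repeat apply Rmult_lt_0_compat; lra).
  assert (Q2 : 0 < Cmod (tri k v0 z w) / (2 * M * (per v0 z w + 1))) by (apply Rdiv_lt_0_compat; lra).
  assert (L0 : 0 < lam) by (repeat apply Rmin_pos; lra).
  assert (L1 : lam <= / 2) by (apply Rle_trans with (1 := Rmin_l _ _), Rmin_l).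
  assert (L2 : lam <= d0 / (4 * Cmod (z - v0))) by (apply Rle_trans with (1 := Rmin_l _ _), Rmin_r).
  assert (L3 : lam <= Cmod (tri k v0 z w) / (2 * M * (per v0 z w + 1))) by apply Rmin_r.
  specialize (Main lam ltac:(lra)).
  apply Rle_not_lt in Main; [apply Main|].
  - apply Rle_lt_trans with (M * (Cmod (tri k v0 z w) / (2 * M * (per v0 z w + 1)) * (per v0 z w + 1))).
    + apply Rmult_le_compat_l; [lra|]. apply Rmult_le_compat; lra.
    + replace (M * (Cmod (tri k v0 z w) / (2 * M * (per v0 z w + 1)) * (per v0 z w + 1))) with (Cmod (tri k v0 z w) / 2) by (field; lra). lra.
  - apply Rle_lt_trans with (d0 / (4 * Cmod (z - v0)) * (2 * Cmod (z - v0))). apply Rmult_le_compat_r; lra.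
    replace (d0 / (4 * Cmod (z - v0)) * (2 * Cmod (z - v0))) with (d0 / 2) by (field; lra). lra.
Qed.

Lemma primitive_exists : exists F, forall z, D z -> cder F z (k z).
Proof.
  exists (seg k v0). intros z Hz eps He.
  destruct (Dopen z Hz) as (d1 & Hd1 & HD1).
  destruct (kcont z Hz eps He) as (d2 & Hd2 & HD2).
  (* At z = v0 the triangle is degenerate and imposes no condition, so any positive value serves. *)
  set (d3 := if Ceq_dec z v0 then 1 else Cmod (z - v0) / 2).
  assert (Hd3 : 0 < d3).
  { unfold d3. destruct (Ceq_dec z v0) as [E|E]; [lra|].
    assert (0 < Cmod (z - v0)); [|lra]. apply Cmod_neq_0. intros E'. apply E.
    replace z with (z - v0 + v0)%C by ring. rewrite E'. ring. }
  exists (Rmin d1 (Rmin d2 d3)). split; [repeat apply Rmin_pos; auto|]. intros w Hw.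
  apply Rmin_Rgt in Hw. destruct Hw as [W1 Hw]. apply Rmin_Rgt in Hw. destruct Hw as [W2 W3].
  assert (T : tri k v0 z w = 0).
  { unfold d3 in W3. destruct (Ceq_dec z v0) as [E|E].
    - subst z. unfold tri. rewrite seg_point, (seg_rev k v0 w) by (apply seg_cont_D; auto). ring.
    - apply tri_far; auto. lra. }
  unfold tri in T. rewrite (seg_rev k v0 w) in T by (apply seg_cont_D; auto).
  replace (seg k v0 w - seg k v0 z)%C with (seg k z w)%C.
  2:{ rewrite <- (Cplus_0_r (seg k v0 w)), <- T. ring. }
  assert (HS : is_seg (fun x => k x - k z)%C z w (seg k z w - k z * (w - z))).
  { apply is_seg_minus. apply seg_correct. apply seg_cont_D; auto.
    replace (k z * (w - z))%C with (k z * w - k z * z)%C by ring.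
    apply (is_seg_ftc (fun x => k z * x)%C).
    - intros x _. eapply cder_eq. apply cder_scal, cder_id. ring.
    - intros x _. apply ccont_const. }
  apply (is_seg_bound _ _ _ _ eps HS).
  intros x (t & Ht & ->). left. apply HD2.
  replace (z + t * (w - z) - z)%C with (RtoC t * (w - z))%C by ring.
  rewrite Cmod_mult, Cmod_R, Rabs_right by lra. generalize (Cmod_ge_0 (w - z)). nra.
Qed.

End Primitive.

(** * Cauchy's formula and power series *)

Definition brect (g : C -> C) (x0 x1 y0 y1 : R) : C :=
  (seg g (x0, y0) (x1, y0) + seg g (x1, y0) (x1, y1) + seg g (x1, y1) (x0, y1) + seg g (x0, y1) (x0, y0))%C.

Definition bd (x0 x1 y0 y1 : R) (z : C) : Prop :=
  on_seg (x0, y0) (x1, y0) z \/ on_seg (x1, y0) (x1, y1) z \/ on_seg (x1, y1) (x0, y1) z \/ on_seg (x0, y1) (x0, y0) z.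

Lemma cont_bd g x0 x1 y0 y1 : (forall z, bd x0 x1 y0 y1 z -> ccont g z) ->
  ccont_on_seg g (x0, y0) (x1, y0) /\ ccont_on_seg g (x1, y0) (x1, y1) /\
  ccont_on_seg g (x1, y1) (x0, y1) /\ ccont_on_seg g (x0, y1) (x0, y0).
Proof. intros H. unfold bd in H. repeat split; intros z Hz; apply H; auto. Qed.

Lemma seg_plus f g a b : ccont_on_seg f a b -> ccont_on_seg g a b ->
  seg (fun z => f z + g z)%C a b = (seg f a b + seg g a b)%C.
Proof. intros Hf Hg. apply is_seg_eq. apply is_seg_plus; apply seg_correct; assumption. Qed.

Lemma seg_scal c g a b : ccont_on_seg g a b -> seg (fun z => c * g z)%C a b = (c * seg g a b)%C.
Proof. intros Hg. apply is_seg_eq. apply is_seg_scal; apply seg_correct; assumption. Qed.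

Lemma seg_ftc F g a b : ccont_on_seg g a b -> (forall z, on_seg a b z -> cder F z (g z)) ->
  seg g a b = (F b - F a)%C.
Proof. intros Hg HF. apply is_seg_eq. apply is_seg_ftc; assumption. Qed.

Lemma brect_plus f g x0 x1 y0 y1 :
  (forall z, bd x0 x1 y0 y1 z -> ccont f z) -> (forall z, bd x0 x1 y0 y1 z -> ccont g z) ->
  brect (fun z => f z + g z)%C x0 x1 y0 y1 = (brect f x0 x1 y0 y1 + brect g x0 x1 y0 y1)%C.
Proof.
  intros Hf Hg. apply cont_bd in Hf. apply cont_bd in Hg.
  destruct Hf as (F1 & F2 & F3 & F4). destruct Hg as (G1 & G2 & G3 & G4). unfold brect.
  rewrite !seg_plus by assumption. ring.
Qed.

Lemma brect_scal c g x0 x1 y0 y1 : (forall z, bd x0 x1 y0 y1 z -> ccont g z) ->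
  brect (fun z => c * g z)%C x0 x1 y0 y1 = (c * brect g x0 x1 y0 y1)%C.
Proof.
  intros Hg. apply cont_bd in Hg.
  destruct Hg as (G1 & G2 & G3 & G4). unfold brect.
  rewrite !seg_scal by assumption. ring.
Qed.

Lemma brect_ext f g x0 x1 y0 y1 : (forall z, bd x0 x1 y0 y1 z -> ccont f z) ->
  (forall z, bd x0 x1 y0 y1 z -> f z = g z) -> brect g x0 x1 y0 y1 = brect f x0 x1 y0 y1.
Proof.
  intros Hf H. apply cont_bd in Hf. destruct Hf as (G1 & G2 & G3 & G4). unfold bd in H. unfold brect.
  f_equal; [f_equal; [f_equal|]|]; apply is_seg_eq; (apply is_seg_ext with f; [intros z Hz; apply H; auto|apply seg_correct; auto]).
Qed.

Lemma brect_primitive F g x0 x1 y0 y1 : (forall z, bd x0 x1 y0 y1 z -> ccont g z) ->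
  (forall z, bd x0 x1 y0 y1 z -> cder F z (g z)) -> brect g x0 x1 y0 y1 = 0.
Proof.
  intros Hf H. apply cont_bd in Hf. destruct Hf as (G1 & G2 & G3 & G4). unfold bd in H. unfold brect.
  rewrite !(seg_ftc F g) by (assumption || (intros z Hz; apply H; auto)). ring.
Qed.

Lemma Cmod_horiz x0 x1 y : Cmod ((x1, y) - (x0, y)) = Rabs (x1 - x0).
Proof. rewrite <- Cmod_R. f_equal. apply injective_projections; simpl; ring. Qed.

Lemma Cmod_vert x y0 y1 : Cmod ((x, y1) - (x, y0)) = Rabs (y1 - y0).
Proof.
  replace ((x, y1) - (x, y0))%C with (Ci * RtoC (y1 - y0))%C by (apply injective_projections; simpl; ring).
  rewrite Cmod_mult, Cmod_Ci, Cmod_R. ring.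
Qed.

Lemma brect_bound g x0 x1 y0 y1 M : x0 <= x1 -> y0 <= y1 -> (forall z, bd x0 x1 y0 y1 z -> ccont g z) ->
  (forall z, bd x0 x1 y0 y1 z -> Cmod (g z) <= M) ->
  Cmod (brect g x0 x1 y0 y1) <= M * (2 * ((x1 - x0) + (y1 - y0))).
Proof.
  intros Hx Hy Hf H. apply cont_bd in Hf. destruct Hf as (G1 & G2 & G3 & G4). unfold bd in H. unfold brect.
  assert (A1 := seg_bound g _ _ M G1 (fun z Hz => H z (or_introl Hz))).
  assert (A2 := seg_bound g _ _ M G2 (fun z Hz => H z (or_intror (or_introl Hz)))).
  assert (A3 := seg_bound g _ _ M G3 (fun z Hz => H z (or_intror (or_intror (or_introl Hz))))).
  assert (A4 := seg_bound g _ _ M G4 (fun z Hz => H z (or_intror (or_intror (or_intror Hz))))).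
  rewrite Cmod_horiz, Rabs_right in A1 by lra. rewrite Cmod_vert, Rabs_right in A2 by lra.
  rewrite Cmod_horiz, Rabs_left1 in A3 by lra. rewrite Cmod_vert, Rabs_left1 in A4 by lra.
  eapply Rle_trans; [apply Cmod_triangle|]. eapply Rle_trans; [apply Rplus_le_compat_r, Cmod_triangle|].
  eapply Rle_trans; [apply Rplus_le_compat_r, Rplus_le_compat_r, Cmod_triangle|]. lra.
Qed.

Lemma bd_crect x0 x1 y0 y1 z : x0 <= x1 -> y0 <= y1 -> bd x0 x1 y0 y1 z -> crect x0 x1 y0 y1 z.
Proof.
  intros Hx Hy [H|[H|[H|H]]]; refine (convex_crect x0 x1 y0 y1 _ _ z _ _ H); unfold crect, Re, Im; simpl; lra.
Qed.

Lemma bd_side x0 x1 y0 y1 z : bd x0 x1 y0 y1 z -> Re z = x0 \/ Re z = x1 \/ Im z = y0 \/ Im z = y1.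
Proof.
  intros [(t & Ht & ->)|[(t & Ht & ->)|[(t & Ht & ->)|(t & Ht & ->)]]]; rewrite Re_seg, Im_seg; unfold Re, Im; simpl; lra.
Qed.

Lemma bd_far x0 x1 y0 y1 z v d : bd x0 x1 y0 y1 z ->
  x0 + d <= Re v <= x1 - d -> y0 + d <= Im v <= y1 - d -> d <= Cmod (z - v).
Proof.
  intros Hz Hx Hy. generalize (re_sub_le z v) (im_sub_le z v).
  destruct (bd_side _ _ _ _ _ Hz) as [E|[E|[E|E]]]; rewrite E.
  - generalize (Rle_abs (- (x0 - Re v))). rewrite Rabs_Ropp. lra.
  - generalize (Rle_abs (x1 - Re v)). lra.
  - generalize (Rle_abs (- (y0 - Im v))). rewrite Rabs_Ropp. lra.
  - generalize (Rle_abs (y1 - Im v)). lra.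
Qed.

Lemma Cminus_neq_0 (z v : C) : z <> v -> (z - v)%C <> 0.
Proof. intros H E. apply H. replace z with (z - v + v)%C by ring. rewrite E. ring. Qed.

Lemma ccont_inv_sub (v z : C) : z <> v -> ccont (fun z => / (z - v))%C z.
Proof.
  intros H. eapply ccont_cder. apply cder_comp with (f := Cinv) (g := fun z => (z - v)%C).
  apply cder_inv. apply Cminus_neq_0, H. apply cder_minus. apply cder_id. apply cder_const.
Qed.

Lemma rect_margin x0 x1 y0 y1 v : rect x0 x1 y0 y1 v ->
  exists d, 0 < d /\ x0 + d <= Re v <= x1 - d /\ y0 + d <= Im v <= y1 - d.
Proof.
  intros [Hx Hy].
  exists (Rmin (Rmin (Re v - x0) (x1 - Re v)) (Rmin (Im v - y0) (y1 - Im v))).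
  split; [repeat apply Rmin_pos; lra|]. unfold Rmin. repeat destruct Rle_dec; lra.
Qed.

(** The difference quotient of f at v, completed by the derivative [l0], is continuous and
    holomorphic off v; hence it has a primitive and its boundary integral vanishes. The integral of
    1 / (z - v) is left unevaluated in the place of 2 pi i. *)
Lemma cauchy_rect f D x0 x1 y0 y1 v : convex D -> copen D -> hull_closed D ->
  (forall z, D z -> exists l, cder f z l) -> (forall z, crect x0 x1 y0 y1 z -> D z) ->
  rect x0 x1 y0 y1 v ->
  brect (fun z => f z * / (z - v))%C x0 x1 y0 y1 = (f v * brect (fun z => / (z - v))%C x0 x1 y0 y1)%C.
Proof.
  intros D1 D2 D3 Hf HD Hv.
  assert (Hx : x0 <= x1) by (destruct Hv; lra). assert (Hy : y0 <= y1) by (destruct Hv; lra).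
  assert (Dv : D v) by (apply HD; destruct Hv; split; lra).
  destruct (Hf v Dv) as [l0 Hl0].
  set (k := fun z => if Ceq_dec z v then l0 else ((f z - f v) * / (z - v))%C).
  assert (Hk : forall z, D z -> z <> v -> exists l, cder k z l).
  { intros z Hz Hne. destruct (Hf z Hz) as [l Hl]. eexists.
    apply cder_ext_loc with (fun z => ((f z - f v) * / (z - v))%C).
    - exists (Cmod (z - v)). split; [apply Cmod_neq_0, Cminus_neq_0, Hne|].
      intros w Hw. unfold k. destruct (Ceq_dec w v) as [->|]; [|reflexivity].
      rewrite Cmod_sub_sym in Hw. lra.
    - apply cder_mult. apply cder_minus; [exact Hl|apply cder_const].
      apply cder_comp with (f := Cinv) (g := fun z => (z - v)%C).
      apply cder_inv. apply Cminus_neq_0, Hne. apply cder_minus. apply cder_id. apply cder_const. }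
  assert (Hkc : forall z, D z -> ccont k z).
  { intros z Hz. destruct (Ceq_dec z v) as [->|Hne].
    - intros e He. destruct (Hl0 (e / 2)) as (d & Hd & H); [lra|]. exists d; split; [exact Hd|].
      intros w Hw. unfold k. destruct (Ceq_dec v v) as [_|n]; [|congruence].
      destruct (Ceq_dec w v) as [->|Hwv].
      + replace (l0 - l0)%C with (RtoC 0) by ring. rewrite Cmod_0. exact He.
      + specialize (H w Hw). assert (N := Cminus_neq_0 _ _ Hwv). assert (P := Cmod_neq_0 _ N).
        replace ((f w - f v) * / (w - v) - l0)%C with ((f w - f v - l0 * (w - v)) * / (w - v))%C by (field; exact N).
        rewrite Cmod_mult, Cmod_inv by exact N.
        apply Rle_lt_trans with (e / 2 * Cmod (w - v) * / Cmod (w - v)).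
        apply Rmult_le_compat_r; [left; apply Rinv_0_lt_compat; exact P|exact H].
        rewrite Rmult_assoc, Rinv_r by lra. lra.
    - destruct (Hk z Hz Hne) as [l Hl]. exact (ccont_cder _ _ _ Hl). }
  destruct (primitive_exists D v k D1 D2 D3 Dv Hkc Hk) as [F HF].
  destruct (rect_margin _ _ _ _ _ Hv) as (d & Hd & Hd1 & Hd2).
  assert (Hbd : forall z, bd x0 x1 y0 y1 z -> D z /\ z <> v).
  { intros z Hz. split; [apply HD, bd_crect; auto|]. intros ->.
    generalize (bd_far _ _ _ _ _ _ _ Hz Hd1 Hd2). replace (v - v)%C with (RtoC 0) by ring. rewrite Cmod_0. lra. }
  rewrite <- brect_scal by (intros z Hz; apply ccont_inv_sub, Hbd, Hz).
  rewrite (brect_ext (fun z => k z + f v * / (z - v))%C).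
  - rewrite brect_plus.
    + rewrite (brect_primitive F k). ring.
      intros z Hz; apply Hkc, Hbd, Hz. intros z Hz; apply HF, Hbd, Hz.
    + intros z Hz; apply Hkc, Hbd, Hz.
    + intros z Hz. apply ccont_scal, ccont_inv_sub, Hbd, Hz.
  - intros z Hz. apply ccont_plus. apply Hkc, Hbd, Hz. apply ccont_scal, ccont_inv_sub, Hbd, Hz.
  - intros z Hz. unfold k. destruct (Hbd z Hz) as [_ N]. destruct (Ceq_dec z v) as [E|_]; [congruence|].
    field. apply Cminus_neq_0, N.
Qed.

(** The cross product Im ((b - a) conj(z - v)) is constant along the segment, so the imaginary part
    of the integrand is this constant divided by |z - v|^2. It measures the angle under which the
    segment is seen from v. *)
Lemma Im_seg_inv a b v rho : 0 <= Im ((b - a) * Cconj (a - v)) ->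
  (forall z, on_seg a b z -> 0 < Cmod (z - v) <= rho) ->
  Im ((b - a) * Cconj (a - v)) / rho ^ 2 <= Im (seg (fun z => / (z - v))%C a b).
Proof.
  intros H0 Hz. set (kap := Im ((b - a) * Cconj (a - v))) in *.
  assert (HS : is_seg (fun z => / (z - v))%C a b (seg (fun z => / (z - v))%C a b)).
  { apply seg_correct. intros z Hs. apply ccont_inv_sub. intros ->.
    generalize (Hz v Hs). replace (v - v)%C with (RtoC 0) by ring. rewrite Cmod_0. lra. }
  apply is_cint_pair in HS. destruct HS as [_ HS].
  assert (Hc := is_RInt_const (V := R_NormedModule) 0 1 (kap / rho ^ 2)).
  refine (is_RInt_le _ _ 0 1 _ _ _ _ HS _); [lra| |].
  - replace (kap / rho ^ 2) with (scal (K := R_AbsRing) (V := R_NormedModule) (1 - 0) (kap / rho ^ 2)). exact Hc.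
    unfold scal; simpl; unfold mult; simpl; ring.
  - intros t Ht. destruct (Hz (a + RtoC t * (b - a))%C) as [P1 P2]; [exists t; split; [lra|reflexivity]|].
    set (w := (a + RtoC t * (b - a) - v)%C) in *.
    assert (N := Cmod_pos_neq _ P1).
    replace ((b - a) * / w)%C with (RtoC (/ Cmod w ^ 2) * ((b - a) * Cconj w))%C.
    + rewrite Im_Cmult, Re_RtoC, Im_RtoC.
      replace (Im ((b - a) * Cconj w)) with kap.
      * rewrite Rmult_0_l, Rplus_0_r, Rmult_comm. apply Rmult_le_compat_l; [exact H0|].
        apply Rinv_le_contravar; [apply pow_lt; exact P1|apply pow_incr; lra].
      * unfold kap, w. destruct a as [a1 a2], b as [b1 b2], v as [v1 v2]. unfold Im; simpl. ring.
    + rewrite RtoC_inv by (apply pow_nonzero; lra). rewrite Cmod2_conj. field. split; [exact N|].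
      intros E. apply N. rewrite <- (Cconj_conj w), E. apply injective_projections; simpl; ring.
Qed.

Lemma Cmod_le_re_im z x y : Rabs (Re z) <= x -> Rabs (Im z) <= y -> Cmod z <= x + y.
Proof. destruct z as [a b]. intros H1 H2. unfold Re, Im in *; simpl in *. generalize (Cmod_le_sum a b). lra. Qed.

(** The strictly positive bound is taken from the left side because it does not involve [x1], which
    tends to infinity in Watson's lemma. *)
Lemma brect_inv_lower x0 x1 y0 y1 v : rect x0 x1 y0 y1 v ->
  0 <= Im (seg (fun z => / (z - v))%C (x0, y0) (x1, y0)) /\
  0 <= Im (seg (fun z => / (z - v))%C (x1, y0) (x1, y1)) /\
  0 <= Im (seg (fun z => / (z - v))%C (x1, y1) (x0, y1)) /\
  (y1 - y0) * (Re v - x0) / ((Re v - x0) + (y1 - y0)) ^ 2 <= Im (seg (fun z => / (z - v))%C (x0, y1) (x0, y0)).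
Proof.
  intros Hv. destruct (rect_margin _ _ _ _ _ Hv) as (d & Hd & Hd1 & Hd2). destruct Hv as [Hx Hy].
  assert (B : forall z, bd x0 x1 y0 y1 z -> 0 < Cmod (z - v) <= (x1 - x0) + (y1 - y0)).
  { intros z Hz. split. generalize (bd_far _ _ _ _ _ _ _ Hz Hd1 Hd2). lra.
    apply bd_crect in Hz; [|lra|lra]. destruct Hz as [Z1 Z2].
    apply Cmod_le_re_im; [rewrite Re_Cminus|rewrite Im_Cminus]; apply Rabs_le; lra. }
  assert (Pos : forall p q, 0 <= p -> 0 <= p / q ^ 2).
  { intros p q Hp. unfold Rdiv. apply Rmult_le_pos; [exact Hp|]. 
    destruct (Req_dec q 0) as [->|N]. replace (0 ^ 2) with 0 by ring. rewrite Rinv_0; lra.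
    left; apply Rinv_0_lt_compat. apply pow2_gt_0; auto. }
  unfold bd in B. destruct v as [v1 v2]. unfold Re, Im in Hx, Hy, Hd1, Hd2; simpl in Hx, Hy, Hd1, Hd2.
  split; [|split; [|split]].
  - eapply Rle_trans; [|apply Im_seg_inv; [|intros z Hz; apply B; tauto]]; [apply Pos|]; unfold Im; simpl; nra.
  - eapply Rle_trans; [|apply Im_seg_inv; [|intros z Hz; apply B; tauto]]; [apply Pos|]; unfold Im; simpl; nra.
  - eapply Rle_trans; [|apply Im_seg_inv; [|intros z Hz; apply B; tauto]]; [apply Pos|]; unfold Im; simpl; nra.
  - assert (B' : forall z, on_seg (x0, y1) (x0, y0) z -> 0 < Cmod (z - (v1, v2)) <= (v1 - x0) + (y1 - y0)).
    { intros z Hz. split; [apply B; tauto|]. destruct Hz as (t & Ht & ->).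
      apply Cmod_le_re_im; [rewrite Re_Cminus, Re_seg|rewrite Im_Cminus, Im_seg]; unfold Re, Im; simpl; apply Rabs_le; nra. }
    eapply Rle_trans; [|apply Im_seg_inv; [|exact B']]; unfold Re, Im; simpl; [|nra].
    right. f_equal. ring.
Qed.

(** * Partial sums and the power series of a holomorphic function *)

Notation psum := fps_partial_sum.

Lemma psum_S c n z : psum c (S n) z = (psum c n z + c n * z ^ n)%C.
Proof.
  destruct n as [|n]; simpl.
  - rewrite sum_O. ring.
  - rewrite sum_Sn. reflexivity.
Qed.

Lemma psum_0 c z : psum c 0 z = 0.
Proof. reflexivity. Qed.

Definition is_psum (c : fps) (z l : C) : Prop := clim (fun n => psum c n z) l.

Lemma fps_sum_is_psum c z l : fps_sum c z l <-> is_psum c z l.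
Proof.
  (* [sum_n] includes the term of index n, [psum] stops before it. *)
  assert (E : forall n, sum_n (G := C_AbelianMonoid) (fun k => scal (K := C_AbsRing) (V := C_NormedModule) (pow_n (K := C_AbsRing) z k) (c k)) n = psum c (S n) z).
  { intros n. simpl. apply sum_n_ext. intros k.
    assert (P : pow_n (K := C_AbsRing) z k = (z ^ k)%C).
    { induction k as [|k IH]; [reflexivity|]. simpl. rewrite IH. reflexivity. }
    rewrite P. apply Cmult_comm. }
  split.
  - intros H e He.
    assert (HP : locally (T := C_UniformSpace) l (fun w => Cmod (w - l) < e)).
    { apply locally_C_Cmod. exists e; auto. }
    destruct (H _ HP) as [N HN]. exists (S N). intros n Hn. destruct n as [|n]; [lia|].
    rewrite <- E. apply HN. lia.
  - intros H P HP. apply locally_C_Cmod in HP. destruct HP as (e & He & HP).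
    destruct (H e He) as [N HN]. exists N. intros n Hn. apply HP.
    change (Cmod (sum_n (G := C_AbelianMonoid) (fun k => scal (K := C_AbsRing) (V := C_NormedModule) (pow_n (K := C_AbsRing) z k) (c k)) n - l) < e).
    rewrite E. apply HN. lia.
Qed.

Lemma clim_scal c u l : clim u l -> clim (fun n => c * u n)%C (c * l).
Proof.
  intros H e He. assert (Hc := Cmod_ge_0 c).
  destruct (H (e / (Cmod c + 1))) as [N HN]; [apply Rdiv_lt_0_compat; lra|].
  exists N. intros n Hn. replace (c * u n - c * l)%C with (c * (u n - l))%C by ring.
  rewrite Cmod_mult. specialize (HN n Hn).
  apply Rle_lt_trans with (Cmod c * (e / (Cmod c + 1))). apply Rmult_le_compat_l; lra.
  apply Rlt_le_trans with ((Cmod c + 1) * (e / (Cmod c + 1))).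
  apply Rmult_lt_compat_r; [apply Rdiv_lt_0_compat; lra|lra]. right; field; lra.
Qed.

Lemma clim_plus u v l l' : clim u l -> clim v l' -> clim (fun n => u n + v n)%C (l + l').
Proof.
  intros H H' e He. destruct (H (e / 2)) as [N HN]; [lra|]. destruct (H' (e / 2)) as [N' HN']; [lra|].
  exists (Nat.max N N'). intros n Hn. specialize (HN n ltac:(lia)). specialize (HN' n ltac:(lia)).
  replace (u n + v n - (l + l'))%C with ((u n - l) + (v n - l'))%C by ring.
  apply Rle_lt_trans with (1 := Cmod_triangle _ _). lra.
Qed.

Lemma clim_const (l : C) : clim (fun _ => l) l.
Proof. intros e He. exists O. intros n _. replace (l - l)%C with (RtoC 0) by ring. rewrite Cmod_0; auto. Qed.

Lemma clim_minus u v l l' : clim u l -> clim v l' -> clim (fun n => u n - v n)%C (l - l').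
Proof.
  intros H H'. replace (l - l')%C with (l + (- (1)) * l')%C by ring.
  apply clim_eventually with (fun n => u n + (- (1)) * v n)%C; [exists O; intros; ring|].
  apply clim_plus; [exact H|]. apply clim_scal. exact H'.
Qed.

Lemma clim_ext u v l : (forall n, u n = v n) -> clim u l -> clim v l.
Proof. intros H. apply clim_eventually. exists O. auto. Qed.

Lemma pow_small P q e : 0 <= q < 1 -> 0 < e -> exists N, forall n, (N <= n)%nat -> P * q ^ n < e.
Proof.
  intros Hq He.
  destruct (pow_lt_1_zero q) with (y := e / (Rabs P + 1)) as [N HN].
  rewrite Rabs_right; lra. apply Rdiv_lt_0_compat; [lra|]. generalize (Rabs_pos P); lra.
  exists N. intros n Hn. specialize (HN n Hn).
  assert (H0 : 0 <= q ^ n) by (apply pow_le; lra).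
  rewrite Rabs_right in HN by lra.
  assert (HP := Rle_abs P). assert (HP' := Rabs_pos P).
  apply Rle_lt_trans with ((Rabs P + 1) * q ^ n). apply Rmult_le_compat_r; lra.
  apply Rlt_le_trans with ((Rabs P + 1) * (e / (Rabs P + 1))). apply Rmult_lt_compat_l; lra.
  right; field; lra.
Qed.

Lemma clim_geom_0 u P q : 0 <= q < 1 -> (forall n, Cmod (u n) <= P * q ^ n) -> clim u 0.
Proof.
  intros Hq H e He. destruct (pow_small P q e Hq He) as [N HN]. exists N. intros n Hn.
  replace (u n - 0)%C with (u n) by ring. apply Rle_lt_trans with (1 := H n). auto.
Qed.

Section CauchySeries.

Variables (f : C -> C) (z0 : C) (r M : R).
Hypothesis (Hr : 0 < r).
Let D := rect (Re z0 - 2 * r) (Re z0 + 2 * r) (Im z0 - 2 * r) (Im z0 + 2 * r).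
Hypothesis (Hf : forall z, D z -> exists l, cder f z l).
Hypothesis (HM : forall z, D z -> Cmod (f z) <= M).

Let sq (g : C -> C) := brect g (Re z0 - r) (Re z0 + r) (Im z0 - r) (Im z0 + r).
Let bds := bd (Re z0 - r) (Re z0 + r) (Im z0 - r) (Im z0 + r).

Lemma bds_D z : bds z -> D z.
Proof. intros H. apply bd_crect in H; [|lra|lra]. destruct H. split; lra. Qed.

Lemma bds_far z : bds z -> r <= Cmod (z - z0).
Proof. intros H. apply (bd_far _ _ _ _ _ _ _ H); lra. Qed.

Lemma bds_neq z w : bds z -> Cmod (w - z0) < r -> z <> w.
Proof. intros H Hw ->. generalize (bds_far w H). lra. Qed.

Lemma rect_center w : Cmod (w - z0) < r -> rect (Re z0 - r) (Re z0 + r) (Im z0 - r) (Im z0 + r) w.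
Proof.
  intros H. generalize (re_sub_le w z0) (im_sub_le w z0). intros A B.
  apply Rabs_le_between in A. apply Rabs_le_between in B. split; lra.
Qed.

Lemma z0_near : Cmod (z0 - z0) < r.
Proof. replace (z0 - z0)%C with (RtoC 0) by ring. rewrite Cmod_0. exact Hr. Qed.

Lemma bds_cont n w z : Cmod (w - z0) < r -> bds z ->
  ccont (fun z => (/ (z - z0)) ^ n * / (z - w))%C z.
Proof.
  intros Hw Hz. apply ccont_mult. 2: apply ccont_inv_sub, bds_neq; auto.
  eapply ccont_cder. apply cder_pow. apply cder_comp with (f := Cinv) (g := fun z => (z - z0)%C).
  apply cder_inv. apply Cminus_neq_0, bds_neq; auto using z0_near.
  apply cder_minus. apply cder_id. apply cder_const.
Qed.

Lemma bds_kernel_bound n w z : Cmod (w - z0) < r -> bds z ->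
  Cmod ((/ (z - z0)) ^ n * / (z - w)) <= (/ r) ^ n * / (r - Cmod (w - z0)).
Proof.
  intros Hw Hz. assert (F := bds_far z Hz).
  assert (N1 := Cminus_neq_0 _ _ (bds_neq z z0 Hz z0_near)).
  assert (N2 := Cminus_neq_0 _ _ (bds_neq z w Hz Hw)).
  rewrite Cmod_mult, Cmod_pow, !Cmod_inv by assumption.
  apply Rmult_le_compat.
  - apply pow_le. left; apply Rinv_0_lt_compat. lra.
  - left; apply Rinv_0_lt_compat, Cmod_neq_0, N2.
  - apply pow_incr. split. left; apply Rinv_0_lt_compat; lra. apply Rinv_le_contravar; lra.
  - apply Rinv_le_contravar. lra. generalize (Cmod_chain z w z0). lra.
Qed.

(** Iterates 1 / (z - w) = 1 / (z - z0) + (w - z0) / ((z - z0) (z - w)); the remainder is O((|w -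
    z0| / r)^n) since the contour keeps distance r from z0. Continuity of g on the contour is
    enough, so that the expansion serves for f and for the constant 1. *)
Lemma sq_series g w : (forall z, bds z -> ccont g z) -> Cmod (w - z0) < r ->
  (exists B, forall z, bds z -> Cmod (g z) <= B) ->
  clim (fun n => psum (fun k => sq (fun z => g z * ((/ (z - z0)) ^ k * / (z - z0)))%C) n (w - z0))
    (sq (fun z => g z * / (z - w))%C).
Proof.
  intros Hg Hw [B HB].
  set (c := fun k => sq (fun z => g z * ((/ (z - z0)) ^ k * / (z - z0)))%C).
  set (I := fun n => sq (fun z => g z * ((/ (z - z0)) ^ n * / (z - w)))%C).
  assert (Step : forall n, I n = (c n + (w - z0) * I (S n))%C).
  { intros n. unfold I, c, sq. 
    rewrite <- brect_scal by (intros z Hz; apply ccont_mult; [apply Hg|apply bds_cont]; auto).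
    rewrite <- brect_plus.
    - apply brect_ext.
      + intros z Hz. apply ccont_plus. apply ccont_mult; [apply Hg|apply bds_cont]; auto using z0_near.
        apply ccont_scal, ccont_mult; [apply Hg|apply bds_cont]; auto.
      + intros z Hz. simpl.
        assert (N1 := Cminus_neq_0 _ _ (bds_neq z z0 Hz z0_near)).
        assert (N2 := Cminus_neq_0 _ _ (bds_neq z w Hz Hw)). field. auto.
    - intros z Hz; apply ccont_mult; [apply Hg|apply bds_cont]; auto using z0_near.
    - intros z Hz. apply ccont_scal, ccont_mult; [apply Hg|apply bds_cont]; auto. }
  assert (Sum : forall n, I O = (psum c n (w - z0) + (w - z0) ^ n * I n)%C).
  { induction n as [|n IH]. rewrite psum_0. simpl. ring.
    rewrite psum_S, IH, (Step n). simpl. ring. }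
  assert (E0 : I O = sq (fun z => g z * / (z - w))%C).
  { unfold I, sq. symmetry. apply brect_ext. intros z Hz. apply ccont_mult; [apply Hg|apply bds_cont]; auto. intros z _. simpl. ring. }
  rewrite <- E0.
  assert (HI : forall n, Cmod ((w - z0) ^ n * I n) <= (Rmax B 0 * / (r - Cmod (w - z0)) * (2 * (2 * r + 2 * r))) * (Cmod (w - z0) / r) ^ n).
  { intros n. rewrite Cmod_mult, Cmod_pow.
    assert (HIn : Cmod (I n) <= Rmax B 0 * ((/ r) ^ n * / (r - Cmod (w - z0))) * (2 * ((Re z0 + r - (Re z0 - r)) + (Im z0 + r - (Im z0 - r))))).
    { unfold I, sq. apply brect_bound; [lra|lra| |].
      - intros z Hz. apply ccont_mult; [apply Hg|apply bds_cont]; auto.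
      - intros z Hz. rewrite Cmod_mult. apply Rmult_le_compat; try apply Cmod_ge_0.
        apply Rle_trans with (2 := Rmax_l _ _), HB, Hz. apply bds_kernel_bound; auto. }
    apply Rle_trans with (Cmod (w - z0) ^ n * (Rmax B 0 * ((/ r) ^ n * / (r - Cmod (w - z0))) * (2 * ((Re z0 + r - (Re z0 - r)) + (Im z0 + r - (Im z0 - r)))))).
    apply Rmult_le_compat_l; [apply pow_le, Cmod_ge_0|exact HIn].
    right. unfold Rdiv. rewrite Rpow_mult_distr. ring. }
  apply clim_ext with (fun n => I O - (w - z0) ^ n * I n)%C.
  { intros n. rewrite (Sum n) at 1. ring. }
  cut (clim (fun n => I O - (w - z0) ^ n * I n)%C (I O - 0)); [replace (I O - 0)%C with (I O) by ring; auto|].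
  apply clim_minus. apply clim_const.
  eapply clim_geom_0; [|exact HI]. split.
  - unfold Rdiv. apply Rmult_le_pos; [apply Cmod_ge_0|left; apply Rinv_0_lt_compat; lra].
  - apply Rmult_lt_reg_r with r; [lra|]. unfold Rdiv. rewrite Rmult_assoc, Rinv_l by lra. lra.
Qed.

(* The value 2 pi i of this integral is never needed: only that it is nonzero ([kap_lower]) and does not
   depend on the position of the pole ([sq_inv]). *)
Let kap := sq (fun z => / (z - z0))%C.

(** Each side adds at least 1 to the imaginary part: its cross product is 2 r^2, and |z - z0|^2 <= 2
    r^2 on the square. *)
Lemma kap_lower : 4 <= Cmod kap.
Proof.
  apply Rle_trans with (Im kap); [|apply Rle_trans with (2 := im_le_Cmod kap), Rle_abs].
  unfold kap, sq, brect. rewrite !Im_Cplus.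
  assert (Side : forall a b, (forall z, on_seg a b z -> bds z) -> Im ((b - a) * Cconj (a - z0)) = 2 * r ^ 2 ->
     (forall z, on_seg a b z -> Cmod (z - z0) ^ 2 <= 2 * r ^ 2) ->
     1 <= Im (seg (fun z => / (z - z0))%C a b)).
  { intros a b H1 H2 H3.
    apply Rle_trans with (Im ((b - a) * Cconj (a - z0)) / sqrt (2 * r ^ 2) ^ 2).
    - rewrite H2, pow2_sqrt by nra. right; field. lra.
    - apply Im_seg_inv. rewrite H2; nra. intros z Hz. split. generalize (bds_far z (H1 z Hz)); lra.
      rewrite <- (sqrt_pow2 (Cmod (z - z0))) by apply Cmod_ge_0. apply sqrt_le_1_alt, H3, Hz. }
  assert (M2 : forall z, bds z -> Cmod (z - z0) ^ 2 <= 2 * r ^ 2).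
  { intros z Hz. apply bd_crect in Hz; [|lra|lra]. destruct Hz as [Z1 Z2].
    rewrite Cmod2_alt, Re_Cminus, Im_Cminus. nra. }
  assert (S1 := Side (Re z0 - r, Im z0 - r) (Re z0 + r, Im z0 - r)).
  assert (S2 := Side (Re z0 + r, Im z0 - r) (Re z0 + r, Im z0 + r)).
  assert (S3 := Side (Re z0 + r, Im z0 + r) (Re z0 - r, Im z0 + r)).
  assert (S4 := Side (Re z0 - r, Im z0 + r) (Re z0 - r, Im z0 - r)).
  unfold bds, bd in M2, S1, S2, S3, S4.
  assert (T1 : 1 <= Im (seg (fun z => / (z - z0))%C (Re z0 - r, Im z0 - r) (Re z0 + r, Im z0 - r))).
  { apply S1; [tauto| |intros; apply M2; tauto]. destruct z0 as [p q]; unfold Re, Im; simpl; ring. }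
  assert (T2 : 1 <= Im (seg (fun z => / (z - z0))%C (Re z0 + r, Im z0 - r) (Re z0 + r, Im z0 + r))).
  { apply S2; [tauto| |intros; apply M2; tauto]. destruct z0 as [p q]; unfold Re, Im; simpl; ring. }
  assert (T3 : 1 <= Im (seg (fun z => / (z - z0))%C (Re z0 + r, Im z0 + r) (Re z0 - r, Im z0 + r))).
  { apply S3; [tauto| |intros; apply M2; tauto]. destruct z0 as [p q]; unfold Re, Im; simpl; ring. }
  assert (T4 : 1 <= Im (seg (fun z => / (z - z0))%C (Re z0 - r, Im z0 + r) (Re z0 - r, Im z0 - r))).
  { apply S4; [tauto| |intros; apply M2; tauto]. destruct z0 as [p q]; unfold Re, Im; simpl; ring. }
  lra.
Qed.

(** The integrand is a power of z - z0 with exponent at most -2 and has a single-valued primitive.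
    It is written as the coefficient that [sq_series] produces for g = 1. *)
Lemma sq_inv_pow k : sq (fun z => 1 * ((/ (z - z0)) ^ S k * / (z - z0)))%C = 0.
Proof.
  unfold sq.
  apply (brect_primitive (fun z => - / RtoC (INR (S k)) * (/ (z - z0)) ^ S k)%C).
  - intros z Hz. apply ccont_scal with (c := RtoC 1) (f := fun z => ((/ (z - z0)) ^ S k * / (z - z0))%C).
    apply bds_cont; auto using z0_near.
  - intros z Hz.
    assert (N1 := Cminus_neq_0 _ _ (bds_neq z z0 Hz z0_near)).
    assert (N2 : RtoC (INR (S k)) <> 0).
    { intros E. injection E. intros E'. apply (not_0_INR (S k)); [lia|exact E']. }
    eapply cder_eq.
    apply cder_scal. apply cder_pow. apply cder_comp with (f := Cinv) (g := fun z => (z - z0)%C).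
    apply cder_inv; exact N1. apply cder_minus. apply cder_id. apply cder_const.
    replace (S k - 1)%nat with k by lia. simpl (_ ^ S k)%C. field. auto.
Qed.

(** Expanded by [sq_series] in powers of w - z0, the integral keeps only its constant term. *)
Lemma sq_inv w : Cmod (w - z0) < r -> sq (fun z => / (z - w))%C = kap.
Proof.
  intros Hw.
  assert (E : sq (fun z => / (z - w))%C = sq (fun z => 1 * / (z - w))%C).
  { unfold sq. symmetry. apply brect_ext. intros z Hz. apply ccont_inv_sub, bds_neq; auto. intros z _. ring. }
  rewrite E.
  apply (clim_unique (fun n => psum (fun k => sq (fun z => 1 * ((/ (z - z0)) ^ k * / (z - z0)))%C) n (w - z0))).
  - apply (sq_series (fun _ => RtoC 1)); auto. intros; apply ccont_const.
    exists 1. intros. rewrite Cmod_1. lra.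
  - apply clim_eventually with (fun _ => kap); [|apply clim_const].
    exists 1%nat. intros n Hn. induction n as [|n IH]; [lia|].
    rewrite psum_S. destruct n as [|n].
    + rewrite psum_0. simpl. rewrite Cplus_0_l, Cmult_1_r. unfold kap, sq. apply brect_ext.
      intros z Hz. apply ccont_scal with (c := RtoC 1) (f := fun z => (1 * / (z - z0))%C).
      apply ccont_scal. apply ccont_inv_sub, bds_neq; auto using z0_near. intros z _. simpl. ring.
    + rewrite <- IH by lia. rewrite sq_inv_pow. ring.
Qed.

Lemma cauchy_series : exists c : fps, (forall n, Cmod (c n) <= 2 * M / r ^ n) /\
  forall w, Cmod (w - z0) < r -> is_psum c (w - z0) (f w).
Proof.
  assert (K4 := kap_lower).
  assert (Kn : kap <> 0) by (apply Cmod_pos_neq; lra).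
  assert (Fc : forall z, bds z -> ccont f z).
  { intros z Hz. destruct (Hf z (bds_D z Hz)) as [l Hl]. exact (ccont_cder _ _ _ Hl). }
  exists (fun k => / kap * sq (fun z => f z * ((/ (z - z0)) ^ k * / (z - z0)))%C)%C. split.
  - intros n. rewrite Cmod_mult, Cmod_inv by exact Kn.
    assert (M0 : 0 <= M).
    { apply Rle_trans with (1 := Cmod_ge_0 (f z0)), HM. unfold D. split; lra. }
    assert (B : Cmod (sq (fun z => f z * ((/ (z - z0)) ^ n * / (z - z0)))%C) <= M * ((/ r) ^ n * / (r - Cmod (z0 - z0))) * (2 * ((Re z0 + r - (Re z0 - r)) + (Im z0 + r - (Im z0 - r))))).
    { unfold sq. apply brect_bound; [lra|lra| |].
      - intros z Hz. apply ccont_mult; [apply Fc|apply bds_cont]; auto using z0_near.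
      - intros z Hz. rewrite Cmod_mult. apply Rmult_le_compat; try apply Cmod_ge_0.
        apply HM, bds_D, Hz. apply bds_kernel_bound; auto using z0_near. }
    replace (z0 - z0)%C with (RtoC 0) in B by ring. rewrite Cmod_0, Rminus_0_r, pow_inv in B.
    (* The perimeter 8 r against |kap| >= 4 produces the factor 2. *)
    apply Rle_trans with (/ 4 * (M * (/ r ^ n * / r) * (2 * (Re z0 + r - (Re z0 - r) + (Im z0 + r - (Im z0 - r)))))).
    apply Rmult_le_compat; [left; apply Rinv_0_lt_compat; lra|apply Cmod_ge_0|apply Rinv_le_contravar; lra|exact B].
    right. field. split; [apply pow_nonzero|]; lra.
  - intros w Hw. unfold is_psum.
    replace (f w) with (/ kap * (sq (fun z => f z * / (z - w))%C))%C.
    + apply clim_ext with (fun n => / kap * psum (fun k => sq (fun z => f z * ((/ (z - z0)) ^ k * / (z - z0)))%C) n (w - z0))%C.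
      { induction n as [|n IH]. rewrite !psum_0. ring. rewrite !psum_S, <- IH. ring. }
      apply clim_scal. apply sq_series; auto. exists M. intros z Hz. apply HM, bds_D, Hz.
    + unfold sq. rewrite (cauchy_rect f D).
      * fold (sq (fun z => / (z - w))%C). rewrite sq_inv by auto. field. exact Kn.
      * apply convex_rect.
      * apply open_rect.
      * apply hull_closed_rect.
      * exact Hf.
      * intros z [Z1 Z2]. split; lra.
      * apply rect_center, Hw.
Qed.

End CauchySeries.

(** The open square of half-side rho / 2 lies in the disc, because |z| <= |Re z| + |Im z|;
    [cauchy_series] then applies with r = rho / 4. *)
Lemma cauchy_ball f z0 rho M : 0 < rho -> (forall z, Cmod (z - z0) < rho -> exists l, cder f z l) ->
  (forall z, Cmod (z - z0) < rho -> Cmod (f z) <= M) ->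
  exists c : fps, (forall n, Cmod (c n) <= 2 * M * (4 / rho) ^ n) /\
  forall w, Cmod (w - z0) < rho / 4 -> is_psum c (w - z0) (f w).
Proof.
  intros Hr Hf HM.
  assert (B : forall z, rect (Re z0 - 2 * (rho / 4)) (Re z0 + 2 * (rho / 4)) (Im z0 - 2 * (rho / 4)) (Im z0 + 2 * (rho / 4)) z -> Cmod (z - z0) < rho).
  { intros z [Z1 Z2].
    assert (A1 : Rabs (Re (z - z0)) < rho / 2) by (rewrite Re_Cminus; apply Rabs_def1; lra).
    assert (A2 : Rabs (Im (z - z0)) < rho / 2) by (rewrite Im_Cminus; apply Rabs_def1; lra).
    generalize (Cmod_le_re_im (z - z0) _ _ (Rle_refl _) (Rle_refl _)). lra. }
  destruct (cauchy_series f z0 (rho / 4) M) as (c & C1 & C2); [lra|auto|auto|].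
  exists c. split; [|exact C2]. intros n. apply Rle_trans with (1 := C1 n).
  right. unfold Rdiv at 1. rewrite <- pow_inv. f_equal. f_equal. field. lra.
Qed.

Lemma psum_at_0 c n : psum c (S n) 0 = c 0%nat.
Proof.
  induction n as [|n IH]. rewrite psum_S, psum_0. simpl. ring.
  rewrite psum_S, IH. simpl. ring.
Qed.

Lemma is_psum_at_0 c l : is_psum c 0 l -> l = c 0%nat.
Proof.
  intros H. apply (clim_unique _ _ _ H). apply clim_eventually with (fun _ => c 0%nat); [|apply clim_const].
  exists 1%nat. intros [|n] Hn; [lia|]. symmetry. apply psum_at_0.
Qed.

Lemma Cmod_zero_sub (z : C) : Cmod (z - z) = 0.
Proof. replace (z - z)%C with (RtoC 0) by ring. apply Cmod_0. Qed.

Lemma cder_quadratic f z0 l d K : 0 < d -> 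
  (forall w, Cmod (w - z0) <= d -> Cmod (f w - f z0 - l * (w - z0)) <= K * Cmod (w - z0) ^ 2) -> cder f z0 l.
Proof.
  intros Hd H e He.
  exists (Rmin d (e / (Rabs K + 1))).
  assert (HK := Rabs_pos K). assert (HK' := Rle_abs K).
  split; [apply Rmin_pos; [lra|apply Rdiv_lt_0_compat; lra]|].
  intros w Hw. apply Rmin_Rgt in Hw. destruct Hw as [H1 H2].
  assert (P := Cmod_ge_0 (w - z0)).
  apply Rle_trans with (1 := H w ltac:(lra)).
  apply Rle_trans with ((Rabs K + 1) * (e / (Rabs K + 1)) * Cmod (w - z0)).
  - replace (K * Cmod (w - z0) ^ 2) with (K * Cmod (w - z0) * Cmod (w - z0)) by ring.
    apply Rmult_le_compat_r; [exact P|].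
    apply Rle_trans with ((Rabs K + 1) * Cmod (w - z0)). apply Rmult_le_compat_r; lra.
    apply Rmult_le_compat_l; lra.
  - right. field. lra.
Qed.

Lemma cder_unique f z l l' : cder f z l -> cder f z l' -> l = l'.
Proof. intros H H'. apply cder_C_derive in H. apply cder_C_derive in H'. congruence. Qed.

(** For |w - z0| <= rho / 8 the Taylor series is dominated by a geometric one of ratio at most 1/2,
    from its quadratic term on. The constants depend on rho and M alone, which gives uniformity over
    sequences of functions and over parameters under an integral. *)
Lemma second_order f z0 rho M : 0 < rho -> (forall z, Cmod (z - z0) < rho -> exists l, cder f z l) ->
  (forall z, Cmod (z - z0) < rho -> Cmod (f z) <= M) ->
  exists l, cder f z0 l /\ Cmod l <= 8 * M / rho /\
  forall w, Cmod (w - z0) <= rho / 8 ->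
    Cmod (f w - f z0 - l * (w - z0)) <= 64 * M / rho ^ 2 * Cmod (w - z0) ^ 2.
Proof.
  intros Hr Hf HM. destruct (cauchy_ball f z0 rho M Hr Hf HM) as (c & C1 & C2).
  assert (M0 : 0 <= M).
  { apply Rle_trans with (1 := Cmod_ge_0 (f z0)), HM. rewrite Cmod_zero_sub; lra. }
  assert (E0 : f z0 = c 0%nat).
  { apply is_psum_at_0. replace (RtoC 0) with (z0 - z0)%C by ring. apply C2. rewrite Cmod_zero_sub; lra. }
  assert (Q : forall w, Cmod (w - z0) <= rho / 8 ->
    Cmod (f w - f z0 - c 1%nat * (w - z0)) <= 64 * M / rho ^ 2 * Cmod (w - z0) ^ 2).
  { intros w Hw. specialize (C2 w ltac:(lra)). set (h := (w - z0)%C) in *.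
    assert (Hh := Cmod_ge_0 h).
    set (q := Cmod h * (4 / rho)).
    assert (Hq : 0 <= q <= / 2).
    { unfold q. split. apply Rmult_le_pos; [exact Hh|left; apply Rdiv_lt_0_compat; lra].
      apply Rle_trans with (rho / 8 * (4 / rho)). apply Rmult_le_compat_r; [left; apply Rdiv_lt_0_compat; lra|lra].
      right; field; lra. }
    assert (B : forall n, Cmod (psum c (2 + n) h - c 0%nat - c 1%nat * h) <= 4 * M * q ^ 2 * (1 - (/ 2) ^ n)).
    { induction n as [|n IH].
      - change (2 + 0)%nat with 2%nat. rewrite !psum_S, psum_0.
        replace (0 + c 0%nat * h ^ 0 + c 1%nat * h ^ 1 - c 0%nat - c 1%nat * h)%C with (RtoC 0) by (simpl; ring).
        rewrite Cmod_0. simpl. lra.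
      - replace (2 + S n)%nat with (S (2 + n)) by lia. rewrite psum_S.
        replace (psum c (2 + n) h + c (2 + n)%nat * h ^ (2 + n) - c 0%nat - c 1%nat * h)%C with
          ((psum c (2 + n) h - c 0%nat - c 1%nat * h) + c (2 + n)%nat * h ^ (2 + n))%C by ring.
        apply Rle_trans with (1 := Cmod_triangle _ _).
        assert (T : Cmod (c (2 + n)%nat * h ^ (2 + n)) <= 2 * M * q ^ 2 * (/ 2) ^ n).
        { rewrite Cmod_mult, Cmod_pow.
          apply Rle_trans with (2 * M * (4 / rho) ^ (2 + n) * Cmod h ^ (2 + n)).
          apply Rmult_le_compat_r; [apply pow_le, Hh|apply C1].
          replace (2 * M * (4 / rho) ^ (2 + n) * Cmod h ^ (2 + n)) with (2 * M * q ^ (2 + n)) by (unfold q; rewrite Rpow_mult_distr; ring).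
          rewrite pow_add, <- Rmult_assoc. apply Rmult_le_compat_l. apply Rmult_le_pos; [lra|apply pow_le; lra].
          apply pow_incr; lra. }
        simpl (_ ^ S n). lra. }
    assert (L : clim (fun n => psum c (2 + n) h - c 0%nat - c 1%nat * h)%C (f w - c 0%nat - c 1%nat * h)).
    { apply clim_minus; [apply clim_minus|]; try apply clim_const.
      intros e He. destruct (C2 e He) as [N HN]. exists N. intros n Hn. apply HN. lia. }
    rewrite E0.
    replace (f w - c 0%nat - c 1%nat * h)%C with (f w - c 0%nat - c 1%nat * h - 0)%C by ring.
    eapply clim_bound; [exact L|]. intros n.
    cbv beta. replace (psum c (2 + n) h - c 0%nat - c 1%nat * h - 0)%C with (psum c (2 + n) h - c 0%nat - c 1%nat * h)%C by ring.
    apply Rle_trans with (1 := B n).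
    apply Rle_trans with (4 * M * q ^ 2 * 1).
    apply Rmult_le_compat_l. apply Rmult_le_pos; [lra|apply pow_le; lra].
    assert (0 <= (/ 2) ^ n) by (apply pow_le; lra). lra.
    right. unfold q. field. lra. }
  exists (c 1%nat). split; [|split].
  - apply cder_quadratic with (rho / 8) (64 * M / rho ^ 2); [lra|exact Q].
  - apply Rle_trans with (1 := C1 1%nat). right. field. lra.
  - exact Q.
Qed.

(* Locally bounded pointwise limits: the quadratic Taylor bound is uniform in the sequence. *)
Lemma cder_bounded_limit (fn : nat -> C -> C) f z0 rho M : 0 < rho ->
  (forall n z, Cmod (z - z0) < rho -> exists l, cder (fn n) z l) ->
  (forall n z, Cmod (z - z0) < rho -> Cmod (fn n z) <= M) ->
  (forall z, Cmod (z - z0) < rho -> clim (fun n => fn n z) (f z)) ->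
  exists l, cder f z0 l /\ clim (fun n => C_derive (fn n) z0) l.
Proof.
  intros Hr Hf HM Hlim.
  set (K := 64 * M / rho ^ 2).
  assert (S2 : forall n w, Cmod (w - z0) <= rho / 8 ->
    Cmod (fn n w - fn n z0 - C_derive (fn n) z0 * (w - z0)) <= K * Cmod (w - z0) ^ 2).
  { intros n w Hw. destruct (second_order (fn n) z0 rho M Hr (Hf n) (HM n)) as (l & L1 & _ & L2).
    rewrite (cder_C_derive _ _ _ L1). apply L2, Hw. }
  assert (K0 : 0 <= K).
  { unfold K. apply Rmult_le_pos; [|left; apply Rinv_0_lt_compat, pow_lt, Hr].
    apply Rmult_le_pos; [lra|]. apply Rle_trans with (1 := Cmod_ge_0 (fn O z0)), HM. rewrite Cmod_zero_sub; lra. }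
  destruct (clim_complete (fun n => C_derive (fn n) z0)) as [l Hl].
  - intros e He.
    (* The derivatives are compared through difference quotients of step h: the two Taylor errors
       cost K h each, at most e / 2 together, and convergence at z0 and z0 + h costs 4 e / 10. *)
    set (h := Rmin (rho / 8) (e / (4 * (K + 1)))).
    assert (H1 : 0 < e / (4 * (K + 1))) by (apply Rdiv_lt_0_compat; lra).
    assert (Hh : 0 < h) by (apply Rmin_pos; lra).
    assert (Hh1 : h <= rho / 8) by apply Rmin_l. assert (Hh2 : h <= e / (4 * (K + 1))) by apply Rmin_r.
    set (w := (z0 + RtoC h)%C).
    assert (Ew : (w - z0)%C = RtoC h) by (unfold w; ring).
    assert (Mw : Cmod (w - z0) = h) by (rewrite Ew, Cmod_R, Rabs_right; lra).
    destruct (Hlim w ltac:(lra) (e * h / 10)) as [N1 HN1]; [nra|].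
    destruct (Hlim z0 ltac:(rewrite Cmod_zero_sub; lra) (e * h / 10)) as [N2 HN2]; [nra|].
    exists (Nat.max N1 N2). intros n m Hn Hm.
    assert (A1 := HN1 n ltac:(lia)). assert (A2 := HN2 n ltac:(lia)).
    assert (A3 := HN1 m ltac:(lia)). assert (A4 := HN2 m ltac:(lia)).
    assert (B1 := S2 n w ltac:(lra)). assert (B2 := S2 m w ltac:(lra)).
    rewrite Mw in B1, B2. rewrite Ew in B1, B2.
    set (dn := C_derive (fn n) z0) in *. set (dm := C_derive (fn m) z0) in *.
    assert (Z : Cmod ((dn - dm) * RtoC h) <= 2 * (K * h ^ 2) + 4 * (e * h / 10)).
    { replace ((dn - dm) * RtoC h)%C with
        ((fn m w - fn m z0 - dm * h) - (fn n w - fn n z0 - dn * h)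
          + ((fn n w - f w) - (fn m w - f w) - ((fn n z0 - f z0) - (fn m z0 - f z0))))%C by ring.
      eapply Rle_trans; [apply Cmod_triangle|].
      assert (P1 := Cmod_triangle_minus (fn m w - fn m z0 - dm * h) (fn n w - fn n z0 - dn * h)).
      assert (P2 := Cmod_triangle_minus ((fn n w - f w) - (fn m w - f w)) ((fn n z0 - f z0) - (fn m z0 - f z0))).
      assert (P3 := Cmod_triangle_minus (fn n w - f w) (fn m w - f w)).
      assert (P4 := Cmod_triangle_minus (fn n z0 - f z0) (fn m z0 - f z0)). lra. }
    rewrite Cmod_mult, Cmod_R, Rabs_right in Z by lra.
    apply Rmult_lt_reg_r with h; [exact Hh|].
    apply Rle_lt_trans with (1 := Z).
    assert (K * h <= e / 4).
    { apply Rle_trans with ((K + 1) * (e / (4 * (K + 1)))). apply Rmult_le_compat; lra. right; field; lra. }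
    nra.
  - exists l. split; [|exact Hl].
    apply cder_quadratic with (rho / 8) K; [lra|]. intros w Hw.
    replace (f w - f z0 - l * (w - z0))%C with (f w - f z0 - (w - z0) * l - 0)%C by ring.
    apply clim_bound with (fun n => fn n w - fn n z0 - (w - z0) * C_derive (fn n) z0)%C.
    + apply clim_minus; [apply clim_minus|apply clim_scal, Hl]; apply Hlim; [lra|rewrite Cmod_zero_sub; lra].
    + intros n. cbv beta. replace (fn n w - fn n z0 - (w - z0) * C_derive (fn n) z0 - 0)%C with (fn n w - fn n z0 - C_derive (fn n) z0 * (w - z0))%C by ring.
      apply S2, Hw.
Qed.

Lemma cder_psum c n z : cder (psum c n) z (psum (fps_deriv c) (n - 1) z).
Proof.
  induction n as [|n IH].
  - apply cder_const.
  - apply cder_ext with (fun w => psum c n w + c n * w ^ n)%C. { intros w. symmetry. apply psum_S. }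
    eapply cder_eq. apply cder_plus. exact IH. apply cder_scal, cder_pow, cder_id.
    destruct n as [|n].
    + change (psum (fps_deriv c) (0 - 1) z) with (RtoC 0). change (psum (fps_deriv c) (1 - 1) z) with (RtoC 0).
      simpl (INR 0). ring.
    + replace (S (S n) - 1)%nat with (S n) by lia. replace (S n - 1)%nat with n by lia.
      rewrite psum_S. unfold fps_deriv. replace (n + 1)%nat with (S n) by lia. ring.
Qed.

Lemma clim_bounded u l : clim u l -> exists B, forall n, Cmod (u n) <= B.
Proof.
  intros H. destruct (H 1 Rlt_0_1) as [N HN].
  assert (F : forall n, exists B, forall k, (k <= n)%nat -> Cmod (u k) <= B).
  { induction n as [|n [B HB]]. exists (Cmod (u O)). intros k Hk. replace k with O by lia. lra.
    exists (Rmax B (Cmod (u (S n)))). intros k Hk. destruct (Nat.eq_dec k (S n)) as [->|]. apply Rmax_r.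
    apply Rle_trans with (2 := Rmax_l _ _), HB. lia. }
  destruct (F N) as [B HB]. exists (Rmax B (Cmod l + 1)). intros n.
  destruct (le_lt_dec n N). apply Rle_trans with (2 := Rmax_l _ _), HB; lia.
  apply Rle_trans with (2 := Rmax_r _ _). specialize (HN n ltac:(lia)).
  generalize (Cmod_rtriangle (u n) l). lra.
Qed.

Lemma is_psum_coef_bound c z l : is_psum c z l -> exists B, 0 < B /\ forall n, Cmod (c n) * Cmod z ^ n <= B.
Proof.
  intros H. destruct (clim_bounded _ _ H) as [B HB]. exists (2 * B + 1).
  assert (B0 : 0 <= B) by (apply Rle_trans with (1 := Cmod_ge_0 _) (2 := HB O)).
  split; [lra|].
  intros n. replace (Cmod (c n) * Cmod z ^ n) with (Cmod (psum c (S n) z - psum c n z)).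
  - generalize (Cmod_triangle_minus (psum c (S n) z) (psum c n z)) (HB (S n)) (HB n). lra.
  - rewrite psum_S. replace (psum c n z + c n * z ^ n - psum c n z)%C with (c n * z ^ n)%C by ring.
    rewrite Cmod_mult, Cmod_pow. reflexivity.
Qed.

Lemma is_psum_geometric_coef c z l : 0 < Cmod z -> is_psum c z l ->
  exists B, 0 < B /\ forall n, Cmod (c n) <= B * (/ Cmod z) ^ n.
Proof.
  intros Hz H. destruct (is_psum_coef_bound c z l H) as (B & HB & H').
  exists B. split; [exact HB|]. intros n.
  apply Rmult_le_reg_r with (Cmod z ^ n); [apply pow_lt, Hz|].
  rewrite Rmult_assoc, <- Rpow_mult_distr, Rinv_l, pow1 by lra. rewrite Rmult_1_r. apply H'.
Qed.

Lemma psum_bound c z B q : 0 <= q < 1 -> (forall n, Cmod (c n * z ^ n) <= B * q ^ n) ->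
  forall n, Cmod (psum c n z) <= B * / (1 - q).
Proof.
  intros Hq H n.
  assert (B0 : 0 <= B) by (generalize (Rle_trans _ _ _ (Cmod_ge_0 _) (H O)); simpl; lra).
  apply Rle_trans with (B * / (1 - q) * (1 - q ^ n)).
  - induction n as [|n IH]. rewrite psum_0, Cmod_0. simpl. right; ring.
    rewrite psum_S. apply Rle_trans with (1 := Cmod_triangle _ _). specialize (H n).
    apply Rle_trans with (B * / (1 - q) * (1 - q ^ n) + B * q ^ n). lra.
    right. simpl. field. lra.
  - rewrite <- (Rmult_1_r (B * / (1 - q))) at 2. apply Rmult_le_compat_l.
    apply Rmult_le_pos; [exact B0|left; apply Rinv_0_lt_compat; lra].
    assert (0 <= q ^ n) by (apply pow_le; lra). lra.
Qed.

(** The partial sums are bounded uniformly near z, so [cder_bounded_limit] yields both the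
    differentiability of the sum and the convergence of the derived series to the derivative. *)
Lemma power_series_cder c r f : (forall z, Cmod z < r -> is_psum c z (f z)) ->
  forall z, Cmod z < r -> exists l, cder f z l /\ is_psum (fps_deriv c) z l.
Proof.
  intros H z Hz. assert (Hz0 := Cmod_ge_0 z).
  set (d := (r - Cmod z) / 4). assert (Hd : 0 < d) by (unfold d; lra).
  set (x := Cmod z + 2 * d).
  assert (Hx : 0 < x) by (unfold x; lra).
  assert (Mx : Cmod (RtoC x) = x) by (rewrite Cmod_R, Rabs_right; lra).
  destruct (is_psum_geometric_coef c x (f x)) as (B & HB0 & HB).
  { rewrite Mx. exact Hx. }
  { apply H. rewrite Mx. unfold x, d. lra. }
  rewrite Mx in HB.
  set (q := (Cmod z + d) / x).
  assert (Hq : 0 <= q < 1).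
  { unfold q. split. apply Rmult_le_pos; [lra|left; apply Rinv_0_lt_compat, Hx].
    apply Rmult_lt_reg_r with x; [exact Hx|]. unfold Rdiv. rewrite Rmult_assoc, Rinv_l by lra. unfold x; lra. }
  destruct (cder_bounded_limit (fun n => psum c n) f z d (B * / (1 - q)) Hd) as (l & L1 & L2).
  - intros n w _. eexists. apply cder_psum.
  - intros n w Hw. apply psum_bound; [exact Hq|]. intros k.
    rewrite Cmod_mult, Cmod_pow.
    assert (Hw' : Cmod w <= Cmod z + d).
    { replace w with ((w - z) + z)%C by ring. apply Rle_trans with (1 := Cmod_triangle _ _). lra. }
    apply Rle_trans with (Cmod (c k) * (Cmod z + d) ^ k).
    apply Rmult_le_compat_l; [apply Cmod_ge_0|]. apply pow_incr; split; [apply Cmod_ge_0|exact Hw'].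
    replace (B * q ^ k) with (B * (/ x) ^ k * (Cmod z + d) ^ k).
    apply Rmult_le_compat_r; [apply pow_le; lra|apply HB].
    rewrite Rmult_assoc, <- Rpow_mult_distr. f_equal. f_equal. unfold q. field. lra.
  - intros w Hw. apply H. replace w with ((w - z) + z)%C by ring. apply Rle_lt_trans with (1 := Cmod_triangle _ _). unfold d in Hw; lra.
  - exists l. split; [exact L1|]. intros e He. destruct (L2 e He) as [N HN]. exists N. intros n Hn.
    specialize (HN (S n) ltac:(lia)). rewrite (cder_C_derive _ _ _ (cder_psum c (S n) z)) in HN.
    replace (S n - 1)%nat with n in HN by lia. exact HN.
Qed.

(** * Iterated derivatives, Taylor series and Cauchy's estimates *)

Definition hol (D : C -> Prop) (f : C -> C) : Prop := forall z, D z -> exists l, cder f z l.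

Lemma cder_shift f z0 z l : cder (fun h => f (z0 + h)%C) (z - z0)%C l -> cder f z l.
Proof.
  intros H. apply cder_ext with (fun w => (fun h => f (z0 + h)%C) (w - z0)%C). { intros w. f_equal; ring. }
  rewrite <- (Cmult_1_r l). apply (cder_comp (fun h => f (z0 + h)%C) (fun w => (w - z0)%C)); [exact H|].
  eapply cder_eq. apply cder_minus. apply cder_id. apply cder_const. ring.
Qed.

Lemma C_derive_series f c z0 r : (forall w, Cmod (w - z0) < r -> is_psum c (w - z0) (f w)) ->
  forall w, Cmod (w - z0) < r -> cder f w (C_derive f w) /\ is_psum (fps_deriv c) (w - z0) (C_derive f w).
Proof.
  intros H w Hw.
  destruct (power_series_cder c r (fun h => f (z0 + h)%C)) with (z := (w - z0)%C) as (l & L1 & L2); [|exact Hw|].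
  - intros h Hh. specialize (H (z0 + h)%C). replace (z0 + h - z0)%C with h in H by ring. auto.
  - apply cder_shift in L1. rewrite (cder_C_derive _ _ _ L1). auto.
Qed.

Lemma C_derive_n_series f c z0 r k : (forall w, Cmod (w - z0) < r -> is_psum c (w - z0) (f w)) ->
  forall w, Cmod (w - z0) < r -> is_psum (Nat.iter k fps_deriv c) (w - z0) (C_derive_n f k w).
Proof.
  intros H. induction k as [|k IH]; [exact H|].
  intros w Hw. simpl. apply (C_derive_series _ _ _ _ IH w Hw).
Qed.

Lemma iter_fps_deriv_0 k c : Nat.iter k fps_deriv c 0%nat = (RtoC (INR (fact k)) * c k)%C.
Proof.
  assert (H : forall j, (RtoC (INR (fact j)) * Nat.iter k fps_deriv c j = RtoC (INR (fact (k + j))) * c (k + j)%nat)%C).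
  { induction k as [|k IH]; intros j; [reflexivity|].
    simpl Nat.iter. unfold fps_deriv at 1.
    replace (RtoC (INR (fact j)) * (RtoC (INR (j + 1)) * Nat.iter k fps_deriv c (j + 1)%nat))%C with
      (RtoC (INR (fact (j + 1))) * Nat.iter k fps_deriv c (j + 1)%nat)%C.
    - rewrite IH. replace (k + (j + 1))%nat with (S k + j)%nat by lia. reflexivity.
    - replace (j + 1)%nat with (S j) by lia. rewrite fact_simpl, mult_INR, RtoC_mult. ring. }
  specialize (H O). simpl fact in H. simpl INR in H. rewrite Cmult_1_l, Nat.add_0_r in H. exact H.
Qed.

Lemma C_derive_n_coef f c z0 r k : 0 < r -> (forall w, Cmod (w - z0) < r -> is_psum c (w - z0) (f w)) ->
  C_derive_n f k z0 = (RtoC (INR (fact k)) * c k)%C.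
Proof.
  intros Hr H. rewrite <- iter_fps_deriv_0. apply is_psum_at_0.
  replace (RtoC 0) with (z0 - z0)%C by ring. apply C_derive_n_series with r; [exact H|]. rewrite Cmod_zero_sub; lra.
Qed.

Lemma cauchy_estimate f z0 rho M k : 0 < rho -> (forall z, Cmod (z - z0) < rho -> exists l, cder f z l) ->
  (forall z, Cmod (z - z0) < rho -> Cmod (f z) <= M) ->
  Cmod (C_derive_n f k z0) <= INR (fact k) * (2 * M * (4 / rho) ^ k).
Proof.
  intros Hr Hf HM. destruct (cauchy_ball f z0 rho M Hr Hf HM) as (c & C1 & C2).
  rewrite (C_derive_n_coef f c z0 (rho / 4) k) by (lra || exact C2).
  rewrite Cmod_mult, Cmod_R, Rabs_right by (apply Rle_ge, pos_INR).
  apply Rmult_le_compat_l; [apply pos_INR|apply C1].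
Qed.

Lemma taylor_series f rho M : 0 < rho -> (forall z, Cmod z < rho -> exists l, cder f z l) ->
  (forall z, Cmod z < rho -> Cmod (f z) <= M) ->
  (forall n, Cmod (taylor f n) <= 2 * M * (4 / rho) ^ n) /\
  forall w, Cmod w < rho / 4 -> is_psum (taylor f) w (f w).
Proof.
  intros Hr Hf HM.
  assert (E : forall z, (z - 0)%C = z) by (intros; ring).
  destruct (cauchy_ball f 0 rho M Hr) as (c & C1 & C2).
  { intros z. rewrite E. apply Hf. } { intros z. rewrite E. apply HM. }
  assert (T : forall n, taylor f n = c n).
  { intros n. unfold taylor. rewrite (C_derive_n_coef f c 0 (rho / 4) n) by (lra || exact C2).
    field. intros E'. injection E'. intros E''. apply (INR_fact_neq_0 n E''). }
  split. intros n. rewrite T; apply C1.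
  intros w Hw. specialize (C2 w). rewrite E in C2. specialize (C2 Hw).
  apply clim_ext with (2 := C2). intros n. induction n as [|n IH]; [reflexivity|]. rewrite !psum_S, IH, T. reflexivity.
Qed.

Lemma hol_local_series f D z0 : copen D -> hol D f -> D z0 ->
  exists c r, 0 < r /\ (forall w, Cmod (w - z0) < r -> D w) /\
   forall w, Cmod (w - z0) < r -> is_psum c (w - z0) (f w).
Proof.
  intros HD Hf Hz.
  destruct (HD z0 Hz) as (d & Hd & H1).
  destruct (Hf z0 Hz) as [l Hl].
  destruct (ccont_cder _ _ _ Hl 1 Rlt_0_1) as (d' & Hd' & H2).
  assert (Hm : 0 < Rmin d d') by (apply Rmin_pos; auto).
  destruct (cauchy_ball f z0 (Rmin d d') (Cmod (f z0) + 1) Hm) as (c & _ & C2).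
  - intros z Hz'. apply Rmin_Rgt in Hz'. apply Hf, H1, Hz'.
  - intros z Hz'. apply Rmin_Rgt in Hz'. specialize (H2 z (proj2 Hz')). generalize (Cmod_rtriangle (f z) (f z0)). lra.
  - exists c, (Rmin d d' / 4). split; [lra|]. split; [|exact C2].
    intros w Hw. apply H1. generalize (Rmin_l d d'). lra.
Qed.

Lemma hol_C_derive f D : copen D -> hol D f -> hol D (C_derive f).
Proof.
  intros HD Hf z Hz. destruct (hol_local_series f D z HD Hf Hz) as (c & r & Hr & _ & H).
  eexists. apply (C_derive_series (C_derive f) (fps_deriv c) z r).
  intros w Hw. apply (C_derive_series f c z r H w Hw). rewrite Cmod_zero_sub; lra.
Qed.

Lemma hol_C_derive_n f D k : copen D -> hol D f -> hol D (C_derive_n f k).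
Proof. intros HD Hf. induction k as [|k IH]; [exact Hf|]. apply hol_C_derive; auto. Qed.

Lemma hol_cder f D z : hol D f -> D z -> cder f z (C_derive f z).
Proof. intros H Hz. destruct (H z Hz) as [l Hl]. rewrite (cder_C_derive _ _ _ Hl). exact Hl. Qed.

Lemma C_derive_n_minus f g D k : copen D -> hol D f -> hol D g ->
  forall z, D z -> C_derive_n (fun w => f w - g w)%C k z = (C_derive_n f k z - C_derive_n g k z)%C.
Proof.
  intros HD Hf Hg. induction k as [|k IH]; [reflexivity|].
  intros z Hz. simpl. apply cder_C_derive.
  apply cder_ext_loc with (fun w => C_derive_n f k w - C_derive_n g k w)%C.
  - destruct (HD z Hz) as (d & Hd & H). exists d; split; [exact Hd|]. intros w Hw. symmetry. apply IH, H, Hw.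
  - apply cder_minus; apply (hol_cder _ D); auto; apply hol_C_derive_n; auto.
Qed.

(** * Gevrey asymptotics *)

Lemma exp_mono x y : x <= y -> exp x <= exp y.
Proof. intros [H|H]; [left; apply exp_increasing, H|rewrite H; lra]. Qed.

Lemma fact_pow_pos n p : 0 < fact_pow n p.
Proof. apply exp_pos. Qed.

Lemma fact_pow_0 p : fact_pow 0 p = 1.
Proof. unfold fact_pow. simpl. unfold Rpower. rewrite ln_1, Rmult_0_r. apply exp_0. Qed.

Lemma INR_fact_pos n : 0 < INR (fact n).
Proof. apply INR_fact_lt_0. Qed.

Lemma INR_fact_S n : INR (fact (S n)) = (INR n + 1) * INR (fact n).
Proof. rewrite fact_simpl, mult_INR, S_INR. reflexivity. Qed.

Lemma fact_mult_le i j : INR (fact i) * INR (fact j) <= INR (fact (i + j)).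
Proof.
  induction j as [|j IH].
  - rewrite Nat.add_0_r. simpl. lra.
  - rewrite Nat.add_succ_r, !INR_fact_S, plus_INR.
    assert (Hi := pos_INR i). assert (Hj := pos_INR j).
    apply Rle_trans with ((INR j + 1) * INR (fact (i + j))); [nra|].
    apply Rmult_le_compat_r; [apply Rlt_le, INR_fact_pos|lra].
Qed.

(** The bound 2^n for binomial coefficients, with Pascal's rule as induction step on n = i + j. *)
Lemma fact_plus_le i j : INR (fact (i + j)) <= 2 ^ (i + j) * (INR (fact i) * INR (fact j)).
Proof.
  assert (H : forall n i j, (i + j = n)%nat -> INR (fact (i + j)) <= 2 ^ (i + j) * (INR (fact i) * INR (fact j))).
  { clear. induction n as [|n IH]; intros i j Hn.
    - replace i with O by lia. replace j with O by lia. simpl. lra.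
    - destruct i as [|i]. { simpl Nat.add. simpl (fact 0). simpl (INR 1).
        rewrite Rmult_1_l. assert (H := pow_R1_Rle 2 j ltac:(lra)). generalize (INR_fact_pos j). nra. }
      destruct j as [|j]. { rewrite Nat.add_0_r. simpl (fact 0). simpl (INR 1).
        rewrite Rmult_1_r. assert (H := pow_R1_Rle 2 (S i) ltac:(lra)). generalize (INR_fact_pos (S i)). nra. }
      replace (S i + S j)%nat with (S (i + S j)) by lia. rewrite INR_fact_S.
      assert (A := IH i (S j) ltac:(lia)). assert (B := IH (S i) j ltac:(lia)).
      replace (S i + j)%nat with (i + S j)%nat in B by lia.
      rewrite plus_INR, S_INR. rewrite INR_fact_S in A. rewrite INR_fact_S in B. rewrite !INR_fact_S.
      assert (Hi := pos_INR i). assert (Hj := pos_INR j).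
      apply (Rmult_le_compat_l (INR i + 1)) in A; [|lra].
      apply (Rmult_le_compat_l (INR j + 1)) in B; [|lra].
      simpl (2 ^ S _). lra. }
  exact (H _ i j eq_refl).
Qed.

Lemma Rpower_mono x y p : 0 <= p -> 0 < x -> x <= y -> Rpower x p <= Rpower y p.
Proof. intros. apply Rle_Rpower_l; [assumption|split; assumption]. Qed.

Lemma fact_pow_mult_le p i j : 0 <= p -> fact_pow i p * fact_pow j p <= fact_pow (i + j) p.
Proof.
  intros Hp. unfold fact_pow. rewrite Rpower_mult_distr by apply INR_fact_pos.
  apply Rpower_mono; [exact Hp| |apply fact_mult_le]. apply Rmult_lt_0_compat; apply INR_fact_pos.
Qed.

Lemma fact_pow_ge_1 p n : 0 <= p -> 1 <= fact_pow n p.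
Proof.
  intros Hp. rewrite <- (fact_pow_0 p) at 1. unfold fact_pow. apply Rpower_mono; [exact Hp|apply INR_fact_pos|].
  apply le_INR. simpl. generalize (lt_O_fact n). lia.
Qed.

Lemma Rpower_pow_le x n p : 0 < x -> Rpower (x ^ n) p = Rpower x p ^ n.
Proof.
  intros Hx. rewrite <- (Rpower_pow n x Hx), <- (Rpower_pow n (Rpower x p)) by apply exp_pos.
  rewrite !Rpower_mult. f_equal. ring.
Qed.

Lemma fact_pow_plus_le p i j : 0 <= p ->
  fact_pow (i + j) p <= Rpower 2 p ^ (i + j) * (fact_pow i p * fact_pow j p).
Proof.
  intros Hp. unfold fact_pow.
  assert (Hi := INR_fact_pos i). assert (Hj := INR_fact_pos j).
  rewrite (Rpower_mult_distr _ _ _ Hi Hj), <- Rpower_pow_le by lra.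
  rewrite Rpower_mult_distr; [|apply pow_lt; lra|apply Rmult_lt_0_compat; assumption].
  apply Rpower_mono; [exact Hp|apply INR_fact_pos|apply fact_plus_le].
Qed.

(** Sums over i < n, possibly empty, to match [psum]; [sum_n] always has at least one term. *)
Fixpoint csum (f : nat -> C) (n : nat) : C :=
  match n with O => 0 | S k => (csum f k + f k)%C end.

Lemma sum_n_csum f n : sum_n (G := C_AbelianMonoid) f n = csum f (S n).
Proof.
  induction n as [|n IH]. rewrite sum_O. symmetry. exact (Cplus_0_l (f O)).
  rewrite sum_Sn, IH. reflexivity.
Qed.

Lemma csum_ext f g n : (forall i, (i < n)%nat -> f i = g i) -> csum f n = csum g n.
Proof. intros H. induction n as [|n IH]; [reflexivity|]. simpl. rewrite IH, H by auto with arith. reflexivity. Qed.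

Lemma csum_plus f g n : csum (fun i => f i + g i)%C n = (csum f n + csum g n)%C.
Proof. induction n as [|n IH]; simpl; [ring|]. rewrite IH. ring. Qed.

Lemma csum_scal c f n : csum (fun i => c * f i)%C n = (c * csum f n)%C.
Proof. induction n as [|n IH]; simpl; [ring|]. rewrite IH. ring. Qed.

Lemma csum_bound f n B : (forall i, (i < n)%nat -> Cmod (f i) <= B) -> Cmod (csum f n) <= INR n * B.
Proof.
  intros H. induction n as [|n IH]. simpl. rewrite Cmod_0. lra.
  rewrite S_INR. simpl csum. apply Rle_trans with (1 := Cmod_triangle _ _).
  generalize (H n ltac:(lia)) (IH ltac:(intros; apply H; lia)). lra.
Qed.

Lemma psum_csum c n z : psum c n z = csum (fun k => c k * z ^ k)%C n.
Proof. induction n as [|n IH]; [reflexivity|]. rewrite psum_S, IH. reflexivity. Qed.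

Lemma csum_S f n : csum f (S n) = (csum f n + f n)%C.
Proof. reflexivity. Qed.

Lemma psum_fps_mul c d n z :
  psum (fps_mul c d) n z = csum (fun i => c i * z ^ i * psum d (n - i) z)%C n.
Proof.
  induction n as [|n IH]; [reflexivity|].
  rewrite psum_S, IH.
  transitivity (csum (fun i => c i * z ^ i * psum d (n - i) z + z ^ n * (c i * d (n - i)%nat))%C (S n)).
  - rewrite csum_plus, csum_scal. unfold fps_mul. rewrite sum_n_csum, (csum_S (fun i => c i * z ^ i * psum d (n - i) z)%C).
    rewrite Nat.sub_diag, psum_0. ring.
  - rewrite !csum_S. f_equal.
    + apply csum_ext. intros i Hi. replace (S n - i)%nat with (S (n - i)) by lia. rewrite psum_S.
      replace (z ^ n)%C with (z ^ i * z ^ (n - i))%C by (rewrite <- Cpow_add_r; f_equal; lia). ring.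
    + replace (S n - n)%nat with 1%nat by lia. rewrite Nat.sub_diag, (psum_S d 0), psum_0. simpl (z ^ 0)%C. ring.
Qed.

(** Stronger than [gevrey_asymp] with p = s - 1: one pair of constants for the whole set. The
    function constructed below satisfies this form, so subsectors appear only at the very end. *)
Definition asy (p : R) (S : C -> Prop) (u : C -> C) (c : fps) : Prop :=
  exists M K : R, 0 < M /\ 0 < K /\ forall (n : nat) (z : C), S z ->
    Cmod (u z - psum c n z) <= M * K ^ n * fact_pow n p * Cmod z ^ n.

Lemma asy_plus p S u v c d : asy p S u c -> asy p S v d ->
  asy p S (fun z => u z + v z)%C (fun k => c k + d k)%C.
Proof.
  intros (M & K & HM & HK & H) (M' & K' & HM' & HK' & H').
  exists (M + M'), (K + K'). split; [lra|]. split; [lra|]. intros n z Hz.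
  replace (u z + v z - psum (fun k => c k + d k)%C n z)%C with ((u z - psum c n z) + (v z - psum d n z))%C.
  2:{ rewrite !psum_csum. rewrite (csum_ext (fun k => (c k + d k) * z ^ k)%C (fun k => c k * z ^ k + d k * z ^ k)%C) by (intros; ring). rewrite csum_plus. ring. }
  apply Rle_trans with (1 := Cmod_triangle _ _).
  specialize (H n z Hz). specialize (H' n z Hz).
  assert (P := Rmult_le_pos _ _ (Rlt_le _ _ (fact_pow_pos n p)) (pow_le _ n (Cmod_ge_0 z))).
  assert (Q : K ^ n <= (K + K') ^ n) by (apply pow_incr; lra).
  assert (Q' : K' ^ n <= (K + K') ^ n) by (apply pow_incr; lra).
  apply Rle_trans with (M * (K + K') ^ n * (fact_pow n p * Cmod z ^ n) + M' * (K + K') ^ n * (fact_pow n p * Cmod z ^ n)); [|right; ring].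
  apply Rplus_le_compat.
  - apply Rle_trans with (1 := H). rewrite Rmult_assoc. apply Rmult_le_compat_r; [exact P|]. apply Rmult_le_compat_l; lra.
  - apply Rle_trans with (1 := H'). rewrite Rmult_assoc. apply Rmult_le_compat_r; [exact P|]. apply Rmult_le_compat_l; lra.
Qed.

Lemma asy_ext p S u v c d : (forall z, S z -> u z = v z) -> (forall k, c k = d k) -> asy p S u c -> asy p S v d.
Proof.
  intros Hu Hc (M & K & HM & HK & H). exists M, K. split; [exact HM|]. split; [exact HK|].
  intros n z Hz. rewrite <- Hu by exact Hz. replace (psum d n z) with (psum c n z); [auto|].
  rewrite !psum_csum. apply csum_ext. intros; rewrite Hc; reflexivity.
Qed.

Lemma asy_opp p S u c : asy p S u c -> asy p S (fun z => - u z)%C (fun k => - c k)%C.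
Proof.
  intros (M & K & HM & HK & H). exists M, K. split; [exact HM|]. split; [exact HK|]. intros n z Hz.
  replace (- u z - psum (fun k => - c k)%C n z)%C with (- (u z - psum c n z))%C. rewrite Cmod_opp. auto.
  rewrite !psum_csum. rewrite (csum_ext (fun k => (- c k) * z ^ k)%C (fun k => - (1) * (c k * z ^ k))%C) by (intros; ring).
  rewrite csum_scal. ring.
Qed.

(** What holomorphy at 0 gives in a small disc: the case p = 0 of [asy], together with the
    coefficient bound that products require. *)
Definition geometric_asy (S : C -> Prop) (a : C -> C) (c : fps) : Prop :=
  exists A L : R, 0 < A /\ 0 < L /\ (forall n, Cmod (c n) <= A * L ^ n) /\
    forall (n : nat) (z : C), S z -> Cmod (a z - psum c n z) <= A * L ^ n * Cmod z ^ n.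

Lemma geometric_asy_asy p S a c : 0 <= p -> geometric_asy S a c -> asy p S a c.
Proof.
  intros Hp (A & L & HA & HL & _ & H). exists A, L. split; [exact HA|]. split; [exact HL|].
  intros n z Hz. apply Rle_trans with (1 := H n z Hz).
  rewrite (Rmult_assoc (A * L ^ n)). apply Rmult_le_compat_l. apply Rmult_le_pos; [lra|apply pow_le; lra].
  rewrite <- (Rmult_1_l (Cmod z ^ n)) at 1. apply Rmult_le_compat_r; [apply pow_le, Cmod_ge_0|apply fact_pow_ge_1, Hp].
Qed.

(** With P_n for partial sums, the remainder of order n is (a - P_n c) v plus the sum over i < n of
    c_i z^i (v - P_(n-i) d). Each of these n + 1 terms is at most [Q], and 1 + n <= 2^n explains the
    factor 2 in the new constant. *)
Lemma asy_mult p S a v c d : 0 <= p -> geometric_asy S a c -> asy p S v d ->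
  asy p S (fun z => a z * v z)%C (fps_mul c d).
Proof.
  intros Hp (A & L & HA & HL & Hc & Ha) (M & K & HM & HK & Hv).
  exists (A * M), (2 * (L + K)). split; [nra|]. split; [lra|]. intros n z Hz.
  rewrite psum_fps_mul.
  replace (a z * v z - csum (fun i => c i * z ^ i * psum d (n - i) z) n)%C with
    ((a z - psum c n z) * v z + csum (fun i => c i * z ^ i * (v z - psum d (n - i) z)) n)%C.
  2:{ rewrite (csum_ext (fun i => c i * z ^ i * (v z - psum d (n - i) z))%C (fun i => v z * (c i * z ^ i) + - (1) * (c i * z ^ i * psum d (n - i) z))%C) by (intros; ring).
      rewrite csum_plus, !csum_scal, psum_csum. ring. }
  assert (Pz := Cmod_ge_0 z).
  set (Q := A * M * (L + K) ^ n * fact_pow n p * Cmod z ^ n).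
  assert (Q0 : 0 <= Q).
  { unfold Q. repeat apply Rmult_le_pos; try lra. apply pow_le; lra. apply Rlt_le, fact_pow_pos. apply pow_le; lra. }
  assert (B1 : Cmod ((a z - psum c n z) * v z) <= Q).
  { rewrite Cmod_mult. assert (V := Hv O z Hz). rewrite psum_0, fact_pow_0 in V.
    replace (v z - 0)%C with (v z) in V by ring. simpl in V. rewrite !Rmult_1_r in V.
    apply Rle_trans with (A * L ^ n * Cmod z ^ n * M). apply Rmult_le_compat; auto using Cmod_ge_0.
    unfold Q. replace (A * L ^ n * Cmod z ^ n * M) with (A * M * (L ^ n * 1) * Cmod z ^ n) by ring.
    apply Rmult_le_compat_r; [apply pow_le; lra|]. rewrite (Rmult_assoc (A * M)). apply Rmult_le_compat_l; [nra|].
    apply Rmult_le_compat; [apply pow_le; lra|lra|apply pow_incr; lra|apply fact_pow_ge_1, Hp]. }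
  assert (B2 : Cmod (csum (fun i => c i * z ^ i * (v z - psum d (n - i) z))%C n) <= INR n * Q).
  { apply csum_bound. intros i Hi. rewrite !Cmod_mult, Cmod_pow.
    apply Rle_trans with (A * L ^ i * Cmod z ^ i * (M * K ^ (n - i) * fact_pow (n - i) p * Cmod z ^ (n - i))).
    - apply Rmult_le_compat; [|apply Cmod_ge_0| |auto].
      apply Rmult_le_pos; [apply Cmod_ge_0|apply pow_le; lra].
      apply Rmult_le_compat_r; [apply pow_le; lra|apply Hc].
    - replace (A * L ^ i * Cmod z ^ i * (M * K ^ (n - i) * fact_pow (n - i) p * Cmod z ^ (n - i))) with
        (A * M * (L ^ i * K ^ (n - i) * fact_pow (n - i) p) * (Cmod z ^ i * Cmod z ^ (n - i))) by ring.
      rewrite <- pow_add. replace (i + (n - i))%nat with n by lia.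
      unfold Q. apply Rmult_le_compat_r; [apply pow_le; lra|]. rewrite (Rmult_assoc (A * M)). apply Rmult_le_compat_l; [nra|].
      replace ((L + K) ^ n) with ((L + K) ^ i * (L + K) ^ (n - i)) by (rewrite <- pow_add; f_equal; lia).
      apply Rmult_le_compat; [apply Rmult_le_pos; apply pow_le; lra|apply Rlt_le, fact_pow_pos| |].
      + apply Rmult_le_compat; try (apply pow_le; lra); apply pow_incr; lra.
      + apply Rle_trans with (fact_pow i p * fact_pow (n - i) p).
        rewrite <- (Rmult_1_l (fact_pow (n - i) p)) at 1. apply Rmult_le_compat_r; [apply Rlt_le, fact_pow_pos|apply fact_pow_ge_1, Hp].
        apply Rle_trans with (1 := fact_pow_mult_le p i (n - i) Hp). replace (i + (n - i))%nat with n by lia. lra. }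
  apply Rle_trans with (1 := Cmod_triangle _ _).
  apply Rle_trans with ((1 + INR n) * Q); [lra|].
  apply Rle_trans with (2 ^ n * Q).
  - apply Rmult_le_compat_r; [exact Q0|].
    generalize (poly n 1 Rlt_0_1). replace (1 + 1) with 2 by ring. rewrite Rmult_1_r. auto.
  - right. unfold Q. rewrite Rpow_mult_distr. ring.
Qed.

Lemma psum_tail_bound c z l B L : 0 < L -> L * Cmod z <= / 2 -> (forall n, Cmod (c n) <= B * L ^ n) ->
  is_psum c z l -> forall n, Cmod (l - psum c n z) <= 2 * B * L ^ n * Cmod z ^ n.
Proof.
  intros HL Hz Hc Hl n.
  assert (Pz := Cmod_ge_0 z).
  assert (B0 : 0 <= B) by (generalize (Rle_trans _ _ _ (Cmod_ge_0 _) (Hc O)); simpl; lra).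
  assert (q0 : 0 <= L * Cmod z) by (apply Rmult_le_pos; lra).
  assert (P : forall k, Cmod (psum c (n + k) z - psum c n z) <= 2 * B * (L * Cmod z) ^ n * (1 - (/ 2) ^ k)).
  { induction k as [|k IH].
    - rewrite Nat.add_0_r, Cmod_zero_sub. simpl. right; ring.
    - rewrite Nat.add_succ_r, psum_S.
      replace (psum c (n + k) z + c (n + k)%nat * z ^ (n + k) - psum c n z)%C with ((psum c (n + k) z - psum c n z) + c (n + k)%nat * z ^ (n + k))%C by ring.
      apply Rle_trans with (1 := Cmod_triangle _ _).
      assert (T : Cmod (c (n + k)%nat * z ^ (n + k)) <= B * (L * Cmod z) ^ n * (/ 2) ^ k).
      { rewrite Cmod_mult, Cmod_pow. apply Rle_trans with (B * L ^ (n + k) * Cmod z ^ (n + k)).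
        apply Rmult_le_compat_r; [apply pow_le; lra|apply Hc].
        replace (B * L ^ (n + k) * Cmod z ^ (n + k)) with (B * (L * Cmod z) ^ (n + k)) by (rewrite Rpow_mult_distr; ring).
        rewrite pow_add, <- Rmult_assoc. apply Rmult_le_compat_l. apply Rmult_le_pos; [lra|apply pow_le; lra].
        apply pow_incr; lra. }
      simpl (_ ^ S k). lra. }
  apply Rle_trans with (2 * B * (L * Cmod z) ^ n); [|rewrite Rpow_mult_distr; right; ring].
  apply clim_bound with (fun k => psum c (n + k) z).
  - intros e He. destruct (Hl e He) as [N HN]. exists N. intros k Hk. apply HN; lia.
  - intros k. apply Rle_trans with (1 := P k).
    rewrite <- (Rmult_1_r (2 * B * (L * Cmod z) ^ n)) at 2. apply Rmult_le_compat_l.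
    apply Rmult_le_pos; [lra|apply pow_le; lra]. assert (0 <= (/ 2) ^ k) by (apply pow_le; lra). lra.
Qed.

Lemma C_derive_n_psum c n j z : C_derive_n (psum c (n + j)) j z = psum (Nat.iter j fps_deriv c) n z.
Proof.
  revert n z. induction j as [|j IH]; intros n z.
  - rewrite Nat.add_0_r. reflexivity.
  - simpl. apply cder_C_derive.
    apply cder_ext with (psum (Nat.iter j fps_deriv c) (S n)).
    + intros w. rewrite <- IH. f_equal. f_equal. lia.
    + eapply cder_eq. apply cder_psum. replace (S n - 1)%nat with n by lia. reflexivity.
Qed.

(** Cauchy's estimate on the disc of radius kappa |z|, applied to the remainder of order n + j: the
    j extra powers of |z| make up for the radius in the denominator. The dependence on j stays
    explicit, so that n = 0 gives the Gevrey bounds on derivatives and a fixed j the asymptotics of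
    one derivative. *)
Lemma asy_C_derive_n p S0 S1 kappa u c : 0 <= p -> 0 < kappa -> copen S0 -> hol S0 u ->
  (forall z, S1 z -> 0 < Cmod z /\ forall w, Cmod (w - z) < kappa * Cmod z -> S0 w) ->
  asy p S0 u c ->
  exists M K, 0 < M /\ 0 < K /\ forall j n z, S1 z ->
    Cmod (C_derive_n u j z - psum (Nat.iter j fps_deriv c) n z) <=
      M * K ^ (n + j) * INR (fact j) * fact_pow (n + j) p * Cmod z ^ n.
Proof.
  intros Hp Hk HO Hu Hball (M & K & HM & HK & H).
  assert (Q : 0 < 4 / kappa) by (apply Rdiv_lt_0_compat; lra).
  exists (2 * M), (K * (1 + kappa) * (1 + 4 / kappa)).
  split; [lra|]. split; [repeat apply Rmult_lt_0_compat; lra|].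
  intros j n z Hz. destruct (Hball z Hz) as [Pz HB].
  assert (S0z : S0 z) by (apply HB; rewrite Cmod_zero_sub; nra).
  rewrite <- C_derive_n_psum.
  assert (Hpol : hol S0 (psum c (n + j))) by (intros w _; eexists; apply cder_psum).
  rewrite <- (C_derive_n_minus u (psum c (n + j)) S0 j HO Hu Hpol z S0z).
  set (X := M * K ^ (n + j) * fact_pow (n + j) p).
  assert (X0 : 0 <= X).
  { unfold X. repeat apply Rmult_le_pos; try lra. apply pow_le; lra. apply Rlt_le, fact_pow_pos. }
  eapply Rle_trans.
  - apply (cauchy_estimate (fun w => u w - psum c (n + j) w)%C z (kappa * Cmod z) (X * ((1 + kappa) * Cmod z) ^ (n + j)) j).
    + nra.
    + intros w Hw. destruct (Hu w (HB w Hw)) as [l Hl]. eexists. apply cder_minus. exact Hl. apply cder_psum.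
    + intros w Hw. apply Rle_trans with (1 := H (n + j)%nat w (HB w Hw)).
      apply Rmult_le_compat_l; [exact X0|]. apply pow_incr. split; [apply Cmod_ge_0|].
      replace w with ((w - z) + z)%C by ring. apply Rle_trans with (1 := Cmod_triangle _ _). lra.
  - assert (E : (((1 + kappa) * Cmod z) ^ (n + j)) * (4 / (kappa * Cmod z)) ^ j = (1 + kappa) ^ (n + j) * (4 / kappa) ^ j * Cmod z ^ n).
    { rewrite Rpow_mult_distr, (pow_add (Cmod z)).
      replace ((1 + kappa) ^ (n + j) * (Cmod z ^ n * Cmod z ^ j) * (4 / (kappa * Cmod z)) ^ j) with
        ((1 + kappa) ^ (n + j) * Cmod z ^ n * (Cmod z ^ j * (4 / (kappa * Cmod z)) ^ j)) by ring.
      rewrite <- Rpow_mult_distr. replace (Cmod z * (4 / (kappa * Cmod z))) with (4 / kappa) by (field; lra). ring. }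
    replace (INR (fact j) * (2 * (X * ((1 + kappa) * Cmod z) ^ (n + j)) * (4 / (kappa * Cmod z)) ^ j)) with
      (INR (fact j) * 2 * X * (((1 + kappa) * Cmod z) ^ (n + j) * (4 / (kappa * Cmod z)) ^ j)) by ring.
    rewrite E. unfold X. rewrite !Rpow_mult_distr.
    replace (INR (fact j) * 2 * (M * K ^ (n + j) * fact_pow (n + j) p) * ((1 + kappa) ^ (n + j) * (4 / kappa) ^ j * Cmod z ^ n)) with
      (2 * M * (K ^ (n + j) * (1 + kappa) ^ (n + j)) * INR (fact j) * fact_pow (n + j) p * Cmod z ^ n * (4 / kappa) ^ j) by ring.
    replace (2 * M * (K ^ (n + j) * (1 + kappa) ^ (n + j) * (1 + 4 / kappa) ^ (n + j)) * INR (fact j) * fact_pow (n + j) p * Cmod z ^ n) with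
      (2 * M * (K ^ (n + j) * (1 + kappa) ^ (n + j)) * INR (fact j) * fact_pow (n + j) p * Cmod z ^ n * (1 + 4 / kappa) ^ (n + j)) by ring.
    apply Rmult_le_compat_l.
    + repeat apply Rmult_le_pos; try lra; try (apply pow_le; lra). apply pos_INR. apply Rlt_le, fact_pow_pos.
    + rewrite pow_add. rewrite <- (Rmult_1_l ((4 / kappa) ^ j)). apply Rmult_le_compat; [lra|apply pow_le; lra| |apply pow_incr; lra].
      apply pow_R1_Rle; lra.
Qed.

Lemma asy_derivative p S0 S1 kappa u c j : 0 <= p -> 0 < kappa -> copen S0 -> hol S0 u ->
  (forall z, S1 z -> 0 < Cmod z /\ forall w, Cmod (w - z) < kappa * Cmod z -> S0 w) ->
  asy p S0 u c -> asy p S1 (C_derive_n u j) (Nat.iter j fps_deriv c).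
Proof.
  intros Hp Hk HO Hu Hb Ha.
  destruct (asy_C_derive_n p S0 S1 kappa u c Hp Hk HO Hu Hb Ha) as (M & K & HM & HK & H).
  set (T := Rpower 2 p). assert (HT : 0 < T) by apply exp_pos.
  exists (M * (K * T) ^ j * INR (fact j) * fact_pow j p), (K * T).
  split. { repeat apply Rmult_lt_0_compat; auto. apply pow_lt; nra. apply INR_fact_pos. apply fact_pow_pos. }
  split; [nra|]. intros n z Hz. apply Rle_trans with (1 := H j n z Hz).
  apply Rmult_le_compat_r; [apply pow_le, Cmod_ge_0|].
  apply Rle_trans with (M * K ^ (n + j) * INR (fact j) * (T ^ (n + j) * (fact_pow n p * fact_pow j p))).
  - apply Rmult_le_compat_l; [|apply fact_pow_plus_le, Hp].
    repeat apply Rmult_le_pos; try lra. apply pow_le; lra. apply pos_INR.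
  - right. rewrite !Rpow_mult_distr, !pow_add. ring.
Qed.

Lemma asy_diffop p N a S0 S1 kappa u c : 0 <= p -> 0 < kappa -> copen S0 -> hol S0 u ->
  (forall z, S1 z -> 0 < Cmod z /\ forall w, Cmod (w - z) < kappa * Cmod z -> S0 w) ->
  (forall j, (j <= N)%nat -> geometric_asy S1 (a j) (taylor (a j))) ->
  asy p S0 u c -> asy p S1 (diffop N a u) (diffop_fps N a c).
Proof.
  intros Hp Hk HO Hu Hb Hg Ha.
  assert (T : forall j, (j <= N)%nat -> asy p S1 (fun z => a j z * C_derive_n u j z)%C (fps_mul (taylor (a j)) (Nat.iter j fps_deriv c))).
  { intros j Hj. apply asy_mult; auto. apply asy_derivative with S0 kappa; auto. }
  clear Hg. induction N as [|N IH].
  - apply asy_ext with (3 := T O (le_n _)); intros; unfold diffop, diffop_fps; rewrite sum_O; reflexivity.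
  - eapply asy_ext; [| |apply asy_plus; [apply IH; intros; apply T; lia|apply (T (S N) (le_n _))]].
    + intros z _. unfold diffop. rewrite sum_Sn. reflexivity.
    + intros k. unfold diffop_fps. rewrite sum_Sn. reflexivity.
Qed.

Lemma fact_le_pow n : INR (fact n) <= INR n ^ n.
Proof.
  induction n as [|n IH]. simpl. lra.
  rewrite INR_fact_S, S_INR. simpl. assert (Hn := pos_INR n).
  apply Rmult_le_compat_l; [lra|]. apply Rle_trans with (1 := IH). apply pow_incr. lra.
Qed.

Lemma psum_zero n z : psum (fun _ => RtoC 0) n z = 0.
Proof. induction n as [|n IH]; [reflexivity|]. rewrite psum_S, IH. ring. Qed.

(** Optimal truncation: K^n n!^p |z|^n <= (K n^p |z|)^n is at most e^(-n) as long as n <= (e K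
    |z|)^(-1/p). Rounding this bound down to an integer costs a factor e. *)
Lemma asy_0_flat p D h : 0 < p -> (forall z, D z -> 0 < Cmod z) -> asy p D h (fun _ => RtoC 0) ->
  exists M c, 0 < M /\ 0 < c /\ forall z, D z -> Cmod (h z) <= M * exp (- (c * Rpower (/ Cmod z) (/ p))).
Proof.
  intros Hp Hpos (M & K & HM & HK & H).
  set (c := Rpower (/ (exp 1 * K)) (/ p)).
  assert (He := exp_pos 1).
  exists (M * exp 1), c. split; [nra|]. split; [apply exp_pos|]. intros z Hz.
  assert (Pz := Hpos z Hz).
  set (N0 := c * Rpower (/ Cmod z) (/ p)).
  assert (EN : N0 = Rpower (/ (exp 1 * K * Cmod z)) (/ p)).
  { unfold N0, c. rewrite Rpower_mult_distr; [|apply Rinv_0_lt_compat; nra|apply Rinv_0_lt_compat, Pz].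
    f_equal. rewrite <- Rinv_mult. f_equal. }
  assert (N0p : 0 < N0) by (rewrite EN; apply exp_pos).
  destruct (nfloor_ex N0) as (n & Hn1 & Hn2); [lra|].
  specialize (H n z Hz).
  replace (h z - psum (fun _ => RtoC 0) n z)%C with (h z) in H.
  2:{ rewrite psum_zero. ring. }
  apply Rle_trans with (1 := H).
  apply Rle_trans with (M * exp (- INR n)).
  - rewrite (Rmult_assoc (M * K ^ n)), Rmult_assoc. apply Rmult_le_compat_l; [lra|].
    (* [Rpower] needs a positive base, so n = 0 is treated apart. *)
    destruct n as [|n].
    { rewrite fact_pow_0. simpl. rewrite Ropp_0, exp_0. lra. }
    set (m := S n) in *.
    assert (Hm : 0 < INR m) by (apply lt_0_INR; unfold m; lia).
    assert (F1 : fact_pow m p <= Rpower (INR m) p ^ m).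
    { rewrite <- Rpower_pow_le by exact Hm. apply Rpower_mono; [lra|apply INR_fact_pos|apply fact_le_pow]. }
    assert (F2 : Rpower (INR m) p <= / (exp 1 * K * Cmod z)).
    { apply Rle_trans with (Rpower N0 p). apply Rpower_mono; lra.
      rewrite EN, Rpower_mult, Rinv_l, Rpower_1 by (try lra; apply Rinv_0_lt_compat; repeat apply Rmult_lt_0_compat; lra). lra. }
    apply Rle_trans with ((K * Rpower (INR m) p * Cmod z) ^ m).
    + rewrite !Rpow_mult_distr, Rmult_assoc. apply Rmult_le_compat_l; [apply pow_le; lra|].
      apply Rmult_le_compat_r; [apply pow_le; lra|exact F1].
    + replace (exp (- INR m)) with (exp (- (1)) ^ m).
      * apply pow_incr. split. repeat apply Rmult_le_pos; try lra. apply Rlt_le, exp_pos.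
        rewrite exp_Ropp.
        apply Rle_trans with (K * / (exp 1 * K * Cmod z) * Cmod z).
        apply Rmult_le_compat_r; [lra|]. apply Rmult_le_compat_l; lra.
        right. field. repeat split; lra.
      * rewrite <- Rpower_pow by apply exp_pos. unfold Rpower. rewrite ln_exp. f_equal. ring.
  - rewrite Rmult_assoc, <- exp_plus. apply Rmult_le_compat_l; [lra|].
    apply exp_mono. unfold N0 in *. lra.
Qed.

(** * Watson's lemma *)

Lemma Re_scal x z : Re (RtoC x * z) = x * Re z.
Proof. rewrite Re_Cmult, Re_RtoC, Im_RtoC. ring. Qed.

Lemma Im_scal x z : Im (RtoC x * z) = x * Im z.
Proof. rewrite Im_Cmult, Re_RtoC, Im_RtoC. ring. Qed.

Lemma Re_cexp z : Re (cexp z) = exp (Re z) * cos (Im z).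
Proof. reflexivity. Qed.

Lemma exp_quadratic x : 0 <= x -> x ^ 2 / 2 <= exp x.
Proof.
  intros Hx. 
  assert (H : forall y, 0 <= y -> 1 + y <= exp y).
  { intros y [Hy| <-]. left; apply exp_ineq1; lra. rewrite exp_0; lra. }
  assert (H2 : 3 * x / 4 <= exp (x / 2)).
  { replace (x / 2) with (x / 4 + x / 4) by field. rewrite exp_plus.
    specialize (H (x / 4) ltac:(lra)).
    apply Rle_trans with ((1 + x / 4) * (1 + x / 4)); [nra|]. apply Rmult_le_compat; lra. }
  replace x with (x / 2 + x / 2) at 2 by field. rewrite exp_plus.
  apply Rle_trans with ((3 * x / 4) * (3 * x / 4)); [nra|]. apply Rmult_le_compat; lra.
Qed.

Lemma rect_hull_props x0 x1 y0 y1 :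
  convex (rect x0 x1 y0 y1) /\ copen (rect x0 x1 y0 y1) /\ hull_closed (rect x0 x1 y0 y1).
Proof. split; [apply convex_rect|split; [apply open_rect|apply hull_closed_rect]]. Qed.

Section Watson.

Variables (H : C -> C) (R0 B M c : R).
Hypothesis (HB : PI / 2 < B) (HM : 0 < M) (Hc : 0 < c).
Hypothesis (Hhol : hol (fun v => R0 < Re v /\ - B < Im v < B) H).
Hypothesis (Hflat : forall v, R0 < Re v -> - B < Im v < B -> Cmod (H v) <= M * exp (- (c * exp (Re v)))).

(* exp (lam e^(q v)) with q B1 = pi/2 has modulus 1 on the horizontal sides |Im v| = B1 and, since
   q < 1, order of growth too small to spoil the decay of H on the right side. *)
Lemma watson_contour_bound B1 R' x0 y0 d lam : let q := PI / (2 * B1) in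
  PI / 2 < B1 < B -> R0 < R' -> 0 < d -> R' + d <= x0 <= lam - d -> - B1 + d <= y0 <= B1 - d ->
  0 < lam -> 2 / (c * (1 - q) ^ 2) <= lam ->
  exp (lam * (exp (q * x0) * cos (q * y0))) * Cmod (H (x0, y0)) *
     (2 * B1 * (x0 - R') / ((x0 - R') + 2 * B1) ^ 2)
   <= M * exp (lam * exp (q * R')) * / d * (2 * ((lam - R') + 2 * B1)).
Proof.
  intros q HB1 HR' Hd Hx Hy Hl Hl2.
  assert (HPI := PI_RGT_0).
  assert (Hq : 0 < q < 1).
  { unfold q. split. apply Rdiv_lt_0_compat; lra. apply Rmult_lt_reg_r with (2 * B1); [lra|].
    unfold Rdiv. rewrite Rmult_assoc, Rinv_l by lra. lra. }
  set (v0 := (x0, y0) : C).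
  set (f := fun v => (cexp (RtoC lam * cexp (RtoC q * v)) * H v)%C).
  set (D := rect R0 (lam + 1) (- B) B).
  assert (Hf : hol D f).
  { intros v [V1 V2]. destruct (Hhol v) as [l Hl0]; [split; lra|].
    eexists. apply cder_mult; [|exact Hl0].
    apply (cder_comp cexp (fun v => (RtoC lam * cexp (RtoC q * v))%C)). apply cder_cexp.
    apply cder_scal. apply (cder_comp cexp (fun v => (RtoC q * v)%C)). apply cder_cexp. apply cder_scal, cder_id. }
  assert (Hv0 : rect R' lam (- B1) B1 v0) by (unfold v0, rect, Re, Im; simpl; lra).
  destruct (rect_hull_props R0 (lam + 1) (- B) B) as (D1 & D2 & D3).
  assert (CF := cauchy_rect f D R' lam (- B1) B1 v0 D1 D2 D3 Hf).
  specialize (CF ltac:(intros z [Z1 Z2]; unfold D, rect; lra) Hv0).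
  assert (Mf : forall v, Cmod (f v) = exp (lam * (exp (q * Re v) * cos (q * Im v))) * Cmod (H v)).
  { intros v. unfold f. rewrite Cmod_mult, Cmod_cexp, Re_scal, Re_cexp, Re_scal, Im_scal. reflexivity. }
  assert (Hbd : forall v, bd R' lam (- B1) B1 v -> Cmod (f v) <= M * exp (lam * exp (q * R'))).
  { intros v Hv. assert (Hs := bd_side _ _ _ _ _ Hv). apply bd_crect in Hv; [|lra|lra]. destruct Hv as [V1 V2].
    assert (F := Hflat v ltac:(lra) ltac:(lra)).
    rewrite Mf, (Rmult_comm M).
    assert (E1 : exp (- (c * exp (Re v))) <= 1).
    { rewrite <- exp_0. apply exp_mono. generalize (exp_pos (Re v)). nra. }
    assert (Hcos : cos (q * Im v) <= 1) by apply COS_bound.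
    assert (L0 : 0 <= lam * exp (q * R')) by (apply Rmult_le_pos; [lra|apply Rlt_le, exp_pos]).
    assert (F' : Cmod (H v) <= M).
    { apply Rle_trans with (1 := F). rewrite <- (Rmult_1_r M) at 2. apply Rmult_le_compat_l; lra. }
    assert (Hhor : cos (q * Im v) = 0 -> exp (lam * (exp (q * Re v) * cos (q * Im v))) * Cmod (H v) <= exp (lam * exp (q * R')) * M).
    { intros E. rewrite E, !Rmult_0_r, exp_0, Rmult_1_l.
      apply Rle_trans with (1 * M); [lra|]. apply Rmult_le_compat_r; [lra|]. rewrite <- exp_0 at 1. apply exp_mono, L0. }
    destruct Hs as [E|[E|[E|E]]].
    - rewrite E. apply Rmult_le_compat; [apply Rlt_le, exp_pos|apply Cmod_ge_0| |exact F'].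
      apply exp_mono. apply Rmult_le_compat_l; [lra|]. rewrite <- (Rmult_1_r (exp (q * R'))) at 2.
      apply Rmult_le_compat_l; [apply Rlt_le, exp_pos|exact Hcos].
    - rewrite E in F |- *.
      apply Rle_trans with (exp (lam * exp (q * lam)) * (M * exp (- (c * exp lam)))).
      + apply Rmult_le_compat; [apply Rlt_le, exp_pos|apply Cmod_ge_0| |exact F].
        apply exp_mono. apply Rmult_le_compat_l; [lra|]. rewrite <- (Rmult_1_r (exp (q * lam))) at 2.
        apply Rmult_le_compat_l; [apply Rlt_le, exp_pos|exact Hcos].
      + replace (exp (lam * exp (q * lam)) * (M * exp (- (c * exp lam)))) with (exp (lam * exp (q * lam) + - (c * exp lam)) * M) by (rewrite exp_plus; ring).
        apply Rmult_le_compat_r; [lra|]. apply exp_mono. apply Rle_trans with 0; [|exact L0].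
        (* The same [lam] is the parameter of the multiplier and the abscissa of the right side.
           There the decay of H must beat the multiplier: e^((1 - q) lam) is at least its quadratic
           term, and the lower bound on [lam] does the rest. *)
        assert (lam * exp (q * lam) <= c * exp lam); [|lra].
        replace (c * exp lam) with (c * exp ((1 - q) * lam) * exp (q * lam)) by (rewrite Rmult_assoc, <- exp_plus; f_equal; f_equal; ring).
        apply Rmult_le_compat_r; [apply Rlt_le, exp_pos|].
        apply Rle_trans with (c * (((1 - q) * lam) ^ 2 / 2)); [|apply Rmult_le_compat_l; [lra|apply exp_quadratic; nra]].
        replace (c * (((1 - q) * lam) ^ 2 / 2)) with (lam * (c * (1 - q) ^ 2 * lam / 2)) by field.
        rewrite <- (Rmult_1_r lam) at 1. apply Rmult_le_compat_l; [lra|].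
        assert (Pc : 0 < c * (1 - q) ^ 2) by (apply Rmult_lt_0_compat; [lra|apply pow_lt; lra]).
        apply (Rmult_le_compat_l (c * (1 - q) ^ 2 / 2)) in Hl2; [|lra].
        replace (c * (1 - q) ^ 2 / 2 * (2 / (c * (1 - q) ^ 2))) with 1 in Hl2 by (field; lra). lra.
    - apply Hhor. rewrite E. replace (q * - B1) with (- (PI / 2)) by (unfold q; field; lra). rewrite cos_neg. apply cos_PI2.
    - apply Hhor. rewrite E. replace (q * B1) with (PI / 2) by (unfold q; field; lra). apply cos_PI2. }
  assert (Hfar : forall v, bd R' lam (- B1) B1 v -> d <= Cmod (v - v0)).
  { intros v Hv. apply (bd_far _ _ _ _ _ _ _ Hv); unfold v0, Re, Im; simpl; lra. }
  assert (Up : Cmod (brect (fun z => f z * / (z - v0))%C R' lam (- B1) B1) <= M * exp (lam * exp (q * R')) * / d * (2 * ((lam - R') + (B1 - - B1)))).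
  { apply brect_bound; [lra|lra| |].
    - intros v Hv. apply ccont_mult. destruct (Hf v) as [l Hl0].
      apply bd_crect in Hv; [|lra|lra]. destruct Hv; unfold D, rect; lra. exact (ccont_cder _ _ _ Hl0).
      apply ccont_inv_sub. intros ->. generalize (Hfar v0 Hv). rewrite Cmod_zero_sub. lra.
    - intros v Hv. assert (Hv' := Hfar v Hv).
      rewrite Cmod_mult, Cmod_inv by (apply Cmod_pos_neq; lra).
      apply Rmult_le_compat; [apply Cmod_ge_0|left; apply Rinv_0_lt_compat; lra|apply Hbd, Hv|apply Rinv_le_contravar; lra]. }
  replace (B1 - - B1) with (2 * B1) in Up by ring.
  refine (Rle_trans _ _ _ _ Up). rewrite CF, Cmod_mult, Mf.
  unfold v0 at 1 2 3. unfold Re, Im; simpl fst; simpl snd.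
  apply Rmult_le_compat_l.
  { apply Rmult_le_pos; [apply Rlt_le, exp_pos|apply Cmod_ge_0]. }
  destruct (brect_inv_lower R' lam (- B1) B1 v0 Hv0) as (I1 & I2 & I3 & I4).
  apply Rle_trans with (Im (brect (fun z => / (z - v0))%C R' lam (- B1) B1)).
  2:{ apply Rle_trans with (2 := im_le_Cmod _), Rle_abs. }
  unfold brect. rewrite !Im_Cplus.
  unfold v0 at 1 2, Re at 1 2 in I4. simpl fst in I4.
  replace (B1 - - B1) with (2 * B1) in I4 by ring. lra.
Qed.

(** As lam grows, the upper bound from the contour is of order lam exp(lam e^(q R')), while the
    multiplier at the point is exp(lam e^(q x0) cos(q y0)). So H vanishes where e^(q x0) cos(q y0)
    exceeds e^(q R'); [R1] is chosen to make it exceed by 1 on the whole narrower strip. *)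
Lemma watson B' : PI / 2 < B' < B -> exists R1, R0 < R1 /\
  forall v, R1 < Re v -> - B' <= Im v <= B' -> H v = 0.
Proof.
  intros HB'. assert (HPI := PI_RGT_0).
  (* A width strictly beyond B' makes q B' < pi / 2, hence the cosine bounded below by a positive
     [kappa] on the strip. *)
  set (B1 := (B' + B) / 2). set (q := PI / (2 * B1)).
  assert (HB1 : PI / 2 < B1 < B) by (unfold B1; lra).
  assert (Hq : 0 < q < 1).
  { unfold q. split. apply Rdiv_lt_0_compat; lra. apply Rmult_lt_reg_r with (2 * B1); [lra|].
    unfold Rdiv. rewrite Rmult_assoc, Rinv_l by lra. lra. }
  assert (HqB : 0 < q * B' < PI / 2).
  { split; [nra|]. replace (PI / 2) with (q * B1) by (unfold q; field; lra). apply Rmult_lt_compat_l; unfold B1; lra. }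
  set (kappa := cos (q * B')).
  assert (Hk : 0 < kappa) by (apply cos_gt_0; lra).
  set (R' := R0 + 1). set (A := exp (q * R')).
  assert (HA : 0 < A) by apply exp_pos.
  assert (Ak : 0 < (A + 1) / kappa) by (apply Rdiv_lt_0_compat; lra).
  exists (Rmax (R' + 1) (ln ((A + 1) / kappa) / q)). split.
  { apply Rlt_le_trans with (2 := Rmax_l _ _). unfold R'; lra. }
  intros [x0 y0] Hx Hy. unfold Re, Im in Hx, Hy; simpl in Hx, Hy.
  assert (Hx1 := Rle_lt_trans _ _ _ (Rmax_l _ _) Hx). assert (Hx2 := Rle_lt_trans _ _ _ (Rmax_r _ _) Hx).
  assert (G : A + 1 <= exp (q * x0) * cos (q * y0)).
  { apply Rle_trans with ((A + 1) / kappa * kappa). right; field; lra.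
    apply Rmult_le_compat; [lra|lra| |].
    - rewrite <- (exp_ln ((A + 1) / kappa)) by exact Ak. apply exp_mono.
      apply Rle_trans with (q * (ln ((A + 1) / kappa) / q)). right; field; lra. apply Rmult_le_compat_l; lra.
    - unfold kappa. destruct (Rle_dec 0 y0).
      + apply cos_decr_1; try lra; nra.
      + replace (q * y0) with (- (q * (- y0))) by ring. rewrite cos_neg. apply cos_decr_1; try lra; nra. }
  destruct (Ceq_dec (H (x0, y0)) 0) as [E|E]; [exact E|exfalso].
  assert (P := Cmod_neq_0 _ E).
  set (d := Rmin 1 (B1 - B')).
  assert (Hd : 0 < d) by (apply Rmin_pos; unfold B1; lra).
  assert (Hd1 : d <= 1) by apply Rmin_l. assert (Hd2 : d <= B1 - B') by apply Rmin_r.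
  set (k0 := 2 * B1 * (x0 - R') / ((x0 - R') + 2 * B1) ^ 2).
  assert (Hk0 : 0 < k0).
  { unfold k0. apply Rdiv_lt_0_compat. apply Rmult_lt_0_compat; lra. apply pow_lt; lra. }
  set (C1 := M * / d * 2). assert (HC1 : 0 < C1) by (unfold C1; repeat apply Rmult_lt_0_compat; try lra; apply Rinv_0_lt_compat, Hd).
  (* In turn: the point lies inside the contour, [watson_contour_bound] applies, the half-perimeter
     is at most 2 lam, and e^lam >= lam^2 / 2 contradicts the linear bound. *)
  set (lam := Rmax (Rmax (x0 + 1) (2 / (c * (1 - q) ^ 2))) (Rmax (Rabs R' + 2 * B1 + 1) (8 * C1 / (Cmod (H (x0, y0)) * k0)))).
  assert (L1 : x0 + 1 <= lam) by (apply Rle_trans with (2 := Rmax_l _ _), Rmax_l).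
  assert (L2 : 2 / (c * (1 - q) ^ 2) <= lam) by (apply Rle_trans with (2 := Rmax_l _ _), Rmax_r).
  assert (L3 : Rabs R' + 2 * B1 + 1 <= lam) by (apply Rle_trans with (2 := Rmax_r _ _), Rmax_l).
  assert (L4 : 8 * C1 / (Cmod (H (x0, y0)) * k0) <= lam) by (apply Rle_trans with (2 := Rmax_r _ _), Rmax_r).
  assert (HR := Rle_abs (- R')). rewrite Rabs_Ropp in HR. assert (Lp : 0 < lam) by lra.
  assert (W := watson_contour_bound B1 R' x0 y0 d lam HB1 ltac:(unfold R'; lra) Hd ltac:(lra) ltac:(lra) Lp L2).
  cbv zeta in W. fold q in W. fold k0 in W. fold A in W.
  assert (W2 : exp (lam * A) * exp lam * (Cmod (H (x0, y0)) * k0) <= exp (lam * A) * (C1 * (2 * lam))).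
  { apply Rle_trans with (exp (lam * (exp (q * x0) * cos (q * y0))) * Cmod (H (x0, y0)) * k0).
    - rewrite <- Rmult_assoc. apply Rmult_le_compat_r; [lra|]. apply Rmult_le_compat_r; [lra|].
      rewrite <- exp_plus. apply exp_mono. nra.
    - apply Rle_trans with (1 := W). unfold C1.
      replace (M * exp (lam * A) * / d * (2 * (lam - R' + 2 * B1))) with (exp (lam * A) * (M * / d * 2 * (lam - R' + 2 * B1))) by ring.
      apply Rmult_le_compat_l; [apply Rlt_le, exp_pos|]. apply Rmult_le_compat_l; [fold C1|]; lra. }
  rewrite Rmult_assoc in W2. apply Rmult_le_reg_l in W2; [|apply exp_pos].
  assert (W3 : lam ^ 2 / 2 * (Cmod (H (x0, y0)) * k0) <= C1 * (2 * lam)).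
  { apply Rle_trans with (2 := W2). apply Rmult_le_compat_r. apply Rmult_le_pos; lra. apply exp_quadratic; lra. }
  assert (Pk : 0 < Cmod (H (x0, y0)) * k0) by (apply Rmult_lt_0_compat; lra).
  apply (Rmult_le_compat_r (Cmod (H (x0, y0)) * k0)) in L4; [|lra].
  replace (8 * C1 / (Cmod (H (x0, y0)) * k0) * (Cmod (H (x0, y0)) * k0)) with (8 * C1) in L4 by (field; lra).
  nra.
Qed.

End Watson.

(** * The Laplace transform in logarithmic coordinates *)

(** A single term of the exponential series, all of whose terms are nonnegative. *)
Lemma pow_le_fact_exp y n : 0 <= y -> y ^ n <= INR (fact n) * exp y.
Proof.
  intros Hy.
  assert (H := is_exp_Reals y).
  set (u := fun k => scal (K := R_AbsRing) (V := R_NormedModule) (pow_n (K := R_AbsRing) y k) (/ INR (fact k))) in *.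
  assert (Eu : forall k, u k = y ^ k / INR (fact k)).
  { intros k. unfold u. rewrite pow_n_pow. reflexivity. }
  assert (Pu : forall k, 0 <= u k).
  { intros k. rewrite Eu. apply Rmult_le_pos; [apply pow_le, Hy|left; apply Rinv_0_lt_compat, INR_fact_pos]. }
  assert (L : is_lim_seq (sum_n u) (exp y)) by exact H.
  assert (I : forall k, sum_n u k <= sum_n u (S k)).
  { intros k. rewrite sum_Sn. unfold plus; simpl. specialize (Pu (S k)). lra. }
  assert (B : sum_n u n <= exp y) by (apply (is_lim_seq_incr_compare _ _ L I)).
  assert (B' : u n <= sum_n u n).
  { destruct n as [|n]. rewrite sum_O; lra. rewrite sum_Sn. unfold plus; simpl.
    assert (0 <= sum_n u n); [|lra]. clear -Pu. induction n as [|n IH]. rewrite sum_O; auto. rewrite sum_Sn. unfold plus; simpl. generalize (Pu (S n)); lra. }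
  rewrite Eu in B'. assert (F := INR_fact_pos n).
  apply Rle_trans with (INR (fact n) * (y ^ n / INR (fact n))). right; field; lra. apply Rmult_le_compat_l; lra.
Qed.

(* With z = e^w and zeta = e^om, the Laplace integral of index 1/p, int e^(-t) g(z t^p) dt, becomes the
   convolution int Kf w om * g(e^om) d om along a horizontal line Im om = phi; rotating the ray of
   integration is moving this line. *)
Definition Ek (v : C) : C := cexp (v - cexp v).

Lemma Cmod_Ek v : Cmod (Ek v) = exp (Re v - exp (Re v) * cos (Im v)).
Proof. unfold Ek. rewrite Cmod_cexp, Re_Cminus, Re_cexp. reflexivity. Qed.

Lemma cder_Ek v : cder Ek v (Ek v * (1 - cexp v)).
Proof.
  apply (cder_comp cexp (fun v => (v - cexp v)%C)). apply cder_cexp.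
  apply cder_minus. apply cder_id. apply cder_cexp.
Qed.

Section Laplace.

Variables (p : R).
Hypothesis (Hp : 0 < p).
Let m := / p.

Let Hm : 0 < m.
Proof. apply Rinv_0_lt_compat, Hp. Qed.

(** With t = e^((om - w) / p) this is e^(-t) dt / d om; the leading factor 1 / p comes from dt. *)
Definition Kf (w om : C) : C := (RtoC (/ p) * Ek (RtoC (/ p) * (om - w)))%C.

(** The modulus of t = e^((om - w) / p) at a point om of real part x. *)
Definition Xf (w : C) (x : R) : R := exp (/ p * (x - Re w)).

Lemma Xf_pos w x : 0 < Xf w x.
Proof. apply exp_pos. Qed.

Lemma Cmod_Kf w x phi : Cmod (Kf w (x, phi)) = m * (Xf w x * exp (- (Xf w x * cos (m * (phi - Im w))))).
Proof.
  unfold Kf. rewrite Cmod_mult, Cmod_R, Rabs_right by (fold m; lra). fold m. f_equal.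
  rewrite Cmod_Ek, Re_scal, Im_scal, Re_Cminus, Im_Cminus. unfold Xf. fold m.
  unfold Re at 1 2; unfold Im at 1; simpl fst; simpl snd.
  rewrite <- exp_plus. reflexivity.
Qed.

Lemma cder_Kf_om w om : cder (Kf w) om (RtoC m * (Ek (RtoC m * (om - w)) * (1 - cexp (RtoC m * (om - w))) * RtoC m)).
Proof.
  unfold Kf. fold m. apply cder_scal.
  apply (cder_comp Ek (fun om => (RtoC m * (om - w))%C)). apply cder_Ek.
  eapply cder_eq. apply cder_scal. apply cder_minus. apply cder_id. apply cder_const. ring.
Qed.

Definition dKf (w om : C) : C :=
  (RtoC (/ p) * (Ek (RtoC (/ p) * (om - w)) * (1 - cexp (RtoC (/ p) * (om - w))) * - RtoC (/ p)))%C.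

Lemma cder_Kf_w w om : cder (fun w => Kf w om) w (dKf w om).
Proof.
  unfold Kf, dKf. apply cder_scal.
  apply (cder_comp Ek (fun w => (RtoC (/ p) * (om - w))%C)). apply cder_Ek.
  eapply cder_eq. apply cder_scal. apply cder_minus. apply cder_const. apply cder_id. ring.
Qed.

Lemma ccont_dKf w om : ccont (dKf w) om.
Proof.
  unfold dKf. apply ccont_scal. apply ccont_mult; [|apply ccont_const].
  assert (A : cder (fun om => (RtoC (/ p) * (om - w))%C) om (RtoC (/ p))).
  { eapply cder_eq. apply cder_scal. apply cder_minus. apply cder_id. apply cder_const. ring. }
  apply ccont_mult; eapply ccont_cder.
  - apply (cder_comp Ek (fun om => (RtoC (/ p) * (om - w))%C)). apply cder_Ek. exact A.
  - apply cder_minus. apply cder_const. apply (cder_comp cexp (fun om => (RtoC (/ p) * (om - w))%C)). apply cder_cexp. exact A.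
Qed.

Lemma continuous_horiz (f : C -> C) phi x : ccont f (x, phi) ->
  continuous (U := C_R_NormedModule) (fun x : R => f (x, phi)) x.
Proof.
  intros H.
  assert (E : forall s : R, ((s, phi) : C) = ((0, phi) + RtoC s * 1)%C) by (intros; apply injective_projections; simpl; ring).
  apply continuous_ext with (fun s : R => f ((0, phi) + RtoC s * 1)%C).
  { intros s. rewrite <- E. reflexivity. }
  apply ccont_path. rewrite <- E. exact H.
Qed.

(** Truncation to [-n, n] presents the improper integral as the limit of a sequence of functions of
    w, the setting of [cder_bounded_limit]. *)
Definition lapI (phi : R) (h : C -> C) (n : nat) (w : C) : C :=
  RInt (V := C_R_CompleteNormedModule) (fun x => Kf w (x, phi) * h (x, phi))%C (- INR n) (INR n).

Definition lap (phi : R) (h : C -> C) (w l : C) : Prop := clim (fun n => lapI phi h n w) l.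

Definition line_cont (phi : R) (h : C -> C) : Prop := forall x, ccont h (x, phi).

Lemma lap_integrable phi h w a b : line_cont phi h ->
  exists l, is_cint (fun x => Kf w (x, phi) * h (x, phi))%C a b l.
Proof.
  intros Hh. apply ex_cint. intros t _. apply (continuous_horiz (fun om => Kf w om * h om)%C).
  apply ccont_mult; [|apply Hh]. eapply ccont_cder, cder_Kf_om.
Qed.

Lemma lapI_correct phi h n w : line_cont phi h ->
  is_cint (fun x => Kf w (x, phi) * h (x, phi))%C (- INR n) (INR n) (lapI phi h n w).
Proof.
  intros Hh. destruct (lap_integrable phi h w (- INR n) (INR n) Hh) as [l Hl].
  unfold lapI. rewrite (is_RInt_unique (V := C_R_CompleteNormedModule) _ _ _ _ Hl). exact Hl.
Qed.

Lemma lapI_eq phi h n w l : is_cint (fun x => Kf w (x, phi) * h (x, phi))%C (- INR n) (INR n) l -> lapI phi h n w = l.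
Proof. intros H. apply (is_RInt_unique (V := C_R_CompleteNormedModule)). exact H. Qed.

(** Half of the decay of the kernel pays for the growth of h; the other half leaves a majorant with
    the elementary primitive [Phi]. *)
Lemma lap_integrand_bound phi (h : C -> C) w kappa A x : 2 * kappa <= cos (m * (phi - Im w)) -> 0 <= A ->
  Cmod (h (x, phi)) <= A * exp (kappa * Xf w x) ->
  Cmod (Kf w (x, phi) * h (x, phi)) <= A * (m * (Xf w x * exp (- (kappa * Xf w x)))).
Proof.
  intros Hk HA Hh. rewrite Cmod_mult, Cmod_Kf.
  assert (Px := Xf_pos w x).
  apply Rle_trans with (m * (Xf w x * exp (- (Xf w x * (2 * kappa)))) * (A * exp (kappa * Xf w x))).
  - apply Rmult_le_compat; [|apply Cmod_ge_0| |exact Hh].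
    + apply Rmult_le_pos; [lra|]. apply Rmult_le_pos; [lra|apply Rlt_le, exp_pos].
    + apply Rmult_le_compat_l; [lra|]. apply Rmult_le_compat_l; [lra|]. apply exp_mono. nra.
  - right. replace (- (Xf w x * (2 * kappa))) with (- (kappa * Xf w x) + - (kappa * Xf w x)) by ring.
    rewrite exp_plus, (exp_Ropp (kappa * Xf w x)). field. apply Rgt_not_eq, exp_pos.
Qed.

Definition Phi (w : C) (kappa x : R) : R := - / kappa * exp (- (kappa * Xf w x)).

Lemma is_derive_Phi w kappa x : kappa <> 0 ->
  is_derive (Phi w kappa) x (m * (Xf w x * exp (- (kappa * Xf w x)))).
Proof. intros Hk. unfold Phi, Xf. fold m. auto_derive; [exact I|]. unfold Rminus. field. exact Hk. Qed.

Lemma is_RInt_Phi w kappa a b : kappa <> 0 ->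
  is_RInt (fun x => m * (Xf w x * exp (- (kappa * Xf w x)))) a b (Phi w kappa b - Phi w kappa a).
Proof.
  intros Hk. apply (is_RInt_derive (V := R_CompleteNormedModule) (Phi w kappa)).
  - intros x _. apply is_derive_Phi, Hk.
  - intros x _. apply (ex_derive_continuous (K := R_AbsRing) (V := R_NormedModule)). unfold Xf. auto_derive. exact I.
Qed.

Lemma lap_piece_bound phi (h : C -> C) w kappa A a b l : a <= b -> 0 < kappa -> 0 <= A ->
  2 * kappa <= cos (m * (phi - Im w)) ->
  (forall x, Cmod (h (x, phi)) <= A * exp (kappa * Xf w x)) ->
  is_cint (fun x => Kf w (x, phi) * h (x, phi))%C a b l ->
  Cmod l <= A * (Phi w kappa b - Phi w kappa a).
Proof.
  intros Hab Hk HA Hcos Hh Hl.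
  apply (is_cint_norm_le (fun x => Kf w (x, phi) * h (x, phi))%C (fun x => A * (m * (Xf w x * exp (- (kappa * Xf w x))))) a b l _ Hab); [|exact Hl|].
  - intros x _. apply lap_integrand_bound; auto.
  - apply (is_RInt_scal (V := R_NormedModule)). apply is_RInt_Phi. lra.
Qed.

Lemma Phi_range w kappa x : 0 < kappa -> - / kappa <= Phi w kappa x <= 0.
Proof.
  intros Hk. unfold Phi. assert (Pk : 0 < / kappa) by (apply Rinv_0_lt_compat, Hk).
  assert (H1 := exp_pos (- (kappa * Xf w x))).
  assert (H2 : exp (- (kappa * Xf w x)) <= 1).
  { rewrite <- exp_0. apply exp_mono. generalize (Xf_pos w x). nra. }
  nra.
Qed.

Lemma lapI_bound phi h w kappa A n : 0 < kappa -> 0 <= A -> line_cont phi h ->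
  2 * kappa <= cos (m * (phi - Im w)) ->
  (forall x, Cmod (h (x, phi)) <= A * exp (kappa * Xf w x)) ->
  Cmod (lapI phi h n w) <= A / kappa.
Proof.
  intros Hk HA Hc Hcos Hh.
  eapply Rle_trans. eapply lap_piece_bound with (6 := lapI_correct phi h n w Hc); eauto. generalize (pos_INR n); lra.
  unfold Rdiv. apply Rmult_le_compat_l; [exact HA|].
  generalize (Phi_range w kappa (INR n) Hk) (Phi_range w kappa (- INR n) Hk). lra.
Qed.

(** The integrals [psi] of the majorant increase and are bounded, because [Phi] takes its values
    between -1 / kappa and 0. They are therefore Cauchy, and they dominate the increments of the
    truncated integrals. *)
Lemma lap_exists phi h w kappa A : 0 < kappa -> 0 <= A -> line_cont phi h ->
  2 * kappa <= cos (m * (phi - Im w)) ->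
  (forall x, Cmod (h (x, phi)) <= A * exp (kappa * Xf w x)) ->
  exists l, lap phi h w l /\ Cmod l <= A / kappa.
Proof.
  intros Hk HA Hc Hcos Hh.
  set (psi := fun n : nat => A * (Phi w kappa (INR n) - Phi w kappa (- INR n))).
  assert (D : forall n k, (n <= k)%nat -> Cmod (lapI phi h k w - lapI phi h n w) <= psi k - psi n).
  { intros n k Hnk. apply le_INR in Hnk. destruct (lap_integrable phi h w (- INR k) (- INR n) Hc) as [l1 H1].
    destruct (lap_integrable phi h w (INR n) (INR k) Hc) as [l2 H2].
    assert (E := is_cint_Chasles _ _ _ _ _ _ (is_cint_Chasles _ _ _ _ _ _ H1 (lapI_correct phi h n w Hc)) H2).
    rewrite (lapI_eq _ _ _ _ _ E).
    replace (l1 + lapI phi h n w + l2 - lapI phi h n w)%C with (l1 + l2)%C by ring.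
    apply Rle_trans with (1 := Cmod_triangle _ _).
    assert (B1 := lap_piece_bound phi h w kappa A (- INR k) (- INR n) l1 ltac:(lra) Hk HA Hcos Hh H1).
    assert (B2 := lap_piece_bound phi h w kappa A (INR n) (INR k) l2 ltac:(lra) Hk HA Hcos Hh H2).
    unfold psi. lra. }
  assert (G : Un_growing psi).
  { intros n. generalize (Rle_trans _ _ _ (Cmod_ge_0 _) (D n (S n) ltac:(lia))). lra. }
  assert (Bd : has_ub psi).
  { exists (A * / kappa). intros y [n ->]. unfold psi. apply Rmult_le_compat_l; [exact HA|].
    generalize (Phi_range w kappa (INR n) Hk) (Phi_range w kappa (- INR n) Hk). lra. }
  destruct (clim_complete (fun n => lapI phi h n w)) as [l Hl].
  - intros e He. destruct (CV_Cauchy psi (growing_cv psi G Bd) e He) as [N HN].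
    exists N. intros n k Hn Hk'.
    specialize (HN n k Hn Hk'). unfold Rdist in HN.
    destruct (le_lt_dec n k) as [L|L].
    + rewrite Cmod_sub_sym. apply Rle_lt_trans with (1 := D n k L). rewrite Rabs_minus_sym in HN. generalize (Rle_abs (psi k - psi n)). lra.
    + apply Rle_lt_trans with (1 := D k n ltac:(lia)). generalize (Rle_abs (psi n - psi k)). lra.
  - exists l. split; [exact Hl|]. replace l with (l - 0)%C by ring.
    eapply clim_bound; [exact Hl|]. intros n. cbv beta. replace (lapI phi h n w - 0)%C with (lapI phi h n w) by ring.
    apply lapI_bound; auto.
Qed.

Lemma lap_ext_scal_minus phi h1 h2 c w l1 l2 : line_cont phi h1 -> line_cont phi h2 ->
  lap phi h1 w l1 -> lap phi h2 w l2 -> lap phi (fun om => h1 om - c * h2 om)%C w (l1 - c * l2).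
Proof.
  intros C1 C2 H1 H2. apply clim_ext with (fun n => lapI phi h1 n w - c * lapI phi h2 n w)%C.
  - intros n. symmetry. apply lapI_eq.
    eapply is_cint_ext; [|apply is_cint_minus; [apply lapI_correct, C1|apply is_cint_scal, lapI_correct, C2]].
    intros t _. simpl. ring.
  - apply clim_minus; [exact H1|]. apply clim_scal, H2.
Qed.

(** (p / kappa)^p, the factor that each further degree costs in the moment bounds, apart from the
    factorial. *)
Definition lap_weight (kappa : R) : R := Rpower (/ (kappa / p)) p.

(* Gevrey growth of the moments: X^(np) <= n!^p lam^(-np) e^(p lam X) from (lam X)^n <= n! e^(lam X). *)
Lemma exp_Xf_bound w kappa n x : 0 < kappa ->
  exp (INR n * x) <= exp (Re w) ^ n * lap_weight kappa ^ n * fact_pow n p * exp (kappa * Xf w x).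
Proof.
  intros Hk. set (lam := kappa / p). assert (Hl : 0 < lam) by (apply Rdiv_lt_0_compat; lra).
  assert (Px := Xf_pos w x).
  assert (B := pow_le_fact_exp (lam * Xf w x) n ltac:(nra)).
  assert (B' : Xf w x ^ n <= (/ lam) ^ n * INR (fact n) * exp (lam * Xf w x)).
  { apply Rmult_le_reg_l with (lam ^ n); [apply pow_lt, Hl|].
    rewrite <- Rpow_mult_distr. apply Rle_trans with (1 := B). right.
    replace (lam ^ n * ((/ lam) ^ n * INR (fact n) * exp (lam * Xf w x))) with ((lam ^ n * (/ lam) ^ n) * (INR (fact n) * exp (lam * Xf w x))) by ring.
    rewrite <- Rpow_mult_distr, Rinv_r, pow1 by lra. ring. }
  assert (E : exp (INR n * x) = exp (Re w) ^ n * Rpower (Xf w x ^ n) p).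
  { rewrite Rpower_pow_le by exact Px. unfold Rpower, Xf. rewrite ln_exp, <- Rpow_mult_distr, <- exp_plus.
    replace (Re w + p * (/ p * (x - Re w))) with x by (field; lra).
    rewrite <- Rpower_pow by apply exp_pos. unfold Rpower. rewrite ln_exp. reflexivity. }
  rewrite E, !Rmult_assoc. apply Rmult_le_compat_l; [apply pow_le, Rlt_le, exp_pos|].
  apply Rle_trans with (Rpower ((/ lam) ^ n * INR (fact n) * exp (lam * Xf w x)) p).
  - apply Rpower_mono; [lra|apply pow_lt, Px|exact B'].
  - right. assert (Hil : 0 < / lam) by (apply Rinv_0_lt_compat, Hl).
    rewrite <- !Rpower_mult_distr; try apply exp_pos; try apply INR_fact_pos; try (apply pow_lt; exact Hil).
    2:{ apply Rmult_lt_0_compat; [apply pow_lt, Hil|apply INR_fact_pos]. }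
    rewrite Rpower_pow_le by exact Hil. unfold lap_weight, fact_pow. fold lam.
    replace (Rpower (exp (lam * Xf w x)) p) with (exp (kappa * Xf w x)). ring.
    unfold Rpower at 1. rewrite ln_exp. f_equal. unfold lam. field. lra.
Qed.

(** The decay 4 kappa is divided into one share for the growth of h, one for the factor e^(n x)
    through [exp_Xf_bound], and two for the convergence of the integral. *)
Lemma lap_gevrey_bound phi h w kappa A n l : 0 < kappa -> 0 <= A -> line_cont phi h ->
  4 * kappa <= cos (m * (phi - Im w)) ->
  (forall x, Cmod (h (x, phi)) <= A * exp (INR n * x) * exp (kappa * Xf w x)) ->
  lap phi h w l -> Cmod l <= A * / kappa * lap_weight kappa ^ n * fact_pow n p * exp (Re w) ^ n.
Proof.
  intros Hk HA Hc Hcos Hh Hl.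
  set (Q := exp (Re w) ^ n * lap_weight kappa ^ n * fact_pow n p).
  assert (Q0 : 0 < Q).
  { unfold Q. repeat apply Rmult_lt_0_compat; try (apply pow_lt, exp_pos). apply fact_pow_pos. }
  destruct (lap_exists phi h w (2 * kappa) (A * Q)) as (l' & L1 & L2); [lra|nra|exact Hc|lra| |].
  - intros x. apply Rle_trans with (1 := Hh x).
    replace (2 * kappa * Xf w x) with (kappa * Xf w x + kappa * Xf w x) by ring. rewrite exp_plus.
    replace (A * Q * (exp (kappa * Xf w x) * exp (kappa * Xf w x))) with (A * (Q * exp (kappa * Xf w x)) * exp (kappa * Xf w x)) by ring.
    apply Rmult_le_compat_r; [apply Rlt_le, exp_pos|]. apply Rmult_le_compat_l; [exact HA|]. apply exp_Xf_bound, Hk.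
  - rewrite (clim_unique _ _ _ Hl L1). apply Rle_trans with (1 := L2).
    unfold Rdiv. rewrite Rinv_mult.
    apply Rle_trans with (A * Q * / kappa); [|right; unfold Q; ring].
    apply Rmult_le_compat_l; [nra|]. assert (0 < / kappa) by (apply Rinv_0_lt_compat, Hk).
    lra.
Qed.

End Laplace.

Lemma seg_horiz (f : C -> C) (a b phi : R) (l : C) : is_cint (fun x => f (x, phi)) a b l -> seg f (a, phi) (b, phi) = l.
Proof.
  intros H. apply is_seg_eq.
  apply is_cint_ext with (fun y => RtoC (b - a) * f (((b - a) * y + a)%R, phi))%C.
  - intros t _. f_equal; [apply injective_projections; simpl; ring|]. f_equal. apply injective_projections; simpl; ring.
  - apply (is_cint_comp_lin (fun x => f (x, phi))).
    replace ((b - a) * 0 + a) with a by ring. replace ((b - a) * 1 + a) with b by ring. exact H.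
Qed.

(** * Rotation of the ray of integration and holomorphy of the Laplace integral *)

Section Shift.

Variable (p : R).
Hypothesis (Hp : 0 < p).

(** Governs the vertical sides at x = n and x = -n. On the left X itself is of order e^(-n / p); on
    the right X e^(-kappa X) <= 2 / (kappa^2 X) is of the same order. *)
Lemma Xf_exp_bound w kappa (n : nat) x : 0 < kappa -> Rabs x = INR n ->
  Xf p w x * exp (- (kappa * Xf p w x)) <= (exp (- / p * Re w) + 2 / kappa ^ 2 * exp (/ p * Re w)) * exp (- / p) ^ n.
Proof.
  intros Hk Hx. assert (Px := Xf_pos p w x).
  assert (En : exp (- / p) ^ n = exp (- / p * INR n)).
  { rewrite <- Rpower_pow by apply exp_pos. unfold Rpower. rewrite ln_exp. f_equal. ring. }
  rewrite En, Rmult_plus_distr_r, Rmult_assoc, <- !exp_plus.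
  assert (K2 : 0 < 2 / kappa ^ 2) by (apply Rdiv_lt_0_compat; [lra|apply pow_lt, Hk]).
  assert (P1 := exp_pos (- / p * Re w + - / p * INR n)).
  assert (P2 : 0 < 2 / kappa ^ 2 * exp (/ p * Re w + - / p * INR n)) by (apply Rmult_lt_0_compat; [exact K2|apply exp_pos]).
  destruct (Rle_dec 0 x) as [H0|H0].
  - rewrite Rabs_right in Hx by lra. subst x.
    apply Rle_trans with (2 / kappa ^ 2 * / Xf p w (INR n)).
    + assert (Q := exp_quadratic (kappa * Xf p w (INR n)) ltac:(nra)).
      rewrite exp_Ropp.
      apply Rmult_le_reg_r with (exp (kappa * Xf p w (INR n))); [apply exp_pos|].
      rewrite Rmult_assoc, Rinv_l, Rmult_1_r by (apply Rgt_not_eq, exp_pos).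
      apply Rle_trans with (2 / kappa ^ 2 * / Xf p w (INR n) * ((kappa * Xf p w (INR n)) ^ 2 / 2)).
      right; field; lra. apply Rmult_le_compat_l; [|exact Q].
      apply Rmult_le_pos; [lra|left; apply Rinv_0_lt_compat, Px].
    + apply Rle_trans with (2 / kappa ^ 2 * exp (/ p * Re w + - / p * INR n)); [|lra].
      apply Rmult_le_compat_l; [lra|]. unfold Xf. rewrite <- exp_Ropp. right. f_equal. ring.
  - rewrite Rabs_left in Hx by lra. 
    apply Rle_trans with (Xf p w x * 1).
    + apply Rmult_le_compat_l; [lra|]. rewrite <- exp_0. apply exp_mono. nra.
    + rewrite Rmult_1_r. apply Rle_trans with (exp (- / p * Re w + - / p * INR n)); [|lra].
      unfold Xf. rewrite <- Hx. right. f_equal. ring.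
Qed.

(** Cauchy's theorem on the rectangle between the two lines, with vertical sides at -n and n whose
    contributions are O(e^(-n / p)). The growth bound is thus needed only for |x| >= X0; the margin
    [delta] supplies an open rectangle on which a primitive exists. *)
Lemma lap_shift phi1 phi2 delta (h : C -> C) w kappa A X0 l1 l2 : 0 < delta -> 0 < kappa -> 0 <= A -> phi1 <= phi2 ->
  hol (fun om => phi1 - delta < Im om < phi2 + delta) h ->
  (forall phi, phi1 <= phi <= phi2 -> 2 * kappa <= cos (/ p * (phi - Im w))) ->
  (forall x phi, X0 <= Rabs x -> phi1 <= phi <= phi2 -> Cmod (h (x, phi)) <= A * exp (kappa * Xf p w x)) ->
  lap p phi1 h w l1 -> lap p phi2 h w l2 -> l1 = l2.
Proof.
  intros Hd Hk HA Hphi Hhol Hcos Hh H1 H2.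
  assert (Hm : 0 < / p) by (apply Rinv_0_lt_compat, Hp).
  set (F := fun om => (Kf p w om * h om)%C).
  assert (LC : forall phi, phi1 <= phi <= phi2 -> line_cont phi h).
  { intros phi Hp' x. destruct (Hhol (x, phi)) as [l Hl]; [unfold Im; simpl; lra|]. exact (ccont_cder _ _ _ Hl). }
  assert (FC : forall om, phi1 - delta < Im om < phi2 + delta -> exists l, cder F om l).
  { intros om Hom. destruct (Hhol om Hom) as [l Hl]. eexists. apply cder_mult; [apply cder_Kf_om|exact Hl]. }
  set (C0 := (exp (- / p * Re w) + 2 / kappa ^ 2 * exp (/ p * Re w))).
  assert (V : forall n x, Rabs x = INR n -> X0 <= INR n ->
     Cmod (seg F (x, phi1) (x, phi2)) <= A * (/ p * (C0 * exp (- / p) ^ n)) * (phi2 - phi1)).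
  { intros n x Hx HX.
    rewrite <- (Rabs_right (phi2 - phi1)) by lra. rewrite <- (Cmod_vert x).
    apply seg_bound.
    - intros z (t & Ht & ->). destruct (FC ((x, phi1) + RtoC t * ((x, phi2) - (x, phi1)))%C) as [l Hl].
      rewrite Im_seg. unfold Im; simpl. nra. exact (ccont_cder _ _ _ Hl).
    - intros z (t & Ht & ->).
      replace ((x, phi1) + RtoC t * ((x, phi2) - (x, phi1)))%C with ((x, phi1 + t * (phi2 - phi1)) : C) by (apply injective_projections; simpl; ring).
      assert (R : phi1 <= phi1 + t * (phi2 - phi1) <= phi2) by nra.
      eapply Rle_trans. apply (lap_integrand_bound p Hp _ h w kappa A x (Hcos _ R) HA). apply Hh; [lra|exact R].
      apply Rmult_le_compat_l; [exact HA|]. apply Rmult_le_compat_l; [lra|]. apply Xf_exp_bound; auto. }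
  assert (Dif : forall n : nat, X0 <= INR n -> Cmod (lapI p phi1 h n w - lapI p phi2 h n w) <= 2 * (A * (/ p * C0) * (phi2 - phi1)) * exp (- / p) ^ n).
  { intros n HX. assert (Hn := pos_INR n).
    destruct (rect_hull_props (- INR n - 1) (INR n + 1) (phi1 - delta) (phi2 + delta)) as (D1 & D2 & D3).
    assert (Dc : rect (- INR n - 1) (INR n + 1) (phi1 - delta) (phi2 + delta) (0, phi1)) by (unfold rect, Re, Im; simpl; lra).
    assert (DF : forall z, rect (- INR n - 1) (INR n + 1) (phi1 - delta) (phi2 + delta) z -> exists l, cder F z l) by (intros z [_ Hz]; apply FC, Hz).
    destruct (primitive_exists _ (0, phi1) F D1 D2 D3 Dc) as [G HG].
    { intros z Hz. destruct (DF z Hz) as [l Hl]. exact (ccont_cder _ _ _ Hl). }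
    { intros z Hz _. apply DF, Hz. }
    assert (Hb : forall z, bd (- INR n) (INR n) phi1 phi2 z -> rect (- INR n - 1) (INR n + 1) (phi1 - delta) (phi2 + delta) z).
    { intros z Hz. apply bd_crect in Hz; [|lra|lra]. destruct Hz. unfold rect. lra. }
    assert (Z : brect F (- INR n) (INR n) phi1 phi2 = 0).
    { apply (brect_primitive G); intros z Hz. destruct (DF z (Hb z Hz)) as [l Hl]. exact (ccont_cder _ _ _ Hl). apply HG, Hb, Hz. }
    unfold brect in Z.
    rewrite (seg_horiz F (- INR n) (INR n) phi1 _ (lapI_correct p phi1 h n w (LC phi1 ltac:(lra)))) in Z.
    rewrite (seg_horiz F (INR n) (- INR n) phi2 _ (is_cint_swap _ _ _ _ (lapI_correct p phi2 h n w (LC phi2 ltac:(lra))))) in Z.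
    rewrite (seg_rev F ((- INR n)%R, phi1) ((- INR n)%R, phi2)) in Z.
    2:{ intros z (t & Ht & ->). destruct (FC (((- INR n)%R, phi1) + RtoC t * (((- INR n)%R, phi2) - ((- INR n)%R, phi1)))%C) as [l Hl].
        rewrite Im_seg. unfold Im; simpl. nra. exact (ccont_cder _ _ _ Hl). }
    assert (V1 := V n (INR n) (Rabs_right _ (Rle_ge _ _ Hn)) HX).
    assert (V2 := V n (- INR n) ltac:(rewrite Rabs_Ropp; apply Rabs_right, Rle_ge, Hn) HX).
    replace (lapI p phi1 h n w - lapI p phi2 h n w)%C with (seg F ((- INR n)%R, phi1) ((- INR n)%R, phi2) - seg F (INR n, phi1) (INR n, phi2))%C.
    - eapply Rle_trans; [apply Cmod_triangle_minus|]. lra.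
    - set (s1 := seg F ((- INR n)%R, phi1) ((- INR n)%R, phi2)) in *. set (s2 := seg F (INR n, phi1) (INR n, phi2)) in *.
      transitivity (s1 - s2 + 0)%C; [ring|]. rewrite <- Z. ring. }
  assert (L : clim (fun n => lapI p phi1 h n w - lapI p phi2 h n w)%C 0).
  { intros e He.
    destruct (pow_small (2 * (A * (/ p * C0) * (phi2 - phi1))) (exp (- / p)) e) as [N HN]; [|exact He|].
    - split; [apply Rlt_le, exp_pos|]. rewrite <- exp_0. apply exp_increasing. lra.
    - destruct (nfloor_ex (Rabs X0)) as (N1 & _ & HN1); [apply Rabs_pos|].
      exists (Nat.max N (S N1)). intros n Hn.
      replace (lapI p phi1 h n w - lapI p phi2 h n w - 0)%C with (lapI p phi1 h n w - lapI p phi2 h n w)%C by ring.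
      apply Rle_lt_trans with (2 := HN n ltac:(lia)). apply Dif.
      assert (INR (S N1) <= INR n) by (apply le_INR; lia). rewrite S_INR in H. generalize (Rle_abs X0). lra. }
  assert (E := clim_unique _ _ _ L (clim_minus _ _ _ _ H1 H2)).
  replace l1 with (l1 - l2 + l2)%C by ring. rewrite <- E. ring.
Qed.

(** Differentiation under the integral sign: [second_order] bounds the Taylor remainder of the
    kernel in w uniformly in x, so the integrated remainder is still quadratic in w - w1. *)
Lemma lapI_cder phi (h : C -> C) n w1 Bh : line_cont phi h ->
  (forall x, - INR n <= x <= INR n -> Cmod (h (x, phi)) <= Bh) ->
  exists l, cder (lapI p phi h n) w1 l.
Proof.
  intros Hc HB. assert (Hm : 0 < / p) by (apply Rinv_0_lt_compat, Hp). assert (Hn := pos_INR n).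
  (* [Y] bounds |t| for x <= n and w within 1 of w1. No sign of the cosine is assumed, so the
     exponential factor is bounded by e^Y. *)
  set (Y := exp (/ p * (INR n - Re w1 + 1))). set (Mn := / p * (Y * exp Y)).
  destruct (ex_cint (fun x => dKf p w1 (x, phi) * h (x, phi))%C (- INR n) (INR n)) as [J HJ].
  { intros t _. apply (continuous_horiz (fun om => dKf p w1 om * h om)%C). apply ccont_mult; [apply ccont_dKf|apply Hc]. }
  exists J. apply cder_quadratic with (1 / 8) (2 * INR n * (64 * Mn * Bh)); [lra|]. intros w Hw.
  assert (HI : is_cint (fun x => (Kf p w (x, phi) * h (x, phi) - Kf p w1 (x, phi) * h (x, phi)) - (w - w1) * (dKf p w1 (x, phi) * h (x, phi)))%C (- INR n) (INR n)
     (lapI p phi h n w - lapI p phi h n w1 - (w - w1) * J)).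
  { apply is_cint_minus; [apply is_cint_minus; apply lapI_correct, Hc|apply is_cint_scal, HJ]. }
  replace (lapI p phi h n w - lapI p phi h n w1 - J * (w - w1))%C with (lapI p phi h n w - lapI p phi h n w1 - (w - w1) * J)%C by ring.
  apply (is_cint_norm_le (fun x => (Kf p w (x, phi) * h (x, phi) - Kf p w1 (x, phi) * h (x, phi)) - (w - w1) * (dKf p w1 (x, phi) * h (x, phi)))%C
    (fun _ => 64 * Mn * Bh * Cmod (w - w1) ^ 2) (- INR n) (INR n)); [lra| |exact HI|].
  - intros x Hx.
    replace (Kf p w (x, phi) * h (x, phi) - Kf p w1 (x, phi) * h (x, phi) - (w - w1) * (dKf p w1 (x, phi) * h (x, phi)))%C
      with ((Kf p w (x, phi) - Kf p w1 (x, phi) - dKf p w1 (x, phi) * (w - w1)) * h (x, phi))%C by ring.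
    rewrite Cmod_mult.
    destruct (second_order (fun w => Kf p w (x, phi)) w1 1 Mn) as (l & L1 & _ & L2); [lra| | |].
    + intros z _. eexists. apply cder_Kf_w.
    + intros z Hz. rewrite (Cmod_Kf p Hp). unfold Mn. apply Rmult_le_compat_l; [lra|].
      assert (XY : Xf p z x <= Y).
      { unfold Xf, Y. apply exp_mono. apply Rmult_le_compat_l; [lra|].
        generalize (re_sub_le z w1) (Rle_abs (- (Re z - Re w1))). rewrite Rabs_Ropp. lra. }
      assert (Px := Xf_pos p z x).
      apply Rmult_le_compat; [lra|apply Rlt_le, exp_pos|exact XY|]. apply exp_mono.
      generalize (COS_bound (/ p * (phi - Im z))). nra.
    + rewrite (cder_unique _ _ _ _ L1 (cder_Kf_w p w1 (x, phi))) in L2.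
      specialize (L2 w ltac:(lra)).
      apply Rle_trans with (64 * Mn / 1 ^ 2 * Cmod (w - w1) ^ 2 * Bh).
      apply Rmult_le_compat; auto using Cmod_ge_0. right; field.
  - replace (2 * INR n * (64 * Mn * Bh) * Cmod (w - w1) ^ 2) with (scal (K := R_AbsRing) (V := R_NormedModule) (INR n - - INR n) (64 * Mn * Bh * Cmod (w - w1) ^ 2)).
    apply (is_RInt_const (V := R_NormedModule)). unfold scal; simpl; unfold mult; simpl; ring.
Qed.

Lemma lap_hol phi (h : C -> C) (U : C -> C) w0 rho kappa A : 0 < rho -> 0 < kappa -> 0 <= A -> line_cont phi h ->
  (forall w, Cmod (w - w0) < rho -> 2 * kappa <= cos (/ p * (phi - Im w))) ->
  (forall w x, Cmod (w - w0) < rho -> Cmod (h (x, phi)) <= A * exp (kappa * Xf p w x)) ->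
  (forall w, Cmod (w - w0) < rho -> lap p phi h w (U w)) ->
  exists l, cder U w0 l.
Proof.
  intros Hr Hk HA Hc Hcos Hh HU.
  assert (Hm : 0 < / p) by (apply Rinv_0_lt_compat, Hp).
  destruct (cder_bounded_limit (fun n w => lapI p phi h n w) U w0 rho (A / kappa) Hr) as (l & L & _).
  - intros n z Hz. apply (lapI_cder phi h n z (A * exp (kappa * Xf p z (INR n))) Hc).
    intros x Hx. apply Rle_trans with (1 := Hh z x Hz). apply Rmult_le_compat_l; [exact HA|]. apply exp_mono.
    apply Rmult_le_compat_l; [lra|]. unfold Xf. apply exp_mono. apply Rmult_le_compat_l; lra.
  - intros n z Hz. apply lapI_bound; auto.
  - exact HU.
  - exists l; exact L.
Qed.

End Shift.

(** * Euler's integral and the moments of the kernel *)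

Section GammaIntegral.

Variable (y : R).

Definition gamma_fun (t : R) : R := Rpower t y * exp (- t).

Lemma gamma_fun_pos t : 0 < gamma_fun t.
Proof. apply Rmult_lt_0_compat; apply exp_pos. Qed.

Lemma gamma_fun_cont t : 0 < t -> continuous gamma_fun t.
Proof.
  intros Ht. apply (ex_derive_continuous (K := R_AbsRing) (V := R_NormedModule)).
  unfold gamma_fun, Rpower. auto_derive. exact Ht.
Qed.

Lemma gamma_fun_int a b : 0 < a -> 0 < b -> ex_RInt gamma_fun a b.
Proof.
  intros Ha Hb. apply (ex_RInt_continuous (V := R_CompleteNormedModule)). intros t Ht.
  apply gamma_fun_cont. apply Rlt_le_trans with (2 := proj1 Ht). apply Rmin_pos; auto.
Qed.

Lemma gamma_int_mono a a' b b' : 0 < a' -> a' <= a -> a <= b -> b <= b' ->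
  RInt gamma_fun a b <= RInt gamma_fun a' b'.
Proof.
  intros H1 H2 H3 H4.
  rewrite <- (RInt_Chasles gamma_fun a' a b') by (apply gamma_fun_int; lra).
  rewrite <- (RInt_Chasles gamma_fun a b b') by (apply gamma_fun_int; lra).
  assert (A : 0 <= RInt gamma_fun a' a).
  { apply RInt_ge_0; [exact H2|apply gamma_fun_int; lra|intros; apply Rlt_le, gamma_fun_pos]. }
  assert (B : 0 <= RInt gamma_fun b b').
  { apply RInt_ge_0; [exact H4|apply gamma_fun_int; lra|intros; apply Rlt_le, gamma_fun_pos]. }
  unfold plus; simpl. lra.
Qed.

(** The integrand is positive, so the integral increases with its interval, and convergence along
    one exhausting sequence of intervals determines the improper integral. *)
Lemma Gamma_lim (a b : nat -> R) L : (forall n, 0 < a n) ->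
  (forall e, 0 < e -> exists N, forall n, (N <= n)%nat -> a n < e) ->
  (forall e, exists N, forall n, (N <= n)%nat -> e < b n) ->
  Un_cv (fun n => RInt gamma_fun (a n) (b n)) L -> Gamma (1 + y) = L /\ 0 < L.
Proof.
  intros Pa Ha Hb HL.
  assert (Up : forall x z, 0 < x -> x < z -> RInt gamma_fun x z <= L).
  { intros x z Hx Hxz. apply Rnot_lt_le. intros Hlt.
    destruct (HL (RInt gamma_fun x z - L)) as [N1 HN1]; [lra|].
    destruct (Ha x Hx) as [N2 HN2]. destruct (Hb z) as [N3 HN3].
    set (n := Nat.max N1 (Nat.max N2 N3)).
    specialize (HN1 n ltac:(unfold n; lia)). specialize (HN2 n ltac:(unfold n; lia)). specialize (HN3 n ltac:(unfold n; lia)).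
    assert (Mo := gamma_int_mono x (a n) z (b n) (Pa n) ltac:(lra) ltac:(lra) ltac:(lra)).
    unfold Rdist in HN1. generalize (Rle_abs (RInt gamma_fun (a n) (b n) - L)). lra. }
  split.
  - unfold Gamma. apply is_RInt_gen_unique.
    intros P [e HP].
    destruct (HL e (cond_pos e)) as [N1 HN1].
    destruct (Ha 1 Rlt_0_1) as [N2 HN2]. destruct (Hb 1) as [N3 HN3].
    set (n := Nat.max N1 (Nat.max N2 N3)).
    specialize (HN1 n ltac:(unfold n; lia)). specialize (HN2 n ltac:(unfold n; lia)). specialize (HN3 n ltac:(unfold n; lia)).
    apply Filter_prod with (Q := fun x => 0 < x < a n) (R := fun z => b n < z).
    + exists (mkposreal _ (Pa n)). intros x Hx Hx0. unfold ball in Hx; simpl in Hx. unfold AbsRing_ball, abs, minus, plus, opp in Hx; simpl in Hx.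
      rewrite Ropp_0, Rplus_0_r in Hx. rewrite Rabs_right in Hx by lra. lra.
    + exists (b n). auto.
    + intros x z Hx Hz. exists (RInt gamma_fun x z). split.
      * apply is_RInt_ext with gamma_fun. { intros t _. unfold gamma_fun. replace (1 + y - 1) with y by ring. reflexivity. }
        apply (RInt_correct (V := R_CompleteNormedModule)). simpl. apply gamma_fun_int; lra.
      * apply HP. simpl. change (Rabs (RInt gamma_fun x z - L) < e).
        assert (U := Up x z ltac:(lra) ltac:(lra)).
        assert (Mo := gamma_int_mono (a n) x (b n) z ltac:(lra) ltac:(lra) ltac:(lra) ltac:(lra)).
        unfold Rdist in HN1. rewrite Rabs_left1 by lra. generalize (Rle_abs (- (RInt gamma_fun (a n) (b n) - L))). rewrite Rabs_Ropp. lra.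
  - apply Rlt_le_trans with (2 := Up 1 2 ltac:(lra) ltac:(lra)).
    apply RInt_gt_0; [lra|intros; apply gamma_fun_pos|]. intros t Ht. apply gamma_fun_cont. lra.
Qed.

End GammaIntegral.

Definition mono (k : nat) (om : C) : C := cexp (RtoC (INR k) * om).

Lemma mono_pow k om : mono k om = (cexp om ^ k)%C.
Proof. apply cexp_nat. Qed.

Lemma cder_mono k om : cder (mono k) om (mono k om * RtoC (INR k)).
Proof.
  apply (cder_comp cexp (fun om => (RtoC (INR k) * om)%C)). apply cder_cexp.
  eapply cder_eq. apply cder_scal, cder_id. ring.
Qed.

Lemma Cmod_mono k x phi : Cmod (mono k (x, phi)) = exp (INR k * x).
Proof. unfold mono. rewrite Cmod_cexp, Re_scal. reflexivity. Qed.

Lemma clim_Re u l : clim u l -> Un_cv (fun n => Re (u n)) (Re l).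
Proof.
  intros H e He. destruct (H e He) as [N HN]. exists N. intros n Hn. unfold Rdist.
  apply Rle_lt_trans with (1 := re_sub_le (u n) l). apply HN, Hn.
Qed.

Lemma clim_Im u l : clim u l -> Un_cv (fun n => Im (u n)) (Im l).
Proof.
  intros H e He. destruct (H e He) as [N HN]. exists N. intros n Hn. unfold Rdist.
  apply Rle_lt_trans with (1 := im_sub_le (u n) l). apply HN, Hn.
Qed.

Lemma cos_ge_of_abs_le x y : Rabs x <= Rabs y -> Rabs y <= PI -> cos y <= cos x.
Proof.
  intros H H'.
  assert (E : forall t, cos (Rabs t) = cos t).
  { intros t. unfold Rabs. destruct (Rcase_abs t); [apply cos_neg|reflexivity]. }
  rewrite <- (E x), <- (E y). assert (H1 := Rabs_pos x). apply cos_decr_1; lra.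
Qed.

Lemma lapI_ext p phi h1 h2 n w : (forall x, h1 (x, phi) = h2 (x, phi)) ->
  lapI p phi h1 n w = lapI p phi h2 n w.
Proof.
  intros H. apply (RInt_ext (V := C_R_CompleteNormedModule)). intros x _. rewrite H. reflexivity.
Qed.

Section Monomial.

Variable (p : R).
Hypothesis (Hp : 0 < p).

Lemma mono_growth k w kappa x phi : 0 < kappa ->
  Cmod (mono k (x, phi)) <= exp (Re w) ^ k * lap_weight p kappa ^ k * fact_pow k p * exp (kappa * Xf p w x).
Proof. intros Hk. rewrite Cmod_mono. apply exp_Xf_bound; auto. Qed.

Lemma mono_const_nonneg k w kappa : 0 <= exp (Re w) ^ k * lap_weight p kappa ^ k * fact_pow k p.
Proof.
  repeat apply Rmult_le_pos; try (apply pow_le, Rlt_le, exp_pos). apply Rlt_le, fact_pow_pos.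
Qed.

Lemma mono_line_cont k phi : line_cont phi (mono k).
Proof. intros x. eapply ccont_cder, cder_mono. Qed.

(** On the line Im om = Im w the variable t is real and positive, and the substitution t = [Xf]
    turns the truncated Laplace integral into a truncated Euler integral. *)
Lemma lapI_mono_real k n w :
  lapI p (Im w) (mono k) n w =
  (mono k w * RtoC (RInt (gamma_fun (INR k * p)) (Xf p w (- INR n)) (Xf p w (INR n))))%C.
Proof.
  apply lapI_eq.
  set (y := INR k * p).
  assert (HR : is_RInt (fun x => scal (K := R_AbsRing) (V := R_NormedModule) (/ p * Xf p w x) (gamma_fun y (Xf p w x))) (- INR n) (INR n)
     (RInt (gamma_fun y) (Xf p w (- INR n)) (Xf p w (INR n)))).
  { apply (is_RInt_comp (V := R_CompleteNormedModule) (gamma_fun y) (Xf p w)).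
    - intros x _. apply gamma_fun_cont, exp_pos.
    - intros x _. split. unfold Xf. auto_derive; [exact I|]. unfold Rminus. ring.
      apply (ex_derive_continuous (K := R_AbsRing) (V := R_NormedModule)). unfold Xf. auto_derive. exact I. }
  apply is_cint_ext with (fun x => mono k w * RtoC (scal (K := R_AbsRing) (V := R_NormedModule) (/ p * Xf p w x)%R (gamma_fun y (Xf p w x))))%C.
  - intros x _. unfold Kf, Ek, mono.
    assert (E1 : (RtoC (/ p) * ((x, Im w) - w))%C = RtoC (/ p * (x - Re w))).
    { destruct w as [w1 w2]. apply injective_projections; unfold Re, Im; simpl; ring. }
    rewrite E1, !cexp_RtoC. fold (Xf p w x).
    rewrite <- RtoC_minus, cexp_RtoC.
    replace (RtoC (INR k) * (x, Im w))%C with (RtoC (INR k) * w + RtoC (INR k * (x - Re w)))%C.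
    2:{ destruct w as [w1 w2]. apply injective_projections; unfold Re, Im; simpl; ring. }
    rewrite cexp_plus, cexp_RtoC.
    unfold scal; simpl. unfold mult; simpl. unfold gamma_fun.
    assert (E2 : Rpower (Xf p w x) y = exp (INR k * (x - Re w))).
    { unfold Rpower, Xf, y. rewrite ln_exp. f_equal. field. lra. }
    rewrite E2. replace (/ p * (x - Re w) - Xf p w x) with (/ p * (x - Re w) + - Xf p w x) by ring. rewrite exp_plus. fold (Xf p w x).
    rewrite !RtoC_mult. ring.
  - apply is_cint_scal. apply is_cint_pair. split; [exact HR|].
    assert (E : Im (RtoC (RInt (gamma_fun y) (Xf p w (- INR n)) (Xf p w (INR n)))) = scal (K := R_AbsRing) (V := R_NormedModule) (INR n - - INR n) 0).
    { unfold scal; simpl; unfold mult; simpl. ring. }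
    rewrite E. apply (is_RInt_const (V := R_NormedModule)).
Qed.

(** The Laplace integral converges by [lap_exists]; divided by the monomial, its truncations are
    real Euler integrals over growing intervals, which [Gamma_lim] identifies. *)
Lemma Gamma_pos k : 0 < Gamma (1 + INR k * p) /\
  forall w, lap p (Im w) (mono k) w (mono k w * RtoC (Gamma (1 + INR k * p))).
Proof.
  assert (G : forall w, lap p (Im w) (mono k) w (mono k w * RtoC (Gamma (1 + INR k * p))) /\ 0 < Gamma (1 + INR k * p)).
  { intros w.
    destruct (lap_exists p Hp (Im w) (mono k) w (/ 2) (exp (Re w) ^ k * lap_weight p (/ 2) ^ k * fact_pow k p)) as (l & L & _).
    - lra.
    - apply mono_const_nonneg.
    - apply mono_line_cont.
    - rewrite Rminus_diag, Rmult_0_r, cos_0. lra.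
    - intros x. apply mono_growth. lra.
    - assert (Nz : mono k w <> 0) by apply cexp_neq_0.
      assert (L' : clim (fun n => RtoC (RInt (gamma_fun (INR k * p)) (Xf p w (- INR n)) (Xf p w (INR n)))) (/ mono k w * l)).
      { apply clim_ext with (fun n => / mono k w * lapI p (Im w) (mono k) n w)%C.
        - intros n. rewrite lapI_mono_real. field. exact Nz.
        - apply clim_scal, L. }
      destruct (Gamma_lim (INR k * p) (fun n => Xf p w (- INR n)) (fun n => Xf p w (INR n)) (Re (/ mono k w * l))) as [G1 G2].
      + intros n. apply exp_pos.
      + intros e He. destruct (nfloor_ex (Rabs (p * ln e + Re w))) as (N & _ & HN); [apply Rabs_pos|].
        exists (S N). intros n Hn. apply le_INR in Hn. rewrite S_INR in Hn.
        rewrite <- (exp_ln e He). unfold Xf. apply exp_increasing.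
        apply Rmult_lt_reg_l with p; [exact Hp|]. rewrite <- Rmult_assoc, Rinv_r, Rmult_1_l by lra.
        generalize (Rle_abs (- (p * ln e + Re w))). rewrite Rabs_Ropp. lra.
      + intros e. destruct (nfloor_ex (Rabs (p * e + Re w))) as (N & _ & HN); [apply Rabs_pos|].
        exists (S N). intros n Hn. apply le_INR in Hn. rewrite S_INR in Hn.
        apply Rlt_le_trans with (exp e).
        generalize (exp_ineq1 e). intros Q. destruct (Req_dec e 0) as [->|E]; [rewrite exp_0; lra|specialize (Q E); lra].
        unfold Xf. apply exp_mono.
        apply Rmult_le_reg_l with p; [exact Hp|]. rewrite <- Rmult_assoc, Rinv_r, Rmult_1_l by lra.
        generalize (Rle_abs (p * e + Re w)). lra.
      + exact (clim_Re _ _ L').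
      + split; [|rewrite G1; exact G2].
        assert (I0 : Im (/ mono k w * l) = 0).
        { apply (UL_sequence _ _ _ (clim_Im _ _ L')). intros e He. exists O. intros n _. unfold Rdist.
          rewrite Im_RtoC, Rminus_diag, Rabs_R0. exact He. }
        replace (mono k w * RtoC (Gamma (1 + INR k * p)))%C with l; [exact L|].
        rewrite G1. replace (RtoC (Re (/ mono k w * l))) with (/ mono k w * l)%C. field; exact Nz.
        apply injective_projections; [reflexivity|]. exact I0. }
  split; [exact (proj2 (G 0))|intros w; apply G].
Qed.

(** Moves the line from Im w, where the value is known, to phi; the cosine on the lines in between
    is at least the one at phi. *)
Lemma lap_monomial k phi w kappa : 0 < kappa -> 2 * kappa <= cos (/ p * (phi - Im w)) ->
  Rabs (/ p * (phi - Im w)) < PI / 2 ->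
  lap p phi (mono k) w (cexp w ^ k * RtoC (Gamma (1 + INR k * p))).
Proof.
  intros Hk Hcos Habs. assert (HPI := PI_RGT_0).
  set (A := exp (Re w) ^ k * lap_weight p kappa ^ k * fact_pow k p).
  destruct (lap_exists p Hp phi (mono k) w kappa A Hk) as (l & L & _); auto.
  { apply mono_const_nonneg. } { apply mono_line_cont. } { intros x. apply mono_growth, Hk. }
  assert (L0 := proj2 (Gamma_pos k) w). rewrite mono_pow in L0.
  assert (Hhol : forall D, hol D (mono k)) by (intros D z _; eexists; apply cder_mono).
  assert (Hc : forall phi', Rabs (phi' - Im w) <= Rabs (phi - Im w) -> 2 * kappa <= cos (/ p * (phi' - Im w))).
  { intros phi' H. apply Rle_trans with (1 := Hcos). apply cos_ge_of_abs_le.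
    - rewrite !Rabs_mult. apply Rmult_le_compat_l; [apply Rabs_pos|exact H].
    - lra. }
  replace (cexp w ^ k * RtoC (Gamma (1 + INR k * p)))%C with l; [exact L|].
  destruct (Rle_dec phi (Im w)) as [Q|Q].
  - apply (lap_shift p Hp phi (Im w) 1 (mono k) w kappa A 0 _ _ Rlt_0_1 Hk (mono_const_nonneg _ _ _) Q (Hhol _)); auto.
    + intros phi' H. apply Hc. rewrite !Rabs_left1 by lra. lra.
    + intros x phi' _ _. apply mono_growth, Hk.
  - symmetry. apply (lap_shift p Hp (Im w) phi 1 (mono k) w kappa A 0 _ _ Rlt_0_1 Hk (mono_const_nonneg _ _ _) ltac:(lra) (Hhol _)); auto.
    + intros phi' H. apply Hc. rewrite !Rabs_right by lra. lra.
    + intros x phi' _ _. apply mono_growth, Hk.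
Qed.

Lemma lap_psum phi w kappa (g : fps) n : 0 < kappa -> 2 * kappa <= cos (/ p * (phi - Im w)) ->
  Rabs (/ p * (phi - Im w)) < PI / 2 ->
  lap p phi (fun om => psum g n (cexp om)) w (psum (fun k => g k * RtoC (Gamma (1 + INR k * p)))%C n (cexp w)).
Proof.
  intros Hk Hcos Habs. induction n as [|n IH].
  - apply clim_ext with (fun _ => RtoC 0); [|apply clim_const]. intros n. symmetry. apply lapI_eq.
    apply is_cint_ext with (fun _ => RtoC 0). intros t _. rewrite psum_0. ring.
    assert (H := is_cint_const 0 (- INR n) (INR n)). rewrite Cmult_0_r in H. exact H.
  - rewrite psum_S.
    replace (psum (fun k => g k * RtoC (Gamma (1 + INR k * p)))%C n (cexp w) + g n * RtoC (Gamma (1 + INR n * p)) * cexp w ^ n)%C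
     with (psum (fun k => g k * RtoC (Gamma (1 + INR k * p)))%C n (cexp w) - (- g n) * (cexp w ^ n * RtoC (Gamma (1 + INR n * p))))%C by ring.
    assert (LC : line_cont phi (fun om => psum g n (cexp om))).
    { intros x. eapply ccont_cder. apply (cder_comp (psum g n) cexp). apply cder_psum. apply cder_cexp. }
    assert (H := lap_ext_scal_minus p phi _ _ (- g n) w _ _ LC (mono_line_cont n phi) IH (lap_monomial n phi w kappa Hk Hcos Habs)).
    refine (clim_ext _ _ _ _ H). intros N. apply lapI_ext. intros x.
    rewrite psum_S, mono_pow. ring.
Qed.

End Monomial.

(** * Logarithms and sectors *)

(** [ell] is the primitive of 1 / z on a square about 1 that vanishes at 1. The derivative of z
    e^(-ell z) is zero, so this product keeps its value 1. *)
Lemma log_exists : exists ell : C -> C, ell 1 = RtoC 0 /\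
  forall z, Cmod (z - 1) < / 2 -> cder ell z (/ z) /\ cexp (ell z) = z.
Proof.
  set (D := rect (/ 2) (3 / 2) (- / 2) (/ 2)).
  destruct (rect_hull_props (/ 2) (3 / 2) (- / 2) (/ 2)) as (D1 & D2 & D3).
  assert (HD : forall z, D z -> z <> 0).
  { intros z [Z1 _] ->. unfold Re in Z1; simpl in Z1. lra. }
  assert (D0 : D 1) by (unfold D, rect, Re, Im; simpl; lra).
  destruct (primitive_exists D 1 Cinv D1 D2 D3 D0) as [G HG].
  { intros z Hz. eapply ccont_cder, cder_inv, HD, Hz. }
  { intros z Hz _. eexists. apply cder_inv, HD, Hz. }
  set (ell := fun z => (G z - G 1)%C).
  assert (L1 : forall z, D z -> cder ell z (/ z)).
  { intros z Hz. eapply cder_eq. apply cder_minus; [apply HG, Hz|apply cder_const]. ring. }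
  assert (E0 : ell 1 = 0) by (unfold ell; ring).
  exists ell. split; [exact E0|]. intros z Hz.
  assert (Dz : D z).
  { generalize (re_sub_le z 1) (im_sub_le z 1). rewrite Re_RtoC, Im_RtoC. intros A B.
    apply Rabs_le_between in A. apply Rabs_le_between in B. unfold D, rect. lra. }
  split; [apply L1, Dz|].
  assert (F : seg (fun _ => RtoC 0) 1 z = (z * cexp (- ell z) - 1 * cexp (- ell 1))%C).
  { apply (seg_ftc (fun z => z * cexp (- ell z))%C).
    - intros w _. apply ccont_const.
    - intros w Hw. assert (Dw := D1 1 z w D0 Dz Hw). eapply cder_eq.
      apply cder_mult. apply cder_id. apply (cder_comp cexp (fun z => (- ell z)%C)). apply cder_cexp. apply cder_opp, L1, Dw.
      cbv beta; field. apply HD, Dw. }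
  rewrite E0 in F. replace (- RtoC 0)%C with (RtoC 0) in F by ring. rewrite cexp_0 in F.
  assert (Z : seg (fun _ => RtoC 0) 1 z = 0).
  { rewrite (seg_ftc (fun _ => RtoC 0)). ring. intros w _; apply ccont_const. intros w _; apply cder_const. }
  rewrite Z, cexp_opp in F.
  assert (N := cexp_neq_0 (ell z)).
  assert (F' : (z * / cexp (ell z))%C = 1).
  { replace (z * / cexp (ell z))%C with ((z * / cexp (ell z) - 1 * 1) + 1)%C by ring. rewrite <- F. ring. }
  rewrite <- (Cmult_1_l (cexp (ell z))), <- F'. field. exact N.
Qed.

Lemma local_log z0 w0 : cexp w0 = z0 -> exists L : C -> C, L z0 = w0 /\
  forall z, Cmod (z - z0) < / 2 * Cmod z0 -> (exists l, cder L z l) /\ cexp (L z) = z.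
Proof.
  intros E. destruct log_exists as (ell & E1 & H).
  assert (N0 : z0 <> 0) by (rewrite <- E; apply cexp_neq_0).
  assert (P0 := Cmod_neq_0 _ N0).
  exists (fun z => (w0 + ell (z * / z0))%C). split.
  - rewrite Cinv_r, E1 by exact N0. ring.
  - intros z Hz.
    assert (Q : Cmod (z * / z0 - 1) < / 2).
    { replace (z * / z0 - 1)%C with ((z - z0) * / z0)%C by (field; exact N0).
      rewrite Cmod_mult, Cmod_inv by exact N0. apply Rmult_lt_reg_r with (Cmod z0); [exact P0|].
      rewrite Rmult_assoc, Rinv_l by lra. lra. }
    destruct (H _ Q) as [H1 H2]. split.
    + eexists. apply cder_plus. apply cder_const. apply (cder_comp ell (fun z => (z * / z0)%C)). exact H1.
      apply cder_mult. apply cder_id. apply cder_const.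
    + rewrite cexp_plus, H2, E. field. exact N0.
Qed.

(** Dilation invariance: division by e^w0 brings everything back to the point 1, so a radius
    proportional to the modulus works with the same [kappa] for all w0. *)
Lemma log_near_uniform delta : 0 < delta -> exists kappa, 0 < kappa /\
  forall w0 z, Cmod (z - cexp w0) < kappa * Cmod (cexp w0) -> exists w, cexp w = z /\ Cmod (w - w0) < delta.
Proof.
  intros Hd. destruct log_exists as (ell & E1 & H).
  assert (H1 := H 1). rewrite Cmod_zero_sub in H1. destruct (H1 ltac:(lra)) as [H1' _]. clear H1.
  destruct (ccont_cder _ _ _ H1' delta Hd) as (d & Hd' & Hc). rewrite E1 in Hc.
  exists (Rmin d (/ 2)). split; [apply Rmin_pos; lra|]. intros w0 z Hz.
  assert (N0 := cexp_neq_0 w0). assert (P0 := Cmod_neq_0 _ N0).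
  assert (Q : Cmod (z * / cexp w0 - 1) < Rmin d (/ 2)).
  { replace (z * / cexp w0 - 1)%C with ((z - cexp w0) * / cexp w0)%C by (field; exact N0).
    rewrite Cmod_mult, Cmod_inv by exact N0. apply Rmult_lt_reg_r with (Cmod (cexp w0)); [exact P0|].
    rewrite Rmult_assoc, Rinv_l by lra. lra. }
  apply Rmin_Rgt in Q. destruct Q as [Q1 Q2].
  exists (w0 + ell (z * / cexp w0))%C. split.
  - rewrite cexp_plus. rewrite (proj2 (H _ Q2)). field. exact N0.
  - replace (w0 + ell (z * / cexp w0) - w0)%C with (ell (z * / cexp w0) - 0)%C by ring. apply Hc, Q1.
Qed.

Lemma cexp_inj w w' : cexp w = cexp w' -> Rabs (Im w - Im w') < 2 * PI -> w = w'.
Proof.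
  intros E H. assert (E1 : Re w = Re w').
  { apply exp_inv. rewrite <- !Cmod_cexp, E. reflexivity. }
  assert (E2 : cos (Im w) = cos (Im w') /\ sin (Im w) = sin (Im w')).
  { unfold cexp in E. injection E. rewrite E1. intros A B. assert (P := exp_pos (Re w')). split; nra. }
  assert (E3 : cos (Im w - Im w') = 1).
  { rewrite cos_minus. destruct E2 as [-> ->]. generalize (sin2_cos2 (Im w')). unfold Rsqr. lra. }
  set (y := (Im w - Im w') / 2). assert (Hy : Im w - Im w' = 2 * y) by (unfold y; field).
  rewrite Hy in E3, H. rewrite cos_2a_sin in E3.
  assert (S0 : sin y = 0) by nra.
  assert (Y0 : y = 0).
  { rewrite Rabs_mult, (Rabs_right 2) in H by lra.
    destruct (Rtotal_order y 0) as [Q|[Q|Q]]; [exfalso|exact Q|exfalso].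
    - rewrite Rabs_left in H by lra. generalize (sin_gt_0 (- y) ltac:(lra) ltac:(lra)). rewrite sin_neg. lra.
    - rewrite Rabs_right in H by lra. generalize (sin_gt_0 y ltac:(lra) ltac:(lra)). lra. }
  apply injective_projections; [exact E1|]. change (Im w = Im w'). lra.
Qed.

Lemma in_sector_cexp S z : in_sector S z <->
  exists w, z = cexp w /\ Rbar_lt (exp (Re w)) (sec_rad S) /\ sec_lo S < Im w < sec_hi S.
Proof.
  split.
  - intros (t & phi & Ht & Hr & Hphi & ->). exists (ln t, phi). split.
    unfold cexp, Re, Im; simpl. rewrite exp_ln by exact Ht. reflexivity.
    unfold Re, Im; simpl. rewrite exp_ln by exact Ht. auto.
  - intros (w & -> & Hr & Hphi). exists (exp (Re w)), (Im w). split; [apply exp_pos|]. auto.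
Qed.

Lemma copen_in_sector S : copen (in_sector S).
Proof.
  intros z Hz. apply in_sector_cexp in Hz. destruct Hz as (w0 & -> & Hr & Hphi).
  assert (Hd : exists d, 0 < d /\ sec_lo S + d <= Im w0 <= sec_hi S - d /\ Rbar_lt (exp (Re w0 + d)) (sec_rad S)).
  { set (d1 := Rmin (Im w0 - sec_lo S) (sec_hi S - Im w0)).
    assert (P1 : 0 < d1) by (apply Rmin_pos; lra).
    assert (Q1 : d1 <= Im w0 - sec_lo S) by apply Rmin_l. assert (Q2 : d1 <= sec_hi S - Im w0) by apply Rmin_r.
    destruct (sec_rad S) as [r| |]; [|exists d1; simpl; lra|contradiction].
    simpl in Hr. assert (Pr : 0 < r) by (generalize (exp_pos (Re w0)); lra).
    assert (Lr : Re w0 < ln r) by (rewrite <- (ln_exp (Re w0)); apply ln_increasing; [apply exp_pos|exact Hr]).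
    exists (Rmin d1 ((ln r - Re w0) / 2)). split; [apply Rmin_pos; lra|].
    generalize (Rmin_l d1 ((ln r - Re w0) / 2)) (Rmin_r d1 ((ln r - Re w0) / 2)). intros A B.
    split; [lra|]. simpl. rewrite <- (exp_ln r) by exact Pr. apply exp_increasing. rewrite ?ln_exp. lra. }
  destruct Hd as (d & Hd & Hi & Hr').
  destruct (log_near_uniform d Hd) as (kappa & Hk & H).
  assert (P0 : 0 < Cmod (cexp w0)) by (rewrite Cmod_cexp; apply exp_pos).
  exists (kappa * Cmod (cexp w0)). split; [nra|]. intros z Hz.
  destruct (H w0 z Hz) as (w & <- & Hw). apply in_sector_cexp. exists w. split; [reflexivity|].
  generalize (re_sub_le w w0) (im_sub_le w w0). intros A B.
  apply Rabs_le_between in A. apply Rabs_le_between in B. split; [|lra].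
  assert (L : exp (Re w) <= exp (Re w0 + d)) by (apply exp_mono; lra).
  destruct (sec_rad S); simpl in *; [lra|exact I|contradiction].
Qed.

(** In logarithmic coordinates the smaller half-strip keeps a distance d from the boundary of the
    larger one. This provides the discs for Cauchy's estimates in [asy_C_derive_n]. *)
Lemma sector_ball theta a0 a1 r0 r1 : a1 < a0 -> 0 < r1 < r0 -> exists kappa, 0 < kappa /\
  forall z, in_sector (bisected_sector theta a1 (Finite r1)) z -> 0 < Cmod z /\
    forall w, Cmod (w - z) < kappa * Cmod z -> in_sector (bisected_sector theta a0 (Finite r0)) w.
Proof.
  intros Ha Hr.
  assert (Hl : ln r1 < ln r0) by (apply ln_increasing; lra).
  set (d := Rmin ((a0 - a1) / 2) (ln r0 - ln r1)).
  assert (Hd : 0 < d) by (apply Rmin_pos; lra).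
  assert (Hd1 : d <= (a0 - a1) / 2) by apply Rmin_l. assert (Hd2 : d <= ln r0 - ln r1) by apply Rmin_r.
  destruct (log_near_uniform d Hd) as (kappa & Hk & H).
  exists kappa. split; [exact Hk|]. intros z Hz. apply in_sector_cexp in Hz.
  destruct Hz as (w0 & -> & Hr0 & Hphi). simpl in Hr0, Hphi.
  split; [rewrite Cmod_cexp; apply exp_pos|]. intros z Hz.
  destruct (H w0 z Hz) as (w & <- & Hw). apply in_sector_cexp. exists w. split; [reflexivity|].
  generalize (re_sub_le w w0) (im_sub_le w w0). intros A B.
  apply Rabs_le_between in A. apply Rabs_le_between in B. simpl. split; [|lra].
  assert (L : Re w0 < ln r1) by (rewrite <- (ln_exp (Re w0)); apply ln_increasing; [apply exp_pos|exact Hr0]).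
  rewrite <- (exp_ln r0) by lra. apply exp_increasing. lra.
Qed.

Lemma in_sector_mono theta a0 a1 r0 r1 z : a1 <= a0 -> r1 <= r0 ->
  in_sector (bisected_sector theta a1 (Finite r1)) z -> in_sector (bisected_sector theta a0 (Finite r0)) z.
Proof.
  intros Ha Hr (t & phi & Ht & Hr' & Hphi & E). exists t, phi. simpl in *. repeat split; auto; lra.
Qed.

Lemma in_proper_subsector S' S z : proper_subsector S' S -> in_sector S' z -> in_sector S z.
Proof.
  intros (_ & H1 & H2 & _ & H3) (t & phi & Ht & Hr & Hphi & E). exists t, phi.
  repeat split; auto; try lra. exact (Rbar_lt_trans _ _ _ Hr H1).
Qed.

(** * Summability and the differential equation *)

Lemma line_bounded phi h a b : line_cont phi h -> a <= b ->
  exists B, 0 < B /\ forall x, a <= x <= b -> Cmod (h (x, phi)) <= B.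
Proof.
  intros Hc Hab.
  destruct (continuity_ab_maj (fun x => Cmod (h (x, phi))) a b Hab) as (M & HM & _).
  - intros c _ eps He. destruct (Hc c eps He) as (d & Hd & H).
    exists d. split; [exact Hd|]. intros x [_ Hx]. simpl in Hx |- *. unfold Rdist in *.
    specialize (H (x, phi)). rewrite Cmod_horiz in H. specialize (H Hx).
    apply Rabs_def1.
    + exact (Rle_lt_trans _ _ _ (Cmod_rtriangle (h (x, phi)) (h (c, phi))) H).
    + rewrite Cmod_sub_sym in H.
      apply Ropp_lt_cancel. rewrite Ropp_involutive, Ropp_minus_distr.
      exact (Rle_lt_trans _ _ _ (Cmod_rtriangle (h (c, phi)) (h (x, phi))) H).
  - exists (Cmod (h (M, phi)) + 1). split; [generalize (Cmod_ge_0 (h (M, phi))); lra|]. intros x Hx. specialize (HM x Hx). cbv beta in HM. lra.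
Qed.

Lemma INR_le_pow2 n : INR n <= 2 ^ n.
Proof. generalize (poly n 1 Rlt_0_1). replace (1 + 1) with 2 by ring. lra. Qed.

(** Away from 0 the powers of 2 L |z| increase, so each of the n terms is bounded through the top
    power, and n <= 2^n. *)
Lemma psum_bound_far c B L z n : 0 <= B -> 0 < L -> (forall n, Cmod (c n) <= B * L ^ n) -> 1 <= 2 * L * Cmod z ->
  Cmod (psum c n z) <= B * (4 * L * Cmod z) ^ n.
Proof.
  intros HB HL Hc Hz. rewrite psum_csum.
  assert (Q : Cmod (csum (fun k => c k * z ^ k)%C n) <= INR n * (B * (2 * L * Cmod z) ^ n)).
  { apply csum_bound. intros i Hi. rewrite Cmod_mult, Cmod_pow.
    apply Rle_trans with (B * L ^ i * Cmod z ^ i). apply Rmult_le_compat_r; [apply pow_le, Cmod_ge_0|apply Hc].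
    rewrite Rmult_assoc, <- Rpow_mult_distr. apply Rmult_le_compat_l; [exact HB|].
    apply Rle_trans with ((2 * L * Cmod z) ^ i). apply pow_incr; lra. apply Rle_pow; [lra|lia]. }
  apply Rle_trans with (1 := Q).
  apply Rle_trans with (2 ^ n * (B * (2 * L * Cmod z) ^ n)).
  - apply Rmult_le_compat_r; [|apply INR_le_pow2]. apply Rmult_le_pos; [exact HB|apply pow_le; lra].
  - right. replace (4 * L * Cmod z) with (2 * (2 * L * Cmod z)) by ring. rewrite (Rpow_mult_distr 2). ring.
Qed.

(** Near 0 the remainder is the tail of a convergent series. Elsewhere C1 e^x >= 1, so h and the
    partial sum can be estimated separately; the constants do not depend on n. *)
Lemma line_remainder p phi h (gc : fps) r r1 b B : line_cont phi h -> 0 < r -> 0 < r1 -> 0 < b -> 0 < B ->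
  (forall x, exp x < r -> is_psum gc (cexp (x, phi)) (h (x, phi))) ->
  (forall x, r1 < exp x -> Cmod (h (x, phi)) <= B * exp (b * exp (/ p * x))) ->
  exists A C1, 0 < A /\ 0 < C1 /\ forall n x,
    Cmod (h (x, phi) - psum gc n (cexp (x, phi))) <= A * C1 ^ n * exp (INR n * x) * exp (b * exp (/ p * x)).
Proof.
  intros Hc Hr Hr1 Hb HB Hser Hgr.
  set (L := 2 / r). assert (HL : 0 < L) by (apply Rdiv_lt_0_compat; lra).
  assert (Mx : forall x, Cmod (cexp (x, phi)) = exp x) by (intros; rewrite Cmod_cexp; reflexivity).
  destruct (is_psum_geometric_coef gc (cexp (ln (r / 2), phi)) (h (ln (r / 2), phi))) as (B0 & HB0 & Hcoef).
  { rewrite Mx. apply exp_pos. } { apply Hser. rewrite exp_ln; lra. }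
  rewrite Mx, exp_ln in Hcoef by lra. replace (/ (r / 2)) with L in Hcoef by (unfold L; field; lra).
  (* The compact range between the zone of the series and the zone of exponential growth; [Rmax]
     keeps the interval nonempty when the two zones overlap. *)
  destruct (line_bounded phi h (ln (r / 4)) (Rmax (ln (r / 4)) (ln (2 * r1))) Hc (Rmax_l _ _)) as (B1 & HB1 & HB1').
  exists (2 * B0 + B + B1), (4 * L). split; [lra|]. split; [lra|]. intros n x.
  assert (Px := exp_pos x).
  assert (P4 : exp (INR n * x) = exp x ^ n).
  { rewrite <- Rpower_pow by exact Px. unfold Rpower. rewrite ln_exp. reflexivity. }
  assert (PE : 1 <= exp (b * exp (/ p * x))).
  { rewrite <- exp_0. apply exp_mono. generalize (exp_pos (/ p * x)). nra. }
  rewrite P4, (Rmult_assoc (2 * B0 + B + B1)), <- Rpow_mult_distr.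
  destruct (Rlt_dec (exp x) (r / 4)) as [Hx|Hx].
  - apply Rle_trans with (2 * B0 * L ^ n * Cmod (cexp (x, phi)) ^ n).
    + apply psum_tail_bound; [exact HL| |exact Hcoef|apply Hser; lra].
      rewrite Mx. unfold L. apply Rle_trans with (2 / r * (r / 4)). apply Rmult_le_compat_l; [fold L|]; lra. right; field; lra.
    + rewrite Mx, (Rmult_assoc (2 * B0)), <- Rpow_mult_distr.
      assert (Q : (L * exp x) ^ n <= (4 * L * exp x) ^ n) by (apply pow_incr; nra).
      assert (Q0 : 0 <= (L * exp x) ^ n) by (apply pow_le; nra).
      apply Rle_trans with ((2 * B0 + B + B1) * (4 * L * exp x) ^ n * 1); [|apply Rmult_le_compat_l; [nra|exact PE]].
      rewrite Rmult_1_r. apply Rmult_le_compat; lra.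
  - apply Rnot_lt_le in Hx.
    assert (H2 : 1 <= 2 * L * Cmod (cexp (x, phi))).
    { rewrite Mx. unfold L. apply Rle_trans with (2 * (2 / r) * (r / 4)). right; field; lra.
      apply Rmult_le_compat_l; [fold L|]; lra. }
    assert (Hps := psum_bound_far gc B0 L (cexp (x, phi)) n ltac:(lra) HL Hcoef H2). rewrite Mx in Hps, H2.
    assert (Hh : Cmod (h (x, phi)) <= (B + B1) * exp (b * exp (/ p * x))).
    { destruct (Rlt_dec r1 (exp x)) as [H1|H1].
      - apply Rle_trans with (1 := Hgr x H1). apply Rmult_le_compat_r; lra.
      - apply Rnot_lt_le in H1. apply Rle_trans with B1; [|nra]. apply HB1'. split.
        + rewrite <- (ln_exp x). destruct Hx as [Hx|Hx]; [left; apply ln_increasing; lra|rewrite Hx; lra].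
        + apply Rle_trans with (2 := Rmax_r _ _). rewrite <- (ln_exp x). left. apply ln_increasing; lra. }
    assert (G1 : 1 <= (4 * L * exp x) ^ n) by (apply pow_R1_Rle; lra).
    set (G := (4 * L * exp x) ^ n) in *. set (Ex := exp (b * exp (/ p * x))) in *.
    apply Rle_trans with (1 := Cmod_triangle_minus _ _).
    assert (T1 : (B + B1) * Ex <= (B + B1) * G * Ex).
    { apply Rmult_le_compat_r; [lra|]. nra. }
    assert (T2 : B0 * G <= B0 * G * Ex) by (rewrite <- (Rmult_1_r (B0 * G)) at 1; apply Rmult_le_compat_l; nra).
    assert (T3 : 0 <= B0 * G * Ex) by (apply Rmult_le_pos; nra). lra.
Qed.

(** * The Borel-Laplace sum on a sector of opening larger than p pi *)

Section Construction.

Variables (p theta eps : R) (c : fps) (g : C -> C).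
Hypothesis (Hp : 0 < p < 2) (Heps : 0 < eps).
Hypothesis (Hext : extends_fps (borel (/ p) c) (bisected_sector theta eps p_infty) g).
Hypothesis (Hgrow : exp_growth (/ p) (bisected_sector theta eps p_infty) g).

(** The three bounds keep the lines theta +- 2 delta, with a margin delta, inside the sector of g;
    keep each line admissible up to delta beyond Im w = theta (4 delta <= p pi / 2); and keep the
    opening p pi + 2 delta below 2 pi. *)
Let delta := Rmin (eps / 8) (Rmin (p * PI / 8) ((2 - p) * PI / 4)).
(** 4 kap is the cosine of pi / 2 - delta / p, the largest argument of t that occurs, as required by
    [lap_gevrey_bound]. *)
Let kap := sin (delta / p) / 4.
Let h := fun om => g (cexp om).

Lemma delta_props : 0 < delta /\ delta <= eps / 8 /\ delta <= p * PI / 8 /\ delta <= (2 - p) * PI / 4.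
Proof.
  assert (HPI := PI_RGT_0). assert (A : 0 < p * PI) by nra. assert (A' : 0 < (2 - p) * PI) by nra.
  unfold delta. split; [repeat apply Rmin_pos; lra|]. split; [apply Rmin_l|].
  split; apply Rle_trans with (1 := Rmin_r _ _); [apply Rmin_l|apply Rmin_r].
Qed.

Lemma delta_div : 0 < delta / p <= PI / 8.
Proof.
  destruct delta_props as (D0 & _ & D2 & _). split. apply Rdiv_lt_0_compat; lra.
  apply Rmult_le_reg_r with p; [lra|]. unfold Rdiv at 1. rewrite Rmult_assoc, Rinv_l by lra. lra.
Qed.

Lemma kap_pos : 0 < kap.
Proof. assert (D := delta_div). unfold kap. assert (0 < sin (delta / p)) by (apply sin_gt_0; lra). lra. Qed.

Lemma angle_ok phi w : Rabs (phi - Im w) <= p * PI / 2 - delta ->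
  4 * kap <= cos (/ p * (phi - Im w)) /\ Rabs (/ p * (phi - Im w)) < PI / 2.
Proof.
  intros H. assert (D := delta_div). destruct delta_props as (D0 & _ & D2 & _).
  assert (E : Rabs (/ p * (phi - Im w)) <= PI / 2 - delta / p).
  { assert (Pp : 0 < / p) by (apply Rinv_0_lt_compat; lra).
    rewrite Rabs_mult, (Rabs_right (/ p)) by lra.
    apply Rle_trans with (/ p * (p * PI / 2 - delta)). apply Rmult_le_compat_l; lra. right; field; lra. }
  split; [|lra].
  replace (4 * kap) with (cos (PI / 2 - delta / p)) by (rewrite cos_shift; unfold kap; field).
  apply cos_ge_of_abs_le; rewrite (Rabs_right (PI / 2 - delta / p)); lra.
Qed.

Lemma h_hol : hol (fun om => theta - eps / 2 < Im om < theta + eps / 2) h.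
Proof.
  intros om Hom. destruct Hext as [H _].
  destruct (proj1 (ex_derive_cder g (cexp om)) (H (cexp om) ltac:(apply in_sector_cexp; exists om; simpl; auto))) as [l Hl].
  eexists. apply (cder_comp g cexp). exact Hl. apply cder_cexp.
Qed.

Lemma h_line_cont phi : theta - eps / 2 < phi < theta + eps / 2 -> line_cont phi h.
Proof. intros Hphi x. destruct (h_hol (x, phi)) as [l Hl]; [exact Hphi|]. exact (ccont_cder _ _ _ Hl). Qed.

Lemma exp_Rpower_m x : Rpower (exp x) (/ p) = exp (/ p * x).
Proof. unfold Rpower. rewrite ln_exp. reflexivity. Qed.

(** The origin of the radius of the sector: the exponent b |zeta|^(1/p) equals b |z|^(1/p) |t|,
    which is at most kap |t| when |z| < (kap / b)^p. *)
Lemma weight_bound b w x : 0 < b -> exp (Re w) < Rpower (kap / b) p -> b * exp (/ p * x) <= kap * Xf p w x.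
Proof.
  intros Hb Hw. assert (K := kap_pos). assert (Kb : 0 < kap / b) by (apply Rdiv_lt_0_compat; lra).
  unfold Rpower in Hw. apply exp_lt_inv in Hw.
  assert (E : exp (/ p * Re w) <= kap / b).
  { rewrite <- (exp_ln (kap / b)) by exact Kb. apply exp_mono.
    apply Rmult_le_reg_l with p; [lra|]. rewrite <- Rmult_assoc, Rinv_r, Rmult_1_l by lra. lra. }
  replace (exp (/ p * x)) with (exp (/ p * Re w) * Xf p w x) by (unfold Xf; rewrite <- exp_plus; f_equal; ring).
  rewrite <- Rmult_assoc. apply Rmult_le_compat_r; [apply Rlt_le, exp_pos|].
  apply Rle_trans with (b * (kap / b)). apply Rmult_le_compat_l; lra. right; field; lra.
Qed.

Lemma borel_coef k : (borel (/ p) c k * RtoC (Gamma (1 + INR k * p)))%C = c k.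
Proof.
  unfold borel. replace (INR k / / p) with (INR k * p) by (field; lra).
  destruct (Gamma_pos p (proj1 Hp) k) as [G _]. field. intros E. injection E. lra.
Qed.

Lemma borel_laplace : exists alpha rho u, p * PI < alpha <= 2 * PI /\ 0 < rho /\
  hol (in_sector (bisected_sector theta alpha (Finite rho))) u /\
  asy p (in_sector (bisected_sector theta alpha (Finite rho))) u c.
Proof.
  destruct delta_props as (D0 & D1 & D2 & D3). assert (K := kap_pos). destruct Hext as [_ (r & Hr & Hser)].
  destruct (Hgrow (theta - 3 * delta) (theta + 3 * delta)) as (r1 & b & B & Hr1 & Hb & HB & Hg); [simpl; lra..|].
  assert (Hgr : forall x phi, theta - 2 * delta <= phi <= theta + 2 * delta -> r1 < exp x -> Cmod (h (x, phi)) <= B * exp (b * exp (/ p * x))).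
  { intros x phi Hphi Hx. specialize (Hg (cexp (x, phi))).
    rewrite Cmod_cexp in Hg. change (Re (x, phi)) with x in Hg. rewrite exp_Rpower_m in Hg. apply Hg; [|exact Hx].
    apply in_sector_cexp. exists (x, phi). unfold Re, Im; simpl. repeat split; lra. }
  assert (Hsr : forall x phi, theta - 2 * delta <= phi <= theta + 2 * delta -> exp x < r -> is_psum (borel (/ p) c) (cexp (x, phi)) (h (x, phi))).
  { intros x phi Hphi Hx. apply fps_sum_is_psum. apply Hser.
    - apply in_sector_cexp. exists (x, phi). unfold Re, Im; simpl. repeat split; lra.
    - rewrite Cmod_cexp. exact Hx. }
  assert (LC : forall phi, theta - 2 * delta <= phi <= theta + 2 * delta -> line_cont phi h).
  { intros phi Hphi. apply h_line_cont. lra. }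
  destruct (line_remainder p (theta + 2 * delta) h (borel (/ p) c) r r1 b B) as (A1 & C1 & HA1 & HC1 & R1); auto.
  { apply LC; lra. } { intros x. apply Hsr; lra. } { intros x. apply Hgr; lra. }
  destruct (line_remainder p (theta - 2 * delta) h (borel (/ p) c) r r1 b B) as (A2 & C2 & HA2 & HC2 & R2); auto.
  { apply LC; lra. } { intros x. apply Hsr; lra. } { intros x. apply Hgr; lra. }
  set (alpha := p * PI + 2 * delta). set (rho := Rpower (kap / b) p).
  (* The line on the same side of theta as w, so that |phi w - Im w| <= p pi / 2 - delta on the
     whole strip of width alpha. *)
  set (phi := fun w : C => if Rlt_dec (Im w) theta then theta - 2 * delta else theta + 2 * delta).
  set (strip := fun w : C => theta - alpha / 2 < Im w < theta + alpha / 2).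
  assert (Hphi : forall w, phi w = theta - 2 * delta \/ phi w = theta + 2 * delta) by (intros w; unfold phi; destruct Rlt_dec; auto).
  assert (Hphi' : forall w, theta - 2 * delta <= phi w <= theta + 2 * delta) by (intros w; destruct (Hphi w) as [-> | ->]; lra).
  assert (Rem : forall w n x, Cmod (h (x, phi w) - psum (borel (/ p) c) n (cexp (x, phi w))) <=
     (A1 + A2) * (C1 + C2) ^ n * exp (INR n * x) * exp (b * exp (/ p * x))).
  { intros w n x. assert (Pn := exp_pos (INR n * x)). assert (Pb := exp_pos (b * exp (/ p * x))).
    assert (Q : forall A C', 0 < A -> 0 < C' -> A <= A1 + A2 -> C' <= C1 + C2 ->
      A * C' ^ n * exp (INR n * x) * exp (b * exp (/ p * x)) <= (A1 + A2) * (C1 + C2) ^ n * exp (INR n * x) * exp (b * exp (/ p * x))).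
    { intros A C' P1 P2 P3 P4. apply Rmult_le_compat_r; [lra|]. apply Rmult_le_compat_r; [lra|].
      apply Rmult_le_compat; [lra|apply pow_le; lra|exact P3|apply pow_incr; lra]. }
    destruct (Hphi w) as [-> | ->]; [eapply Rle_trans; [apply R2|]|eapply Rle_trans; [apply R1|]]; apply Q; lra. }
  assert (Bnd : forall w0 w x, exp (Re w) < rho -> Cmod (h (x, phi w0)) <= (A1 + A2) * exp (kap * Xf p w x)).
  { intros w0 w x Hw. assert (Q := Rem w0 O x). rewrite psum_0 in Q. replace (h (x, phi w0) - 0)%C with (h (x, phi w0)) in Q by ring.
    simpl in Q. rewrite Rmult_0_l, exp_0, !Rmult_1_r in Q. apply Rle_trans with (1 := Q).
    apply Rmult_le_compat_l; [lra|]. apply exp_mono. apply weight_bound; auto. }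
  (* The line chosen for w0 also serves its neighbours, even those across Im w = theta; holomorphy
     needs one line for a whole disc. *)
  assert (Ang : forall w0 w, strip w0 -> strip w -> Rabs (Im w - Im w0) < delta -> Rabs (phi w0 - Im w) <= p * PI / 2 - delta).
  { intros w0 w S0 S1 Hd. apply Rabs_def2 in Hd. unfold strip, alpha in S0, S1. unfold phi.
    destruct Rlt_dec; apply Rabs_le; lra. }
  assert (Ang0 : forall w, strip w -> Rabs (phi w - Im w) <= p * PI / 2 - delta).
  { intros w S0. apply Ang; auto. rewrite Rminus_diag, Rabs_R0. lra. }
  assert (Ex : forall w, strip w -> exp (Re w) < rho -> exists l, lap p (phi w) h w l).
  { intros w S0 Hw. destruct (angle_ok (phi w) w (Ang0 w S0)) as [N1 _].
    destruct (lap_exists p (proj1 Hp) (phi w) h w kap (A1 + A2) K ltac:(lra) (LC _ (Hphi' w)) ltac:(lra)) as (l & L & _).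
    - intros x. apply Bnd, Hw.
    - exists l; exact L. }
  (* Descent from w to z: a strip of width alpha < 2 pi contains at most one logarithm of z, so the
     chosen value is the Laplace integral at that w. *)
  set (u := fun z => epsilon (inhabits (RtoC 0)) (fun l => exists w, cexp w = z /\ strip w /\ lap p (phi w) h w l)).
  assert (Spec : forall w, strip w -> exp (Re w) < rho -> lap p (phi w) h w (u (cexp w))).
  { intros w S0 Hw. destruct (Ex w S0 Hw) as [l Hl].
    assert (E := epsilon_spec (inhabits (RtoC 0)) (fun l => exists w', cexp w' = cexp w /\ strip w' /\ lap p (phi w') h w' l)
       (ex_intro _ l (ex_intro _ w (conj eq_refl (conj S0 Hl))))).
    destruct E as (w' & E1 & E2 & E3).
    assert (Ew : w' = w).
    { apply cexp_inj; [exact E1|]. unfold strip, alpha in S0, E2. apply Rabs_def1; lra. }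
    rewrite Ew in E3. exact E3. }
  (* phi jumps at Im w = theta; near there both lines are admissible and give the same value. *)
  assert (Near : forall w0 w, strip w0 -> strip w -> exp (Re w) < rho -> Rabs (Im w - Im w0) < delta -> lap p (phi w0) h w (u (cexp w))).
  { intros w0 w S0 S1 Hw Hd.
    destruct (Req_dec (phi w0) (phi w)) as [E|E]; [rewrite E; apply Spec; auto|].
    assert (Hov : theta - delta < Im w < theta + delta).
    { apply Rabs_def2 in Hd. unfold phi in E. destruct (Rlt_dec (Im w0) theta), (Rlt_dec (Im w) theta); try (exfalso; apply E; reflexivity); lra. }
    assert (AngM : forall phi', theta - 2 * delta <= phi' <= theta + 2 * delta -> 2 * kap <= cos (/ p * (phi' - Im w))).
    { intros phi' H'. destruct (angle_ok phi' w) as [N1 _]; [apply Rabs_le; lra|lra]. }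
    assert (LCm : exists l, lap p (phi w0) h w l).
    { destruct (lap_exists p (proj1 Hp) (phi w0) h w kap (A1 + A2) K ltac:(lra) (LC _ (Hphi' w0)) (AngM _ (Hphi' w0))) as (l & L & _).
      intros x. apply Bnd, Hw. exists l; exact L. }
    destruct LCm as [l0 Hl0]. assert (Hl1 := Spec w S1 Hw).
    destruct (is_psum_geometric_coef (borel (/ p) c) (cexp (ln (r / 2), theta)) (h (ln (r / 2), theta))) as (B0 & HB0 & Hcoef).
    { rewrite Cmod_cexp. apply exp_pos. } { apply Hsr; [lra|]. rewrite exp_ln; lra. }
    rewrite Cmod_cexp in Hcoef. change (Re (ln (r / 2), theta)) with (ln (r / 2)) in Hcoef. rewrite exp_ln in Hcoef by lra.
    replace (/ (r / 2)) with (2 / r) in Hcoef by (field; lra).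
    (* A bound uniform in phi' comes from the growth of g for large positive x and from the power
       series for very negative x; [lap_shift] asks for no more. *)
    assert (Far : exists X0, forall x phi', X0 <= Rabs x -> theta - 2 * delta <= phi' <= theta + 2 * delta -> Cmod (h (x, phi')) <= (B + 2 * B0) * exp (kap * Xf p w x)).
    { exists (Rmax (Rmax (Rabs (ln (r / 4))) (Rabs (ln r1))) 0 + 1). intros x phi' Hx H'.
      assert (X1 := Rle_trans _ _ _ (Rle_trans _ _ _ (Rle_abs (- ln (r / 4))) (Rle_trans _ _ _ (Req_le _ _ (Rabs_Ropp _)) (Rmax_l _ (Rabs (ln r1))))) (Rmax_l _ 0)).
      assert (X2 := Rle_trans _ _ _ (Rle_trans _ _ _ (Rle_abs (ln r1)) (Rmax_r (Rabs (ln (r / 4))) _)) (Rmax_l _ 0)).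
      assert (Pe : 1 <= exp (kap * Xf p w x)).
      { rewrite <- exp_0. apply exp_mono. generalize (Xf_pos p w x). nra. }
      destruct (Rle_dec 0 x) as [Hx0|Hx0].
      - rewrite (Rabs_right x) in Hx by lra.
        apply Rle_trans with (B * exp (b * exp (/ p * x))).
        + apply Hgr; [exact H'|]. rewrite <- (exp_ln r1) by exact Hr1. apply exp_increasing. lra.
        + apply Rmult_le_compat; [lra|apply Rlt_le, exp_pos|lra|]. apply exp_mono, weight_bound; auto.
      - rewrite (Rabs_left x) in Hx by lra.
        assert (Hxr : exp x < r / 4) by (rewrite <- (exp_ln (r / 4)) by lra; apply exp_increasing; lra).
        assert (T := psum_tail_bound (borel (/ p) c) (cexp (x, phi')) (h (x, phi')) B0 (2 / r)).
        assert (Hr2 : 0 < 2 / r) by (apply Rdiv_lt_0_compat; lra).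
        specialize (T Hr2). rewrite Cmod_cexp in T. change (Re (x, phi')) with x in T.
        assert (T' := T ltac:(apply Rle_trans with (2 / r * (r / 4)); [apply Rmult_le_compat_l; lra|right; field; lra])).
        specialize (T' Hcoef (Hsr x phi' H' ltac:(lra)) O). rewrite psum_0 in T'. replace (h (x, phi') - 0)%C with (h (x, phi')) in T' by ring.
        simpl in T'. rewrite !Rmult_1_r in T'. apply Rle_trans with (1 := T'). nra. }
    destruct Far as [X0 Far].
    assert (E2 : forall l1 l2, lap p (theta - 2 * delta) h w l1 -> lap p (theta + 2 * delta) h w l2 -> l1 = l2).
    { intros l1 l2 L1 L2.
      apply (lap_shift p (proj1 Hp) (theta - 2 * delta) (theta + 2 * delta) delta h w kap (B + 2 * B0) X0 l1 l2 D0 K ltac:(lra) ltac:(lra)); auto.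
      intros om Hom. apply h_hol. lra. }
    destruct (Hphi w0) as [F0|F0], (Hphi w) as [F1|F1]; rewrite F0 in *; rewrite F1 in *; try (exfalso; apply E; reflexivity).
    - rewrite <- (E2 _ _ Hl0 Hl1). exact Hl0.
    - rewrite (E2 _ _ Hl1 Hl0). exact Hl0. }
  exists alpha, rho, u.
  split; [unfold alpha; lra|]. split; [apply exp_pos|].
  assert (In : forall w, in_sector (bisected_sector theta alpha (Finite rho)) (cexp w) -> exists w', cexp w' = cexp w /\ strip w' /\ exp (Re w') < rho).
  { intros w Hw. apply in_sector_cexp in Hw. destruct Hw as (w' & E & Hr' & Hs). exists w'. split; [symmetry; exact E|]. split; [exact Hs|exact Hr']. }
  split.
  - intros z Hz. assert (Hz' := Hz). apply in_sector_cexp in Hz'. destruct Hz' as (w0 & Ez & Hw0 & S0). simpl in Hw0, S0.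
    assert (Hd : exists d, 0 < d /\ forall w, Cmod (w - w0) < d -> strip w /\ exp (Re w) < rho /\ Rabs (Im w - Im w0) < delta).
    { assert (Lr : Re w0 < ln rho) by (rewrite <- (ln_exp (Re w0)); apply ln_increasing; [apply exp_pos|exact Hw0]).
      exists (Rmin (Rmin (Im w0 - (theta - alpha / 2)) (theta + alpha / 2 - Im w0)) (Rmin (ln rho - Re w0) delta)).
      split; [repeat apply Rmin_pos; lra|]. intros w Hw.
      apply Rmin_Rgt in Hw. destruct Hw as [W1 W2]. apply Rmin_Rgt in W1. apply Rmin_Rgt in W2.
      generalize (re_sub_le w w0) (im_sub_le w w0). intros Q1 Q2.
      split; [|split].
      - apply Rabs_le_between in Q2. unfold strip. lra.
      - apply Rabs_le_between in Q1. rewrite <- (exp_ln rho) by apply exp_pos. apply exp_increasing. lra.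
      - lra. }
    destruct Hd as (d & Hd & Hball).
    (* The line is frozen at [phi w0]; [Near] says that on the disc about w0 it still computes u. *)
    destruct (lap_hol p (proj1 Hp) (phi w0) h (fun w => u (cexp w)) w0 d kap (A1 + A2) Hd K ltac:(lra) (LC _ (Hphi' w0))) as [l Hl].
    + intros w Hw. destruct (Hball w Hw) as (B1 & B2 & B3). destruct (angle_ok (phi w0) w (Ang w0 w S0 B1 B3)). lra.
    + intros w x Hw. apply Bnd. apply Hball, Hw.
    + intros w Hw. destruct (Hball w Hw) as (B1 & B2 & B3). apply Near; auto.
    + destruct (local_log z w0 (eq_sym Ez)) as (Lg & E1 & E2).
      assert (Pz : 0 < Cmod z) by (rewrite Ez, Cmod_cexp; apply exp_pos).
      destruct (E2 z) as [[l' Hl'] _]; [rewrite Cmod_zero_sub; lra|].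
      exists (l * l')%C. apply cder_ext_loc with (fun z => u (cexp (Lg z))).
      * exists (/ 2 * Cmod z). split; [lra|]. intros w Hw. rewrite (proj2 (E2 w Hw)). reflexivity.
      * apply (cder_comp (fun w => u (cexp w)) Lg); [|exact Hl']. rewrite E1. exact Hl.
  - exists ((A1 + A2) / kap), ((C1 + C2) * lap_weight p kap).
    assert (LW : 0 < lap_weight p kap) by apply exp_pos.
    split; [apply Rdiv_lt_0_compat; lra|]. split; [nra|]. intros n z Hz.
    apply in_sector_cexp in Hz. destruct Hz as (w & -> & Hw & S0). simpl in Hw, S0. fold (strip w) in S0.
    destruct (angle_ok (phi w) w (Ang0 w S0)) as [N1 N2].
    assert (LP := lap_psum p (proj1 Hp) (phi w) w kap (borel (/ p) c) n K ltac:(lra) N2).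
    assert (LCp : line_cont (phi w) (fun om => psum (borel (/ p) c) n (cexp om))).
    { intros x. eapply ccont_cder. apply (cder_comp (psum (borel (/ p) c) n) cexp). apply cder_psum. apply cder_cexp. }
    assert (LD := lap_ext_scal_minus p (phi w) _ _ 1 w _ _ (LC _ (Hphi' w)) LCp (Spec w S0 Hw) LP).
    rewrite Cmod_cexp.
    replace (u (cexp w) - psum c n (cexp w))%C with (u (cexp w) - 1 * psum (fun k => borel (/ p) c k * RtoC (Gamma (1 + INR k * p)))%C n (cexp w))%C.
    2:{ rewrite !psum_csum. rewrite (csum_ext _ (fun k => c k * cexp w ^ k)%C). ring. intros i _. rewrite borel_coef. reflexivity. }
    eapply Rle_trans. eapply (lap_gevrey_bound p (proj1 Hp) (phi w) _ w kap ((A1 + A2) * (C1 + C2) ^ n) n); [exact K| | |exact N1| |exact LD].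
    + apply Rmult_le_pos; [lra|apply pow_le; lra].
    + intros x.
      intros e He. assert (Q : ccont (fun om => h om + (- (1)) * psum (borel (/ p) c) n (cexp om))%C (x, phi w)).
      { apply ccont_plus. apply (LC _ (Hphi' w)). apply ccont_scal. apply LCp. }
      destruct (Q e He) as (d & Hd & Hq). exists d. split; [exact Hd|]. intros om Hom. specialize (Hq om Hom).
      replace (h om - 1 * psum (borel (/ p) c) n (cexp om) - (h (x, phi w) - 1 * psum (borel (/ p) c) n (cexp (x, phi w))))%C with
        (h om + (- (1)) * psum (borel (/ p) c) n (cexp om) - (h (x, phi w) + (- (1)) * psum (borel (/ p) c) n (cexp (x, phi w))))%C by ring.
      exact Hq.
    + intros x. cbv beta. rewrite Cmult_1_l. apply Rle_trans with (1 := Rem w n x).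
      apply Rmult_le_compat_l. repeat apply Rmult_le_pos; try lra. apply pow_le; lra. apply Rlt_le, exp_pos.
      apply exp_mono, weight_bound; auto.
    + right. unfold Rdiv. rewrite Rpow_mult_distr. ring.
Qed.

End Construction.

(** * Coefficients, right-hand side and vanishing of the residual *)

Lemma geometric_asy_sub (S S' : C -> Prop) a c : (forall z, S' z -> S z) -> geometric_asy S a c -> geometric_asy S' a c.
Proof. intros H (A & L & HA & HL & Hc & Ha). exists A, L. repeat split; auto. Qed.

Lemma geometric_asy_taylor D a : copen D -> D 0 -> hol D a ->
  exists rho, 0 < rho /\ geometric_asy (fun z => Cmod z < rho) a (taylor a).
Proof.
  intros HD D0 Ha.
  destruct (HD 0 D0) as (d & Hd & H1).
  destruct (Ha 0 D0) as [l Hl].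
  destruct (ccont_cder _ _ _ Hl 1 Rlt_0_1) as (d' & Hd' & H2).
  assert (Hm : 0 < Rmin d d') by (apply Rmin_pos; auto).
  assert (M0 := Cmod_ge_0 (a 0)).
  destruct (taylor_series a (Rmin d d') (Cmod (a 0) + 1) Hm) as [T1 T2].
  - intros z Hz. apply Ha, H1. replace (z - 0)%C with z by ring. generalize (Rmin_l d d'); lra.
  - intros z Hz. specialize (H2 z). replace (z - 0)%C with z in H2 by ring.
    generalize (Cmod_rtriangle (a z) (a 0)) (H2 ltac:(generalize (Rmin_r d d'); lra)). lra.
  - set (r := Rmin d d') in *. exists (r / 8). split; [lra|].
    assert (HL : 0 < 4 / r) by (apply Rdiv_lt_0_compat; lra).
    exists (2 * (2 * (Cmod (a 0) + 1))), (4 / r). split; [lra|]. split; [exact HL|]. split.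
    + intros n. apply Rle_trans with (1 := T1 n). apply Rmult_le_compat_r; [apply pow_le; lra|lra].
    + intros n z Hz. apply psum_tail_bound; [exact HL| |exact T1|apply T2; lra].
      apply Rle_trans with (4 / r * (r / 8)). apply Rmult_le_compat_l; lra. right; field; lra.
Qed.

Lemma geometric_asy_taylors D a N : copen D -> D 0 -> (forall j, (j <= N)%nat -> hol D (a j)) ->
  exists rho, 0 < rho /\ forall j, (j <= N)%nat -> geometric_asy (fun z => Cmod z < rho) (a j) (taylor (a j)).
Proof.
  intros HD D0 Ha. induction N as [|N IH].
  - destruct (geometric_asy_taylor D (a O) HD D0 (Ha O (le_n _))) as (rho & Hr & H).
    exists rho. split; [exact Hr|]. intros j Hj. replace j with O by lia. exact H.
  - destruct IH as (rho & Hr & H); [intros; apply Ha; lia|].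
    destruct (geometric_asy_taylor D (a (S N)) HD D0 (Ha (S N) (le_n _))) as (rho' & Hr' & H').
    exists (Rmin rho rho'). split; [apply Rmin_pos; auto|]. intros j Hj.
    destruct (Nat.eq_dec j (S N)) as [->|].
    + apply geometric_asy_sub with (2 := H'). intros z Hz. generalize (Rmin_r rho rho'); lra.
    + apply geometric_asy_sub with (2 := H j ltac:(lia)). intros z Hz. generalize (Rmin_l rho rho'); lra.
Qed.

Lemma geometric_asy_sum f : fps_convergent f -> exists F rho, 0 < rho /\
  (forall z, Cmod z < rho -> is_psum f z (F z)) /\ hol (fun z => Cmod z < rho) F /\
  geometric_asy (fun z => Cmod z < rho) F f.
Proof.
  intros (r & Hr & H).
  set (F := fun z => epsilon (inhabits (RtoC 0)) (fun l => is_psum f z l)).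
  assert (HF : forall z, Cmod z < r -> is_psum f z (F z)).
  { intros z Hz. apply (epsilon_spec (inhabits (RtoC 0)) (fun l => is_psum f z l)).
    destruct (H z Hz) as [l Hl]. exists l. apply fps_sum_is_psum, Hl. }
  assert (Mr : Cmod (RtoC (r / 2)) = r / 2) by (rewrite Cmod_R, Rabs_right; lra).
  destruct (is_psum_geometric_coef f (RtoC (r / 2)) (F (RtoC (r / 2)))) as (B & HB & Hcoef).
  { lra. } { apply HF. lra. }
  rewrite Mr in Hcoef. replace (/ (r / 2)) with (2 / r) in Hcoef by (field; lra).
  exists F, (r / 4). split; [lra|]. split; [intros z Hz; apply HF; lra|]. split.
  - intros z Hz. destruct (power_series_cder f r F HF z) as (l & L & _); [lra|]. exists l; exact L.
  - assert (HL : 0 < 2 / r) by (apply Rdiv_lt_0_compat; lra).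
    exists (2 * B), (2 / r). split; [lra|]. split; [exact HL|]. split.
    + intros n. apply Rle_trans with (1 := Hcoef n). apply Rmult_le_compat_r; [apply pow_le; lra|lra].
    + intros n z Hz. apply psum_tail_bound; [exact HL| |exact Hcoef|apply HF; lra].
      apply Rle_trans with (2 / r * (r / 4)). apply Rmult_le_compat_l; lra. right; field; lra.
Qed.

Lemma hol_sub (D D' : C -> Prop) f : (forall z, D' z -> D z) -> hol D f -> hol D' f.
Proof. intros H Hf z Hz. apply Hf, H, Hz. Qed.

Lemma hol_diffop N a u D : copen D -> hol D u -> (forall j, (j <= N)%nat -> hol D (a j)) -> hol D (diffop N a u).
Proof.
  intros HD Hu Ha.
  assert (T : forall j, (j <= N)%nat -> hol D (fun z => a j z * C_derive_n u j z)%C).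
  { intros j Hj z Hz. destruct (Ha j Hj z Hz) as [l Hl]. destruct (hol_C_derive_n u D j HD Hu z Hz) as [l' Hl'].
    eexists. apply cder_mult; [exact Hl|exact Hl']. }
  clear Ha. induction N as [|N IH]; intros z Hz.
  - destruct (T O (le_n _) z Hz) as [l Hl]. exists l.
    apply cder_ext with (2 := Hl). intros w. unfold diffop. rewrite sum_O. reflexivity.
  - destruct (IH ltac:(intros; apply T; lia) z Hz) as [l Hl]. destruct (T (S N) (le_n _) z Hz) as [l' Hl'].
    exists (l + l')%C. eapply cder_ext; [|apply cder_plus; [exact Hl|exact Hl']].
    intros w. unfold diffop. rewrite sum_Sn. reflexivity.
Qed.

(* In the coordinate v with z = e^(i theta - p v) the sector becomes a half-strip wider than pi. *)
Lemma watson_sector p theta a1 a2 r1 h : 0 < p -> p * PI < a2 < a1 -> 0 < r1 ->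
  hol (in_sector (bisected_sector theta a1 (Finite r1))) h ->
  asy p (in_sector (bisected_sector theta a1 (Finite r1))) h (fun _ => RtoC 0) ->
  exists r2, 0 < r2 <= r1 /\ forall z, in_sector (bisected_sector theta a2 (Finite r2)) z -> h z = 0.
Proof.
  intros Hp Ha Hr Hh Hasy. destruct (asy_0_flat p (in_sector (bisected_sector theta a1 (Finite r1))) h Hp) as (M & c & HM & Hc & Hflat); [|exact Hasy|].
  { intros z Hz. apply in_sector_cexp in Hz. destruct Hz as (w & -> & _). rewrite Cmod_cexp. apply exp_pos. }
  set (zeta := fun v : C => ((0, theta) - RtoC p * v)%C).
  assert (Rz : forall v, Re (zeta v) = - (p * Re v)) by (intros v; unfold zeta; rewrite Re_Cminus, Re_scal; unfold Re; simpl; ring).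
  assert (Iz : forall v, Im (zeta v) = theta - p * Im v) by (intros v; unfold zeta; rewrite Im_Cminus, Im_scal; unfold Im; simpl; ring).
  set (R0 := - ln r1 / p). set (B := a1 / (2 * p)). set (B' := a2 / (2 * p)).
  assert (EB : p * B = a1 / 2) by (unfold B; field; lra).
  assert (EB' : p * B' = a2 / 2) by (unfold B'; field; lra).
  assert (HB : PI / 2 < B' < B).
  { split; apply Rmult_lt_reg_l with p; lra. }
  assert (In : forall v, R0 < Re v -> - B < Im v < B -> in_sector (bisected_sector theta a1 (Finite r1)) (cexp (zeta v))).
  { intros v V1 V2. apply in_sector_cexp. exists (zeta v). split; [reflexivity|]. rewrite Rz, Iz. simpl. split.
    - rewrite <- (exp_ln r1) by exact Hr. apply exp_increasing.
      apply (Rmult_lt_compat_l p) in V1; [|exact Hp]. unfold R0 in V1.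
      replace (p * (- ln r1 / p)) with (- ln r1) in V1 by (field; lra). lra.
    - destruct V2 as [V2 V3]. apply (Rmult_lt_compat_l p) in V2; [|exact Hp]. apply (Rmult_lt_compat_l p) in V3; [|exact Hp]. lra. }
  destruct (watson (fun v => h (cexp (zeta v))) R0 B M c ltac:(lra) HM Hc) with (B' := B') as (R1 & HR1 & W); [| |lra|].
  - intros v [V1 V2]. destruct (Hh _ (In v V1 V2)) as [l Hl]. eexists.
    apply (cder_comp h (fun v => cexp (zeta v))). exact Hl.
    apply (cder_comp cexp zeta). apply cder_cexp.
    unfold zeta. apply cder_minus. apply cder_const. apply cder_scal, cder_id.
  - intros v V1 V2. replace (exp (Re v)) with (Rpower (/ Cmod (cexp (zeta v))) (/ p)).
    + apply Hflat, In; auto.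
    + rewrite Cmod_cexp, Rz, <- exp_Ropp, Ropp_involutive. unfold Rpower. rewrite ln_exp. f_equal. field. lra.
  - exists (Rmin r1 (exp (- (p * R1)))). split; [split; [apply Rmin_pos; [exact Hr|apply exp_pos]|apply Rmin_l]|].
    intros z Hz. apply in_sector_cexp in Hz. destruct Hz as (w & -> & Hw & Hi). simpl in Hw, Hi.
    set (v := (RtoC (/ p) * ((0, theta) - w))%C).
    assert (Ev : zeta v = w).
    { unfold zeta, v. rewrite RtoC_inv by lra. field. intros E; injection E; lra. }
    assert (Rv := Rz v). assert (Iv := Iz v). rewrite Ev in Rv, Iv.
    rewrite <- Ev. apply W.
    + assert (L : exp (Re w) < exp (- (p * R1))) by (apply Rlt_le_trans with (1 := Hw), Rmin_r).
      apply exp_lt_inv in L. apply Rmult_lt_reg_l with p; lra.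
    + split; apply Rmult_le_reg_l with p; lra.
Qed.

Lemma fact_pow_succ n s : fact_pow n s = INR (fact n) * fact_pow n (s - 1).
Proof.
  unfold fact_pow. rewrite <- (Rpower_1 (INR (fact n))) at 2 by apply INR_fact_pos.
  rewrite <- Rpower_plus. f_equal. ring.
Qed.

Theorem mainTheorem4 :
  forall (N : nat) (U : C -> Prop) (a : nat -> C -> C)
         (s : R) (uhat f : fps) (theta epsilon : R),
    open (T := C_UniformSpace) U -> U (RtoC 0) ->
    (forall j : nat, (j <= N)%nat -> holomorphic_on U (a j)) ->
    1 < s < 3 ->
    gevrey_fps s uhat ->
    fps_convergent f ->
    (forall k : nat, diffop_fps N a uhat k = f k) ->
    - PI <= theta <= PI ->
    0 < epsilon <= 2 * PI ->
    (exists g : C -> C,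
        extends_fps (borel (/ (s - 1)) uhat)
          (bisected_sector theta epsilon p_infty) g /\
        exp_growth (/ (s - 1)) (bisected_sector theta epsilon p_infty) g) ->
    exists (alpha : R) (rho : Rbar) (u : C -> C),
      (s - 1) * PI < alpha <= 2 * PI /\
      Rbar_lt 0 rho /\
      (forall z : C, in_sector (bisected_sector theta alpha rho) z -> U z) /\
      gevrey_on s (bisected_sector theta alpha rho) u /\
      gevrey_asymp s (bisected_sector theta alpha rho) u uhat /\
      (forall z : C, in_sector (bisected_sector theta alpha rho) z ->
         fps_sum f z (diffop N a u z)).
Proof.
  intros N U a s uhat f theta eps HU U0 Ha Hs _ Hf HPf _ Heps (g & Hg1 & Hg2).
  set (p := s - 1) in *. assert (Hp : 0 < p < 2) by (unfold p; lra).
  assert (HUo : copen U) by (intros z Hz; apply locally_C_Cmod, HU, Hz).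
  assert (Ha' : forall j, (j <= N)%nat -> hol U (a j)).
  { intros j Hj z Hz. apply ex_derive_cder. exact (Ha j Hj z Hz). }
  destruct (borel_laplace p theta eps uhat g Hp (proj1 Heps) Hg1 Hg2) as (al0 & rho0 & u & Hal & Hrho & Hu & Has).
  (* Equal steps from al0 down towards p pi: Cauchy's discs lead from al0 to al1, Watson's lemma
     from al1 to al2. *)
  set (al1 := (p * PI + 2 * al0) / 3). set (al2 := (2 * (p * PI) + al0) / 3).
  destruct (geometric_asy_taylors U a N HUo U0 Ha') as (rhoa & Hra & Hga).
  destruct (geometric_asy_sum f Hf) as (F & rhoF & HrF & HF1 & HF2 & HF3).
  destruct (HUo 0 U0) as (rU & HrU & HU').
  (* rho0 / 2 leaves the strict inequality that [sector_ball] needs; the other radii serve the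
     coefficients, the sum of f and the inclusion in U. *)
  set (rho1 := Rmin (rho0 / 2) (Rmin rhoa (Rmin rhoF rU))).
  assert (Hr1 : 0 < rho1) by (unfold rho1; repeat apply Rmin_pos; lra).
  assert (Q0 : rho1 <= rho0 / 2) by apply Rmin_l.
  assert (Qa : rho1 <= rhoa) by (unfold rho1; eapply Rle_trans; [apply Rmin_r|apply Rmin_l]).
  assert (QF : rho1 <= rhoF) by (unfold rho1; eapply Rle_trans; [apply Rmin_r|]; eapply Rle_trans; [apply Rmin_r|apply Rmin_l]).
  assert (QU : rho1 <= rU) by (unfold rho1; eapply Rle_trans; [apply Rmin_r|]; eapply Rle_trans; [apply Rmin_r|apply Rmin_r]).
  destruct (sector_ball theta al0 al1 rho0 rho1) as (kappa & Hk & Hball); [unfold al1; lra|lra|].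
  set (S0 := in_sector (bisected_sector theta al0 (Finite rho0))) in *.
  set (S1 := in_sector (bisected_sector theta al1 (Finite rho1))) in *.
  assert (S1r : forall z, S1 z -> Cmod z < rho1).
  { intros z Hz. apply in_sector_cexp in Hz. destruct Hz as (w & -> & Hw & _). rewrite Cmod_cexp. exact Hw. }
  assert (S10 : forall z, S1 z -> S0 z).
  { intros z. apply in_sector_mono; [unfold al1; lra|lra]. }
  assert (S1U : forall z, S1 z -> U z).
  { intros z Hz. apply HU'. replace (z - 0)%C with z by ring. generalize (S1r z Hz); lra. }
  assert (Hdiff : asy p S1 (fun z => diffop N a u z + - F z)%C (fun _ => RtoC 0)).
  { eapply asy_ext; [reflexivity| |apply asy_plus; [apply (asy_diffop p N a S0 S1 kappa u uhat)|apply asy_opp, (geometric_asy_asy p S1 F f)]].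
    - intros k. cbv beta. rewrite HPf. ring.
    - lra.
    - exact Hk.
    - apply copen_in_sector.
    - exact Hu.
    - exact Hball.
    - intros j Hj. apply geometric_asy_sub with (2 := Hga j Hj). intros z Hz. generalize (S1r z Hz); lra.
    - exact Has.
    - lra.
    - apply geometric_asy_sub with (2 := HF3). intros z Hz. generalize (S1r z Hz); lra. }
  assert (Hhol : hol S1 (fun z => diffop N a u z + - F z)%C).
  { intros z Hz.
    destruct (hol_diffop N a u S1 (copen_in_sector _) (hol_sub _ _ _ S10 Hu) (fun j Hj => hol_sub _ _ _ S1U (Ha' j Hj)) z Hz) as [l Hl].
    destruct (HF2 z) as [l' Hl']; [generalize (S1r z Hz); lra|].
    eexists. apply cder_plus; [exact Hl|apply cder_opp; exact Hl']. }
  destruct (watson_sector p theta al1 al2 rho1 _ (proj1 Hp) ltac:(unfold al1, al2; lra) Hr1 Hhol Hdiff) as (rho2 & Hr2 & W).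
  assert (S21 : forall z, in_sector (bisected_sector theta al2 (Finite rho2)) z -> S1 z).
  { intros z. apply in_sector_mono; [unfold al1, al2; lra|lra]. }
  exists al2, (Finite rho2), u.
  split; [unfold al2; lra|]. split; [simpl; lra|]. split; [intros z Hz; apply S1U, S21, Hz|].
  split; [split|split].
  - intros z Hz. apply ex_derive_cder. apply Hu, S10, S21, Hz.
  - intros S' HS'.
    (* At n = 0 the bound reads M K^k k! k!^(s - 1), which is the growth allowed for derivatives in
       [gevrey_on]. *)
    destruct (asy_C_derive_n p S0 S1 kappa u uhat ltac:(lra) Hk (copen_in_sector _) Hu Hball Has) as (M & K & HM & HK & HC).
    exists M, K. split; [exact HM|]. split; [exact HK|]. intros k z Hz.
    specialize (HC k O z (S21 z (in_proper_subsector _ _ z HS' Hz))).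
    rewrite psum_0 in HC. replace (C_derive_n u k z - 0)%C with (C_derive_n u k z) in HC by ring.
    rewrite fact_pow_succ. fold p. simpl in HC. lra.
  - intros S' HS'. destruct Has as (M & K & HM & HK & HC). exists M, K. split; [exact HM|]. split; [exact HK|].
    intros n z Hz. apply HC, S10, S21, (in_proper_subsector _ _ z HS' Hz).
  - intros z Hz. apply fps_sum_is_psum.
    replace (diffop N a u z) with (F z). apply HF1. generalize (S1r z (S21 z Hz)); lra.
    assert (E := W z Hz). cbv beta in E. replace (F z) with (F z + 0)%C by ring. rewrite <- E. ring.
Qed.
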